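(* Let $F=F(X)$ be an $\mathbb{N}$-valued random variable in $L^2(P)$ with mean $\mu$ and variance $\sigma^2$. Then $$d_{TV}(F,\mathrm{Pn}(\theta))\le\left(1\wedge\sqrt{\tfrac{2}{e\theta}}\right)|\theta-\mu|+\frac{1-e^{-\theta}}{\theta}\left(E|\theta-Z|+E\left[\sum_{i=1}^{\infty}\big[2(\mathfrak{d}_iF)^2+\mathfrak{D}_iF\big]\,\big|E[\mathfrak{D}_iF|\mathcal{F}_i]\big|\right]\right)$$ and the right-hand side is in turn bounded by $$\left(1\wedge\sqrt{\tfrac{2}{e\theta}}\right)|\theta-\mu|+\frac{1-e^{-\theta}}{\theta}\left(|\theta-\sigma^2|+\sqrt{\mathrm{Var}(Z)}+2\mathcal{L}_3(F)+\mathcal{L}_2(F)\right),$$ where $Z:=\sum_{i=1}^{\infty}\mathfrak{D}_iF\,E[\mathfrak{D}_iF|\mathcal{F}_i]$.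
   Context: $\mathbb{N}=\{0,1,2,\dots\}$ and $a\wedge b=\min(a,b)$. $\mathrm{Pn}(\theta)$ is a Poisson random variable with parameter $\theta>0$. $d_{TV}(F,\mathrm{Pn}(\theta))=\sup_{A\subseteq\mathbb{N}}|P(F\in A)-P(\mathrm{Pn}(\theta)\in A)|$. $X=(X_1,X_2,\dots)$ is a sequence of independent random variables (not necessarily identically distributed) on a probability space $(\Omega,\mathfrak{F},P)$ with values in a measurable space $\mathcal{X}$. $F=F(X)$ means that $F$ is a measurable function of the sequence $X$. $X'=(X_1',X_2',\dots)$ is an independent copy of $X$, and $T_iF=F(X_1,\dots,X_{i-1},X_i',X_{i+1},\dots)$ for $i\ge1$. $E_i$ and $E_i'$ denote the expectations with respect to $X_i$ and $X_i'$, respectively; in particular $E_i[F]=E[F|\sigma(X_k,k\neq i)]$. Difference operators: $\mathfrak{D}_iF=F-E_i[F]$ for $F\in L^1(P)$, and $\mathfrak{d}_iF=\big(\tfrac12E_i'|F-T_iF|^2\big)^{1/2}$ for $F\in L^2(P)$, $i\ge1$. $\mathcal{F}_i=\sigma(X_k,k\le i)$. Generalized Lyapunov ratio: $\mathcal{L}_r(F):=\sum_{i=1}^\infty E|\mathfrak{D}_iF|^r$, $r>0$. *)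

(* Defs.v *)
From HB Require Import structures.
From mathcomp Require Import all_boot all_order all_algebra.
From mathcomp Require Import all_classical all_reals all_analysis measurable_realfun.

Set Implicit Arguments.
Unset Strict Implicit.
Unset Printing Implicit Defensive.

Import Order.TTheory GRing.Theory Num.Theory.
Import numFieldNormedType.Exports.

Local Open Scope classical_set_scope.
Local Open Scope ring_scope.
Local Open Scope charge_scope.

(* The cylinders generating the product sigma-algebra on sequences. *)
Definition cylinders d' (S : measurableType d') : set_system (nat -> S) :=
  \bigcup_i preimage_set_system setT (fun x : nat -> S => x i) measurable.
Arguments cylinders {d'} S.

Notation seq_space S := (g_sigma_algebraType (cylinders S)).

(* sigma(X_k, k \in I) *)
Definition sigma_family d' (T : Type) (S : measurableType d')
    (I : set nat) (X : nat -> T -> S) : set_system T :=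
  <<s \bigcup_(k in I) preimage_set_system setT (X k) measurable >>.

Section conditional_expectation.
Context d (T : measurableType d) (R : realType) (P : probability T R).
Implicit Types (G : set_system T) (Y W : T -> R).

(* W is a version of E[Y | G]. *)
Definition is_cond_exp G Y W : Prop :=
  [/\ forall B : set R, measurable B -> G (W @^-1` B),
      P.-integrable setT (EFin \o W) &
      forall A, G A ->
        (\int[P]_(w in A) (W w)%:E = \int[P]_(w in A) (Y w)%:E)%E].

(* An arbitrarily chosen version of E[Y | G]; cond_expP shows that there is one. *)
Definition cond_exp G Y : T -> R := xget (cst 0) (is_cond_exp G Y).

Lemma cond_expP G Y : sigma_algebra setT G -> G `<=` measurable ->
  P.-integrable setT (EFin \o Y) -> is_cond_exp G Y (cond_exp G Y).
Proof.
move=> sG Gm iY; rewrite /cond_exp; apply: xgetPex.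
have GE : <<s G >> = G by exact: sigma_algebra_id.
have mY A : measurable_fun A (EFin \o Y).
  exact: measurable_funTS (measurable_int P iY).
pose i : T -> g_sigma_algebraType G := idfun.
have mi : measurable_fun setT i.
  by move=> _ B; rewrite setTI /measurable/= GE; exact: Gm.
pose I : {mfun T >-> g_sigma_algebraType G} :=
  HB.pack i (isMeasurableFun.Build _ _ _ _ i mi).
pose Q : probability _ R := distribution P I.
have [nu nuE] : exists nu : {charge set (g_sigma_algebraType G) -> \bar R},
    forall A, nu A = (\int[P]_(w in A) (Y w)%:E)%E.
  by unshelve eexists (pushforward (induced_charge iY) i).
have nuQ : nu `<< Q.
  apply/null_content_dominatesP => A mA QA.
  have mA' : measurable (A : set T) by apply: Gm; rewrite -GE.
  rewrite nuE; exact: null_set_integral.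
pose W := 'd nu '/d Q.
have iW : Q.-integrable setT W by exact: Radon_Nikodym_integrable.
have mW : measurable_fun setT W by exact: (measurable_int Q).
have iWP : P.-integrable setT (W \o i).
  apply/integrableP; split; first exact: measurableT_comp.
  case/integrableP : iW => _; rewrite ge0_integral_pushforward//.
  exact: measurableT_comp.
have WE : EFin \o (fine \o W) = W \o i.
  by apply/funext => w /=; rewrite fineK// Radon_Nikodym_fin_num.
exists (fine \o W); split.
- move=> B mB; have : measurable_fun setT (fine \o W) by exact: measurableT_comp.
  by move=> /(_ measurableT _ mB); rewrite setTI /measurable/= GE.
- by rewrite WE.
- move=> A GA.
  have mA : measurable (A : set (g_sigma_algebraType G)).
    by rewrite /measurable/= GE.
  rewrite -nuE (Radon_Nikodym_integral nuQ mA) integral_pushforward//.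
    by apply: eq_integral => w _; rewrite -[LHS]/((EFin \o (fine \o W)) w) WE.
  by apply: integrableS iWP => //; exact: Gm.
Qed.

End conditional_expectation.

(* sup_A |mu A - nu A|, with no factor 1/2. *)
Definition dTV (R : realType) (mu nu : set nat -> \bar R) : \bar R :=
  ereal_sup [set (`|mu A - nu A|)%E | A in [set: set nat]].

(* [poisson_prob] takes a dummy second argument, which its body ignores. *)
Definition Pn (R : realType) (theta : R) : set nat -> \bar R :=
  poisson_prob theta 0%N.

Section sequences_of_random_variables.
Context d d' (T : measurableType d) (S : measurableType d') (R : realType).
Variable P : probability T R.
Implicit Types (X : nat -> {RV P >-> S}) (f : seq_space S -> R) (i : nat).

Definition seq_of X (w : T) : seq_space S := fun i => X i w.

Definition independent_seq X : Prop :=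
  forall (J : seq nat) (B : nat -> set S), uniq J ->
    (forall i, measurable (B i)) ->
    (P (\bigcap_(i in [set` J]) X i @^-1` B i) =
     \prod_(i <- J) P (X i @^-1` B i))%E.

Definition independent_copy X X' : Prop :=
  (forall A : set (seq_space S), measurable A ->
     P (seq_of X' @^-1` A) = P (seq_of X @^-1` A)) /\
  (forall A B : set (seq_space S), measurable A -> measurable B ->
     P (seq_of X @^-1` A `&` seq_of X' @^-1` B) =
     (P (seq_of X @^-1` A) * P (seq_of X' @^-1` B))%E).

(* Below, f represents the random variable F = f (seq_of X). Indices start at
   0, so that index i stands for i + 1 in the usual numbering from 1. *)

(* The sequence x with its i-th term replaced by that of y. *)
Definition replace i (x y : seq_space S) : seq_space S :=
  fun k => if k == i then y k else x k.

(* T_i F is Tshift f i (seq_of X w) (seq_of X' w) at w. *)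
Definition Tshift f i (x y : seq_space S) : R := f (replace i x y).

(* E_i [F], the expectation with respect to X_i alone: the other terms are
   frozen at w. *)
Definition Ei X f i (w : T) : R :=
  fine 'E_P[fun w' => Tshift f i (seq_of X w) (seq_of X w')].

Definition Dop X f i (w : T) : R := f (seq_of X w) - Ei X f i w.

(* The inner expectation is E_i', with respect to X'_i alone: X is frozen
   at w, and Tshift only depends on the i-th term of its last argument. *)
Definition dop X X' f i (w : T) : R :=
  Num.sqrt (2^-1 * fine 'E_P[fun w' =>
    `|f (seq_of X w) - Tshift f i (seq_of X w) (seq_of X' w')| ^+ 2]).

Definition filtration X i : set_system T :=
  sigma_family [set k | (k <= i)%N] (fun k => X k : T -> S).

(* E[D_i F | F_i] *)
Definition condD X f i : T -> R := cond_exp P (filtration X i) (Dop X f i).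

(* Generalized Lyapunov ratio; it may be infinite. *)
Definition lyapunov X f (r : R) : \bar R :=
  (\sum_(0 <= i <oo) 'E_P[fun w => (`|Dop X f i w| `^ r)%R])%E.

(* The series is summed pointwise; where it diverges, [limn] is a default
   value. *)
Definition Zvar X f (w : T) : R :=
  limn (fun n => \sum_(0 <= i < n) Dop X f i w * condD X f i w).

End sequences_of_random_variables.

(* Main.v *)
Require Import Defs.
From HB Require Import structures.
From mathcomp Require Import all_boot all_order all_algebra.
From mathcomp Require Import all_classical all_reals all_analysis measurable_realfun.
From mathcomp Require Import ring lra zify.

(* Stein's method on the space of sequences. The Stein equation
     theta phi(k + 1) - k phi(k) = 1_A(k) - Pn(theta)(A)
   has a solution with |phi| <= 1 /\ sqrt(2 / (e theta)) and
   |Delta phi| <= (1 - e^-theta) / theta, so the total variation distance is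
   a supremum of theta E phi(F + 1) - E F phi(F).  Write F - mu as the sum of
   the martingale differences a_i = E[D_i F | F_i].  As a_i is orthogonal to
   E_i phi(F), E a_i phi(F) = E a_i (phi(F) - E_i phi(F)), and for integers
     |phi(k) - phi(l) - Delta phi(k) (k - l)| <=
       sup |Delta phi| ((k - l)^2 + (k - l)),
   so averaging over the resampled coordinate replaces phi(F) - E_i phi(F) by
   Delta phi(F) D_i F, up to sup |Delta phi| (2 (d_i F)^2 + D_i F).  The sum of
   Delta phi(F) D_i F a_i is Delta phi(F) Z.

   All conditional expectations involved are averages over a resampled set of
   coordinates, and their calculus follows from the invariance of the law of
   (X, X') under the exchange of any set of coordinates. *)

Set Implicit Arguments.
Unset Strict Implicit.
Unset Printing Implicit Defensive.

Import Order.TTheory GRing.Theory Num.Theory.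
Import numFieldNormedType.Exports.

Local Open Scope classical_set_scope.
Local Open Scope ring_scope.

(** * The Poisson distribution and its Stein equation *)

(** The constant sqrt(2 / (e theta)) has this origin: the largest |phi(m + 1)| over test sets is the
    integral over u in [0, 1] of a mixture of Poisson weights of parameter theta u, and such weights
    never exceed (2 e theta u)^(-1/2).

    The obstacle is that F is only in L^2, so that Z need not converge a priori and the correction
    sum may be infinite. If that sum is infinite, the first bound is too. Otherwise integrality
    gives |D_i F| <= 2 (d_i F)^2, so the correction terms are nonnegative almost everywhere, and
    E|D_i F a_i| <= E (2 (d_i F)^2 + D_i F) |a_i| + E a_i^2. As the E a_i^2 sum to the variance, the
    series Z converges in L^1 even when the Lyapunov ratios are infinite.

    Averages over resampled coordinates are explicit functions of the sequence, while [cond_exp] is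
    an arbitrary version. The argument therefore runs under the law of X on the sequence space, and
    the two are identified almost everywhere only at the end. *)

Section poisson_weights.
Context {R : realType}.
Implicit Types (x y l t u v : R) (j k m n : nat).

Lemma le0_is_derive (f df : R -> R) (a b : R) : a <= b ->
  (forall x, a <= x < b -> is_derive x 1 f (df x)) ->
  (forall x, a < x < b -> df x <= 0) ->
  {within `[a, b], continuous f} -> f b <= f a.
Proof.
move=> ab fdf df0 cf; rewrite le_eqVlt in ab; case/orP: ab => [/eqP->//|ab].
have [|c cab e] := @MVT R f df a b ab _ cf.
  by move=> x /andP[/= ax xb]; apply: fdf; rewrite (ltW ax).
rewrite -subr_le0 e; move: cab; rewrite in_itv/= => cab.
by rewrite mulr_le0_ge0 ?df0// subr_ge0 ltW.
Qed.

(** The left side minus the right vanishes at 0 and has derivative ln (1 - y^2) <= 0. With x = 1 /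
    (2 b) this is the logarithm of the induction step in [half_shift_fact_le]. *)
Lemma log_ratio_le x : 0 <= x < 1 ->
  (1 + x) * ln (1 + x) - (1 - x) * ln (1 - x) <= 2 * x.
Proof.
move=> /andP[x0 x1].
pose K y : R := (1 + y) * ln (1 + y) - (1 - y) * ln (1 - y) - 2 * y.
pose dK y : R := ln (1 + y) + ln (1 - y).
have dKP (y : R) : -1 < y < 1 -> is_derive y 1 K (dK y).
  move=> /andP[yN1 y1].
  have y1p : 0 < 1 + y by lra.
  have y1m : 0 < 1 - y by lra.
  have dp : is_derive y 1 (fun z => ln (1 + z)) ((1 + y)^-1).
    by apply: (is_derive_eq (is_derive1_comp (is_derive1_ln y1p) _)); rewrite add0r mulr1.
  have dm : is_derive y 1 (fun z => ln (1 - z)) (- (1 - y)^-1).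
    have d1 : is_derive y 1 (fun z => 1 - z : R) (0 - 1) by exact: is_deriveB.
    have := @is_derive1_comp R (@ln R) (fun z => 1 - z) y _ _ (is_derive1_ln y1m) d1.
    by rewrite sub0r mulrN1.
  rewrite /K; apply: is_derive_eq.
  rewrite /dK /GRing.scale/=; field; lra.
suff: K x <= K 0.
  by rewrite /K !(addr0, subr0, mulr0) subrr; lra.
apply: (@le0_is_derive K dK) => //.
- by move=> y /andP[y0 yx]; apply: dKP; lra.
- move=> y /andP[y0 yx]; rewrite /dK -lnM ?posrE; [|lra|lra].
  by apply: ln_le0; nra.
- apply: derivable_within_continuous => y; rewrite in_itv/= => /andP[y0 yx].
  by apply: ex_derive; apply: dKP; lra.
Qed.

Definition ppmf l j : R := l ^+ j / j`!%:R * expR (- l).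

Lemma ppmf_ge0 l j : 0 <= l -> 0 <= ppmf l j.
Proof. by move=> l0; rewrite /ppmf !mulr_ge0 ?exprn_ge0 ?expR_ge0. Qed.

Lemma ppmf_gt0 l j : 0 < l -> 0 < ppmf l j.
Proof. by move=> l0; rewrite /ppmf !mulr_gt0 ?exprn_gt0 ?expR_gt0 ?invr_gt0 ?ltr0n ?fact_gt0. Qed.

Lemma ppmfS l j : j.+1%:R * ppmf l j.+1 = l * ppmf l j.
Proof.
rewrite /ppmf factS natrM exprS; field.
by rewrite addrC natr1 !pnatr_eq0 -lt0n fact_gt0.
Qed.

(** The square of the Stirling-type bound j! >= sqrt 2 (j + 1/2)^(j + 1/2) e^(-j). Equality at j = 0
    fixes the constant in [ppmf_le]. *)
Lemma half_shift_fact_le j :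
  2 * (j%:R + 2^-1) ^+ (2 * j + 1) <= expR 1 ^+ (2 * j) * (j`!%:R : R) ^+ 2.
Proof.
elim: j => [|j IH].
  by rewrite mulr0n/= add0n expr0 mul1r fact0 expr1n add0r expr1 mulfV.
set a : R := j%:R + 2^-1 in IH.
pose b : R := j.+1%:R.
have ab : a = b - 2^-1 by rewrite /a /b -(natr1 j); lra.
have a0 : 0 < a by rewrite /a ltr_wpDl// invr_gt0.
have b0 : 0 < b by rewrite /b ltr0n.
(* Compares the growth of both sides from j to j + 1; the factor 2 has cancelled. *)
have key : (b + 2^-1) ^+ (2 * j + 3) <= expR 1 ^+ 2 * b ^+ 2 * a ^+ (2 * j + 1).
  rewrite -ler_ln ?posrE; last 2 first.
  - by apply: exprn_gt0; lra.
  - by rewrite !mulr_gt0 ?exprn_gt0 ?expR_gt0.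
  rewrite !lnM ?posrE ?mulr_gt0 ?exprn_gt0 ?expR_gt0//.
  rewrite !lnXn ?expR_gt0//; last by lra.
  rewrite expRK.
  have x01 : 0 <= (2 * b)^-1 < 1.
    rewrite invr_ge0 mulr_ge0 ?ltW//= invf_lt1 ?mulr_gt0//.
    by rewrite /b -(natr1 j) mulrDr mulr1 ltr_wpDl ?mulr_ge0// ltr1n.
  have := log_ratio_le x01.
  have b1 : 1 + (2 * b)^-1 = (b + 2^-1) / b by field; lra.
  have b2 : 1 - (2 * b)^-1 = a / b by rewrite ab; field; lra.
  rewrite b1 b2 !ln_div ?posrE//; last by lra.
  rewrite -(ler_pM2l (_ : 0 < 2 * b)) ?mulr_gt0//.
  have -> : 2 * b * (2 / (2 * b)) = 2 by field; lra.
  set A := ln (b + 2^-1); set B := ln b; set C := ln a.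
  have -> : 2 * b * ((b + 2^-1) / b * (A - B) - a / b * (C - B))
     = (2 * b + 1) * (A - B) - (2 * b - 1) * (C - B).
    by rewrite ab; field; lra.
  have eb : b = j%:R + 1 by rewrite /b -(natr1 j).
  have e3 : (2 * j + 3)%:R = 2 * b + 1 :> R by rewrite eb natrD natrM; lra.
  have e4 : (2 * j + 1)%:R = 2 * b - 1 :> R by rewrite eb natrD natrM; lra.
  by rewrite -[A *+ _]mulr_natl -[C *+ _]mulr_natl e3 e4; lra.
have -> : (2 * j.+1 + 1 = 2 * j + 3)%N by lia.
have -> : (2 * j.+1 = 2 * j + 2)%N by lia.
rewrite factS natrM exprMn (exprD (expR 1)) -/b.
have p0 : 0 <= expR 1 ^+ 2 * b ^+ 2 by rewrite mulr_ge0 ?exprn_ge0 ?expR_ge0 ?ltW.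
have := ler_wpM2l p0 IH.
set X := a ^+ _; set Y := expR 1 ^+ (2 * j); set Z := j`!%:R ^+ 2.
move: key; set U := _ ^+ (2 * j + 3); set V := expR 1 ^+ 2; rewrite -/X.
set W := b ^+ 2 => UX YZ; apply: (@le_trans _ _ (V * W * (2 * X))).
  by rewrite (_ : V * W * (2 * X) = 2 * (V * W * X)); [lra|ring].
by rewrite (_ : Y * V * (W * Z) = V * W * (Y * Z))//; ring.
Qed.

(** For fixed j, l^(j + 1/2) e^(-l) is largest at l = j + 1/2, where the claim is
    [half_shift_fact_le]. Equality holds for j = 0 and l = 1/2. *)
Lemma ppmf_le l j : 0 < l -> ppmf l j <= (Num.sqrt (2 * expR 1 * l))^-1.
Proof.
move=> l0.
have e0 : 0 < 2 * expR 1 * l by rewrite !mulr_gt0 ?expR_gt0.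
have f0 : 0 < j`!%:R :> R by rewrite ltr0n fact_gt0.
rewrite -ler_sqr ?nnegrE ?invr_ge0 ?sqrtr_ge0 ?ppmf_ge0 ?(ltW l0)//.
rewrite exprVn sqr_sqrtr ?(ltW e0)// -[leRHS]mul1r ler_pdivlMr//.
set a : R := j%:R + 2^-1.
have a0 : 0 < a by rewrite /a ltr_wpDl// invr_gt0.
(* Maximality at l = a is y <= e^(y - 1) for y = l / a, raised to the power 2 a = 2 j + 1. *)
have h1 : l ^+ (2 * j + 1) <= a ^+ (2 * j + 1) * expR (2 * l) / expR 1 ^+ (2 * j + 1).
  have h : l / a <= expR (l / a - 1).
    by have := expR_ge1Dx (l / a - 1); lra.
  have := lerXn2r (2 * j + 1) (divr_ge0 (ltW l0) (ltW a0)) (expR_ge0 _) h.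
  rewrite -expRM_natl expr_div_n ler_pdivrMr ?exprn_gt0// => /le_trans; apply.
  rewrite mulrC -mulrA ler_pM2l ?exprn_gt0//.
  rewrite -expRM_natl -expRB ler_expR.
  have -> : (2 * j + 1)%:R = 2 * a :> R by rewrite natrD natrM /a; lra.
  rewrite le_eqVlt; apply/orP; left; apply/eqP; field; lra.
have h2 := half_shift_fact_le j.
rewrite -/a in h2.
have -> : ppmf l j ^+ 2 * (2 * expR 1 * l) =
    l ^+ (2 * j + 1) * (2 * expR 1 / j`!%:R ^+ 2 / expR (2 * l)).
  rewrite /ppmf (expRM_natl 2) expRN exprD mulnC exprM.
  by field; rewrite gt_eqF ?expR_gt0// gt_eqF.
apply: (@le_trans _ _ (a ^+ (2 * j + 1) * expR (2 * l) / expR 1 ^+ (2 * j + 1) *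
   (2 * expR 1 / j`!%:R ^+ 2 / expR (2 * l)))).
  by rewrite ler_wpM2r// !mulr_ge0 ?invr_ge0 ?expR_ge0 ?exprn_ge0 ?ler0n.
have -> : a ^+ (2 * j + 1) * expR (2 * l) / expR 1 ^+ (2 * j + 1) *
   (2 * expR 1 / j`!%:R ^+ 2 / expR (2 * l)) =
   2 * a ^+ (2 * j + 1) / (expR 1 ^+ (2 * j) * j`!%:R ^+ 2).
  rewrite [in LHS](exprD (expR 1)).
  by field; rewrite ?expf_neq0 ?gt_eqF ?expR_gt0.
by rewrite ler_pdivrMr ?mul1r// mulr_gt0 ?exprn_gt0 ?expR_gt0.
Qed.

End poisson_weights.

(** * Binomial-Poisson mixtures and the sup norm of the Stein solution *)

Section immigration_death.
Context {R : realType} (t : R).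
Implicit Types (u v x : R) (j k m n : nat).

Lemma is_derive_ppmf u i : is_derive u 1 (fun v => ppmf (t * v) i)
  (t * ((if i is j.+1 then ppmf (t * u) j else 0) - ppmf (t * u) i)).
Proof.
have dt : is_derive u 1 (fun v => t * v) t.
  by apply: is_derive_eq; rewrite /GRing.scale/= !(mulr1, mulr0, addr0).
have de : is_derive u 1 (fun v => expR (- (t * v))) (expR (- (t * u)) * - t).
  exact: (@is_derive1_comp R (@expR R) (fun v => - (t * v))).
case: i => [|i].
  have p0 v : ppmf (t * v) 0 = expR (- (t * v)).
    by rewrite /ppmf expr0 fact0 divr1 mul1r.
  under eq_fun do rewrite p0.
  by apply: (is_derive_eq de); rewrite p0; ring.
have dx : is_derive u 1 (fun v => (t * v) ^+ i.+1) (i.+1%:R * (t * u) ^+ i * t).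
  have -> : (fun v => (t * v) ^+ i.+1) = (fun v => t * v) ^+ i.+1 by apply/funext => v; rewrite fctE.
  exact: (is_derive_eq (is_deriveX i.+1 dt)).
rewrite /ppmf; apply: is_derive_eq.
rewrite /GRing.scale/= factS natrM exprS; field.
by rewrite addrC natr1 !pnatr_eq0 -lt0n fact_gt0.
Qed.

(* P (Bin (k, 1 - u) + Po (t u) = j), for independent variables *)
Fixpoint imdeath k j u : R :=
  if k is l.+1 then
    (1 - u) * (if j is i.+1 then imdeath l i u else 0) + u * imdeath l j u
  else ppmf (t * u) j.

Definition imdeath_cdf k n u : R := \sum_(i < n) imdeath k i u.

Lemma imdeath_cdfS k n u : imdeath_cdf k.+1 n.+1 u =
  (1 - u) * imdeath_cdf k n u + u * imdeath_cdf k n.+1 u.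
Proof.
rewrite /imdeath_cdf !mulr_sumr big_split/=; congr (_ + _).
by rewrite big_ord_recl/= mulr0 add0r.
Qed.

(** Raising u feeds the Poisson part at rate t, which carries mass from n to n + 1, and lowers the
    success probability of each of the k trials, the others contributing with k - 1. At k = 0 the
    factor k cancels the truncated [k.-1]. *)
Lemma is_derive_imdeath_cdf k n u : is_derive u 1 (imdeath_cdf k n.+1)
  (- t * imdeath k n u + k%:R * imdeath k.-1 n u).
Proof.
elim: k n => [|k IH] n.
  have -> : imdeath_cdf 0 n.+1 = fun v => \sum_(i < n.+1) ppmf (t * v) i by [].
  elim: n => [|n IH].
    under eq_fun do rewrite big_ord1.
    apply: (is_derive_eq (is_derive_ppmf u 0)).
    by rewrite mul0r addr0/= sub0r mulrN mulNr.
  under eq_fun do rewrite big_ord_recr/=.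
  apply: (is_derive_eq (is_deriveD IH (is_derive_ppmf u n.+1))).
  by rewrite /=; ring.
have dn : is_derive u 1 (imdeath_cdf k n) (if n is m.+1 then
    - t * imdeath k m u + k%:R * imdeath k.-1 m u else 0).
  case: n => [|n]; last exact: IH.
  have -> : imdeath_cdf k 0 = cst 0 by apply/funext => v; rewrite /imdeath_cdf big_ord0.
  exact: is_derive_cst.
rewrite (_ : imdeath_cdf _ _ = fun v => (1 - v) * imdeath_cdf k n v + v * imdeath_cdf k n.+1 v).
  2: by apply/funext => v; exact: imdeath_cdfS.
have := IH n => dn1.
apply: is_derive_eq.
rewrite /GRing.scale/= [imdeath_cdf k n.+1 u]big_ord_recr/= -/(imdeath_cdf k n u).
case: n dn dn1 => [|n] _ _; case: k IH => [|k] _ /=; rewrite ?mulr0n -?(natr1 k.+1) -?(natr1 k); ring.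
Qed.

(** The recursion takes convex combinations, which cannot exceed the largest Poisson weight. *)
Lemma imdeath_le k j u x : 0 <= u <= 1 -> 0 <= x ->
  (forall i, ppmf (t * u) i <= x) -> imdeath k j u <= x.
Proof.
move=> /andP[u0 u1] x0 H; elim: k j => [|k IH] j //=.
have h : (if j is i.+1 then imdeath k i u else 0) <= x by case: j.
rewrite (le_trans (lerD (ler_wpM2l _ h) (ler_wpM2l _ (IH j))))// ?subr_ge0//.
by lra.
Qed.

Lemma imdeath_cdf0 k n : (k < n)%N -> imdeath_cdf k n 0 = 1.
Proof.
elim: k n => [|k IH] [//|n]; last first.
  by rewrite ltnS => kn; rewrite imdeath_cdfS mul0r addr0 subr0 mul1r IH.
move=> _; rewrite /imdeath_cdf big_ord_recl/= big1 => [|i _].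
  by rewrite /ppmf mulr0 oppr0 expR0 expr0 fact0 invr1 !mulr1 addr0.
by rewrite /ppmf mulr0 expr0n/= !mul0r.
Qed.

Lemma imdeath_cdf1 k n : imdeath_cdf k n 1 = \sum_(i < n) ppmf t i.
Proof.
elim: k n => [|k IH] n; first by apply: eq_bigr => i _ /=; rewrite mulr1.
case: n => [|n]; first by rewrite /imdeath_cdf !big_ord0.
by rewrite imdeath_cdfS subrr mul0r add0r mul1r IH.
Qed.

(* The weights t^k / k! make the derivatives of the cdfs telescope. *)
Lemma is_derive_weighted_cdf K n u :
  is_derive u 1 (fun v => \sum_(k < K.+1) t ^+ k / k`!%:R * imdeath_cdf k n.+1 v)
    (- t * (t ^+ K / K`!%:R) * imdeath K n u).
Proof.
elim: K => [|K IH].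
  under eq_fun do rewrite big_ord1.
  have := is_derive_imdeath_cdf 0 n u => d0.
  by apply: is_derive_eq; rewrite /GRing.scale/= expr0 fact0; ring.
under eq_fun do rewrite big_ord_recr/=.
have := is_derive_imdeath_cdf K.+1 n u => dK.
apply: is_derive_eq; rewrite /GRing.scale/= factS natrM exprS; field.
by rewrite addrC natr1 !pnatr_eq0 -lt0n fact_gt0.
Qed.

Lemma ppmf_le1 u j : 0 <= u -> ppmf u j <= 1.
Proof.
move=> u0; rewrite /ppmf expRN ler_pdivrMr ?expR_gt0// mul1r.
case: j => [|j]; first by rewrite expr0 fact0 divr1 -expR0 ler_expR.
by have := expR_ge1Dxn j u0; lra.
Qed.

(* The left side is the sup norm, over test sets, of the Stein solution at
   [m + 1]; in the immigration-death process it is the integral over u of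
   [P (Bin (m, 1 - u) + Po (t u) = m)]. *)
Lemma stein_sup_bound m (L := \sum_(i < m.+1) ppmf t i) : 0 < t ->
  L * (1 - L) <= t * ppmf t m * Num.min 1 (Num.sqrt (2 / (expR 1 * t))).
Proof.
move=> t0.
pose w k : R := t ^+ k / k`!%:R.
pose G v := \sum_(k < m.+1) w k * imdeath_cdf k m.+1 v.
have dG v : is_derive v 1 G (- t * w m * imdeath m m v).
  exact: is_derive_weighted_cdf.
have eL k : w k = expR t * ppmf t k.
  by rewrite /ppmf mulrCA -expRD subrr expR0 mulr1.
have G0 : G 0 = expR t * L.
  rewrite /G /L mulr_sumr; apply: eq_bigr => k _.
  by rewrite imdeath_cdf0// mulr1 eL.
have G1 : G 1 = expR t * L * L.
  rewrite /G; under eq_bigr do rewrite imdeath_cdf1.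
  rewrite -mulr_suml; congr (_ * _); rewrite /L mulr_sumr.
  by apply: eq_bigr => k _; rewrite eL.
have w0 : 0 <= t * w m.
  by rewrite eL mulr_ge0 ?(ltW t0)// mulr_ge0 ?expR_ge0// ppmf_ge0 ?ltW.
(* As G 0 - G 1 = e^t L (1 - L), either bound is one on the drop of G over [0, 1]. *)
have red x : G 0 - G 1 <= t * w m * x -> L * (1 - L) <= t * ppmf t m * x.
  rewrite G0 G1 eL => h; rewrite -(ler_pM2l (expR_gt0 t)).
  by apply: (@le_trans _ _ (expR t * L - expR t * L * L)); lra.
have cont (f df : R -> R) : (forall v, is_derive v 1 f (df v)) ->
    {within `[0, 1], continuous f}.
  by move=> fdf; apply: derivable_within_continuous => v _; exact: ex_derive.
rewrite minEle; case: ifP => _; apply: red.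
  pose f v := - G v - t * w m * v.
  have df v : is_derive v 1 f (t * w m * imdeath m m v - t * w m).
    by apply: is_derive_eq; rewrite /GRing.scale/=; ring.
  suff : f 1 <= f 0 by rewrite /f; lra.
  apply: (le0_is_derive ler01 (fun v _ => df v)); last exact: cont df.
  move=> v /andP[v0 v1]; rewrite subr_le0 ler_piMr//.
  apply: imdeath_le => // [|i]; first by rewrite (ltW v0) ltW.
  by apply: ppmf_le1; rewrite mulr_ge0 ?ltW.
pose c := (Num.sqrt (2 * expR 1 * t))^-1.
have s0 : 0 < 2 * expR 1 * t by rewrite !mulr_gt0 ?expR_gt0.
have -> : Num.sqrt (2 / (expR 1 * t)) = 2 * c.
  rewrite (_ : 2 / _ = 2 ^+ 2 / (2 * expR 1 * t)); last first.
    by field; rewrite !gt_eqF ?expR_gt0.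
  by rewrite sqrtrM ?sqr_ge0// sqrtrV ?(ltW s0)// sqrtr_sqr ger0_norm.
(* The substitution u = v^2 removes the singularity at 0 of (2 e t u)^(-1/2), whose integral over
   [0, 1] is 2 c. *)
pose f v := - G (v ^+ 2) - t * w m * (2 * c) * v.
have df v : is_derive v 1 f
    (t * w m * imdeath m m (v ^+ 2) * (2 * v) - t * w m * (2 * c)).
  have d2 : is_derive v 1 (fun v => v ^+ 2) (2 * v).
    have -> : (fun v => v ^+ 2) = (fun v => v * v) :> (R -> R) by [].
    by apply: is_derive_eq; rewrite /GRing.scale/=; ring.
  have dG2 := @is_derive1_comp R G (fun v => v ^+ 2) v _ _ (dG _) d2.
  have -> : f = fun v => - (G \o (fun v => v ^+ 2)) v - t * w m * (2 * c) * v by [].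
  by apply: is_derive_eq; rewrite /GRing.scale/=; ring.
suff : f 1 <= f 0 by rewrite /f !expr2; rewrite !(mulr1, mulr0); lra.
apply: (le0_is_derive ler01 (fun v _ => df v)); last exact: cont df.
move=> v /andP[v0 v1]; rewrite -mulrA -mulrBr mulr_ge0_le0//.
suff : imdeath m m (v ^+ 2) * v <= c by lra.
rewrite -ler_pdivlMr//; apply: imdeath_le.
- by rewrite sqr_ge0 expr_le1// ltW.
- by rewrite divr_ge0 ?invr_ge0 ?sqrtr_ge0// ltW.
- move=> i; apply: (le_trans (ppmf_le _ _)); first by rewrite mulr_gt0 ?exprn_gt0.
  rewrite mulrA sqrtrM ?(ltW s0)// sqrtr_sqr ger0_norm ?(ltW v0)//.
  by rewrite invfM.
Qed.

End immigration_death.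

(** * A second-order Taylor bound on the integers *)

Section second_order.
Context {R : realType}.
Implicit Types (k m n : nat).

(** The left side is the modulus of a sum of |k - l| differences of increments, each at most 2 c in
    modulus; for k < l one of them is zero. With m = |k - l| >= 1 this gives 2 c m <= c m (m + 1)
    above l, and 2 c (m - 1) <= c m (m - 1) below l, since m is an integer. *)
Lemma nat_taylor (phi : nat -> R) (c : R) (k l : nat) : 0 <= c ->
  (forall j, `|phi j.+1 - phi j| <= c) ->
  `|phi k - phi l - (phi k.+1 - phi k) * (k%:R - l%:R)| <=
    c * ((k%:R - l%:R) ^+ 2 + (k%:R - l%:R)).
Proof.
move=> c0 dphi.
have dd i j : `|(phi i.+1 - phi i) - (phi j.+1 - phi j)| <= 2 * c.
  by rewrite (le_trans (ler_normB _ _))//; have := dphi i; have := dphi j; lra.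
case: (leqP k l) => [kl|/ltnW lk].
  rewrite -(subnKC kl) natrD; elim: (l - k)%N => [|m IH].
    by rewrite addn0 addr0 !subrr mulr0 subr0 normr0 expr0n/= addr0 mulr0.
  (* For l = k + 1 both sides vanish. Later steps add 2 c x on the right, with x >= 1, against one
     more difference on the left. *)
  case: m IH => [|m] IH; rewrite addnS.
    rewrite addn0 opprD addrA subrr sub0r mulrN1 opprK addrC subrKA subrr normr0.
    by rewrite sqrrN expr1n subrr mulr0.
  move: IH; rewrite -(natr1 m.+1) opprD addrA.
  have := dd k (k + m.+1)%N.
  have m1 : 1 <= m.+1%:R :> R by rewrite ler1n.
  set x := m.+1%:R in m1 *; set A := phi k.+1; set B := phi k.
  set C := phi (k + m.+1).+1; set D := phi (k + m.+1)%N.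
  rewrite !ler_norml => /andP[h1 h2] /andP[h3 h4].
  apply/andP; split; nra.
rewrite -(subnKC lk) natrD; move: (k - l)%N => m; elim: m l {lk} => [|m IH] l.
  by rewrite addn0 addr0 !subrr mulr0 subr0 normr0 expr0n/= addr0 mulr0.
move: (IH l.+1); rewrite addSnnS.
have := dd l (l + m.+1)%N.
have m0 : 0 <= m%:R :> R by [].
rewrite -!(natr1 m) -(natr1 l).
set x := m%:R in m0 *; set A := phi l.+1; set B := phi l.
set C := phi (l + m.+1).+1; set D := phi (l + m.+1)%N.
have -> : l%:R + 1 + x - (l%:R + 1) = x by ring.
have -> : l%:R + (x + 1) - l%:R = x + 1 by ring.
rewrite !ler_norml => /andP[h1 h2] /andP[h3 h4].
apply/andP; split; nra.
Qed.

End second_order.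

(** * The solution of the Stein equation and its increments *)

Section stein_solution.
Context {R : realType} (t : R).
Hypothesis t0 : 0 < t.
Implicit Types (A : set nat) (j k m n : nat).

Local Notation p := (ppmf t).

Definition pcdf k : R := \sum_(r < k) p r.
Definition pcdf_in A k : R := \sum_(r < k) (nat_of_ord r \in A)%:R * p r.
Definition pmass A : R := fine (Pn t A).

Let p_gt0 k : 0 < p k. Proof. exact: ppmf_gt0. Qed.

Lemma PnE A : Pn t A = (pmass A)%:E.
Proof.
rewrite /pmass fineK//.
exact: (fin_num_measure (poisson_prob t 0 : probability _ R)).
Qed.

Lemma pcdf_in_cvg A : pcdf_in A n @[n --> \oo] --> pmass A.
Proof.
have e : Pn t A = (\sum_(0 <= k <oo) ((k \in A)%:R * p k)%:E)%E.
  rewrite /Pn /poisson_prob t0.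
  transitivity (\sum_(k <oo | k \in A) (poisson_pmf t k)%:E)%E.
    by rewrite nneseries_esum ?set_mem_set// => n _; rewrite lee_fin poisson_pmf_ge0.
  rewrite [LHS]eseries_mkcond; apply: eq_eseriesr => k _.
  rewrite /poisson_pmf t0; case: (boolP (k \in A)) => _; rewrite ?mul1r ?mul0r//.
have : (pcdf_in A n)%:E @[n --> \oo] --> (pmass A)%:E.
  rewrite -PnE e.
  under eq_fun do rewrite /pcdf_in -sumEFin -(big_mkord xpredT (fun r => ((r \in A)%:R * p r)%:E)).
  apply: is_cvg_nneseries => k _ _.
  by rewrite lee_fin mulr_ge0// ltW.
by move/fine_cvgP => [].
Qed.

Lemma pcdf_inT k : pcdf_in setT k = pcdf k.
Proof. by apply: eq_bigr => i _; rewrite in_setT mul1r. Qed.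

Lemma pmassT : pmass setT = 1.
Proof.
rewrite /pmass /Pn.
by rewrite (@probability_setT _ _ _ (poisson_prob t 0 : probability _ R)).
Qed.

Lemma pcdf_cvg : pcdf n @[n --> \oo] --> (1 : R).
Proof.
rewrite -pmassT; under eq_fun do rewrite -pcdf_inT; exact: pcdf_in_cvg.
Qed.

Lemma pcdfS k : pcdf k.+1 = pcdf k + p k.
Proof. by rewrite /pcdf big_ord_recr. Qed.

Lemma pcdf_inS A k : pcdf_in A k.+1 = pcdf_in A k + (k \in A)%:R * p k.
Proof. by rewrite /pcdf_in big_ord_recr. Qed.

Lemma pcdf_in_ge0 A k : 0 <= pcdf_in A k.
Proof. by apply: sumr_ge0 => i _; rewrite mulr_ge0// ltW. Qed.

Lemma pcdf_in_le A k : pcdf_in A k <= pcdf k.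
Proof. by apply: ler_sum => i _; rewrite ler_piMl ?(ltW (p_gt0 _))//; case: (_ \in _). Qed.

(** Inequalities between Poisson tails are proved by induction on partial sums started at k, then
    carried to the limit by this. *)
Lemma cvg_ge0 (u : nat -> R) (l : R) k : u n @[n --> \oo] --> l ->
  (forall n, 0 <= u (n + k)%N) -> 0 <= l.
Proof.
move=> ul u0; apply: (ler_cvg_to (@cvg_cst _ (0 : R) _ \oo _) ul).
by exists k => // n /= kn; rewrite -(subnK kn).
Qed.

Lemma ptail_in_ge0 A k : 0 <= pmass A - pcdf_in A k.
Proof.
apply: (@cvg_ge0 (fun n => pcdf_in A n - pcdf_in A k) _ k).
  by apply: cvgB; [exact: pcdf_in_cvg|exact: cvg_cst].
elim=> [|n IH]; first by rewrite add0n subrr.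
by rewrite addSn pcdf_inS addrAC addr_ge0// mulr_ge0// ltW.
Qed.

Lemma ptail_in_le A k : pmass A - pcdf_in A k <= 1 - pcdf k.
Proof.
rewrite -subr_ge0; apply: (@cvg_ge0 (fun n =>
  pcdf n - pcdf k - (pcdf_in A n - pcdf_in A k)) _ k).
  by apply: cvgB; apply: cvgB; [exact: pcdf_cvg|exact: cvg_cst|exact: pcdf_in_cvg|exact: cvg_cst].
elim=> [|n IH]; first by rewrite add0n !subrr.
rewrite addSn pcdf_inS pcdfS; have := p_gt0 (n + k).
by case: (_ \in _) => /=; lra.
Qed.

(** Term by term: t p(r) = (r + 1) p(r + 1) >= k p(r + 1) for r >= k. *)
Lemma ptail_ratio k : k%:R * (1 - pcdf k.+1) <= t * (1 - pcdf k).
Proof.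
rewrite -subr_ge0; apply: (@cvg_ge0 (fun n =>
  t * (pcdf n - pcdf k) - k%:R * (pcdf n.+1 - pcdf k.+1)) _ k).
  apply: cvgB; apply: cvgM; first exact: cvg_cst.
  - by apply: cvgB; [exact: pcdf_cvg|exact: cvg_cst].
  - exact: cvg_cst.
  - by apply: cvgB; [rewrite (cvg_shiftS pcdf); exact: pcdf_cvg|exact: cvg_cst].
elim=> [|n IH]; first by rewrite add0n !subrr !mulr0 subrr.
rewrite addSn pcdfS [pcdf (n + k).+2]pcdfS.
have := ppmfS t (n + k); have := ltW (p_gt0 (n + k).+1).
have : k%:R <= (n + k).+1%:R :> R by rewrite ler_nat ltnW// ltnS leq_addl.
by move: IH; rewrite -(natr1 (n + k)); nra.
Qed.

(** Term by term: t p(r) = (r + 1) p(r + 1) <= k p(r + 1) for r < k. *)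
Lemma phead_ratio k : t * pcdf k <= k%:R * (pcdf k.+1 - p 0).
Proof.
elim: k => [|k IH]; first by rewrite /pcdf big_ord0 mulr0 mul0r.
have h : 0 <= pcdf k.+1 - p 0.
  by rewrite /pcdf big_ord_recl/= addrC addKr sumr_ge0// => i _; exact: ltW.
rewrite pcdfS [pcdf k.+2]pcdfS mulrDr -ppmfS -(natr1 k).
by move: IH h; nra.
Qed.

(** The equation leaves the value at 0 free, as it is multiplied by 0 there. Taking the value at 1
    makes the increment at 0 vanish, so the bounds need no exception. *)
Definition stein_sol A k : R :=
  let j := maxn 1 k in (pcdf_in A j - pmass A * pcdf j) / (j%:R * p j).

Lemma stein_solS A k :
  stein_sol A k.+1 = (pcdf_in A k.+1 - pmass A * pcdf k.+1) / (t * p k).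
Proof. by rewrite /stein_sol maxnSS max0n ppmfS. Qed.

Lemma stein_equation A k :
  t * stein_sol A k.+1 - k%:R * stein_sol A k = (k \in A)%:R - pmass A.
Proof.
have tn0 : t != 0 by rewrite gt_eqF.
have pn0 j : p j != 0 by rewrite gt_eqF.
rewrite stein_solS pcdf_inS pcdfS; case: k => [|k].
  rewrite mul0r subr0 /pcdf_in /pcdf !big_ord0 !add0r; field.
  by rewrite pn0.
rewrite /stein_sol maxnSS max0n.
set x := k.+1%:R; have x0 : x != 0 by rewrite pnatr_eq0.
by field; rewrite tn0 pn0 addrC natr1 x0.
Qed.

(** With a and b the masses of A in [0, j] and beyond j, and L = [pcdf j.+1], the numerator at j + 1
    is a (1 - L) - b L. Since 0 <= a <= L and 0 <= b <= 1 - L, its modulus is at most L (1 - L). *)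
Lemma stein_sol_le A k :
  `|stein_sol A k| <= Num.min 1 (Num.sqrt (2 / (expR 1 * t))).
Proof.
have [j ->] : exists j, stein_sol A k = stein_sol A j.+1.
  by case: k => [|k]; [exists 0|exists k].
rewrite stein_solS.
have tp : 0 < t * p j by rewrite mulr_gt0.
rewrite normrM normfV (gtr0_norm tp) ler_pdivrMr// [leRHS]mulrC.
apply: le_trans (stein_sup_bound j t0); rewrite -/(pcdf j.+1).
have h1 := pcdf_in_ge0 A j.+1; have h2 := pcdf_in_le A j.+1.
have h3 := ptail_in_ge0 A j.+1; have h4 := ptail_in_le A j.+1.
by rewrite ler_norml; apply/andP; split; nra.
Qed.

(** The increment at K >= 1 is linear in the masses of A below K, at K and above K. The two ratio
    inequalities make the outer coefficients nonpositive, so the maximum is at A = {K}, where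
    [phead_ratio] gives the bound; the minimum is at the complement of {K}. *)
Lemma stein_sol_diff_le A k :
  `|stein_sol A k.+1 - stein_sol A k| <= (1 - expR (- t)) / t.
Proof.
have ct : 0 <= (1 - expR (- t)) / t.
  by rewrite divr_ge0 ?(ltW t0)// subr_ge0 -expR0 ler_expR oppr_le0 ltW.
case: k => [|k].
  by rewrite {2}/stein_sol maxn0 -[X in _ - X]/(stein_sol A 1) subrr normr0.
rewrite stein_solS /stein_sol maxnSS max0n pcdf_inS pcdfS.
set K := k.+1; set x : R := K%:R.
have x0 : 0 < x by rewrite ltr0n.
have h1 := pcdf_in_ge0 A K; have h2 := pcdf_in_le A K.
have h3 := ptail_in_ge0 A K.+1; have h4 := ptail_in_le A K.+1.
have h5 := ptail_ratio K; have h6 := phead_ratio K.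
have pK := p_gt0 K.
have p0 : p 0 = expR (- t) by rewrite /ppmf expr0 fact0 divr1 mul1r.
rewrite p0 in h6.
move: h3 h4 h5 h6; rewrite pcdf_inS pcdfS -/x.
set a1 := pcdf_in A K in h1 h2 *; set L := pcdf K in h2 *; set q := p K in pK *.
set I := (K \in A)%:R; set e := expR (- t).
set M := pmass A => h3 h4 h5 h6.
have I01 : 0 <= I <= 1 by rewrite /I; case: (_ \in _); rewrite ?lexx ?ler01.
pose a3 := M - (a1 + I * q).
pose W : R := 1 - (L + q).
have eM : M = a1 + I * q + a3 by rewrite /a3; ring.
have -> : (a1 + I * q - M * (L + q)) / (t * q) - (a1 - M * L) / (x * q) =
    a1 * (W / (t * q) - (W + q) / (x * q)) + I * q * (W / (t * q) + L / (x * q)) -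
    a3 * ((L + q) / (t * q) - L / (x * q)).
  by rewrite eM /W; field; rewrite !gt_eqF.
have d0 : 0 < x * t * q by apply: mulr_gt0 => //; exact: mulr_gt0.
have c1 : W / (t * q) - (W + q) / (x * q) <= 0.
  have -> : W / (t * q) - (W + q) / (x * q) = (x * W - t * (W + q)) / (x * t * q).
    by field; rewrite !gt_eqF.
  by rewrite mulr_le0_ge0 ?invr_ge0 ?(ltW d0)// /W; lra.
have c3 : 0 <= (L + q) / (t * q) - L / (x * q).
  have -> : (L + q) / (t * q) - L / (x * q) = (x * (L + q) - t * L) / (x * t * q).
    by field; rewrite !gt_eqF.
  rewrite mulr_ge0 ?invr_ge0 ?(ltW d0)//.
  by have := mulr_gt0 x0 (expR_gt0 (- t)); rewrite -/e; lra.
have c2 : q * (W / (t * q) + L / (x * q)) <= (1 - e) / t.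
  have -> : q * (W / (t * q) + L / (x * q)) = (x * W + t * L) / x / t.
    by field; rewrite !gt_eqF.
  by rewrite ler_pM2r ?invr_gt0// ler_pdivrMr// /W; lra.
set C1 := W / (t * q) - (W + q) / (x * q) in c1 *.
set C3 := (L + q) / (t * q) - L / (x * q) in c3 *.
set C2 := W / (t * q) + L / (x * q) in c2 *.
(* The solution for the full set is constant, so the three coefficients balance. *)
have bal : L * C1 + q * C2 - W * C3 = 0.
  by rewrite /C1 /C2 /C3 /W; field; rewrite !gt_eqF.
rewrite -/a3 -/W in h3 h4.
have e1 : a1 * C1 <= 0 by rewrite mulr_ge0_le0.
have e2 : 0 <= (L - a1) * - C1 by rewrite mulr_ge0 ?subr_ge0 ?oppr_ge0.
have e3 : 0 <= a3 * C3 by rewrite mulr_ge0.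
have e4 : 0 <= (W - a3) * C3 by apply: mulr_ge0 => //; rewrite subr_ge0.
have [e5 e6] : 0 <= I * (q * C2) /\ I * (q * C2) <= q * C2.
  have : 0 <= q * C2 by lra.
  by rewrite /I; case: (K \in A) => /= ?; rewrite ?mul1r ?mul0r; split.
by rewrite ler_norml; apply/andP; split; lra.
Qed.

End stein_solution.

(** * Resampling coordinates *)

Section replacement.
Context d' (S : measurableType d').
Local Notation E := (seq_space S).
Implicit Types (I J : pred nat) (x y z : E).

Definition rep I x y : E := fun k => if I k then y k else x k.

Lemma measurable_coord i : measurable_fun setT (fun x : E => x i).
Proof.
move=> _ B mB; apply: sub_sigma_algebra; exists i => //=.
by exists B.
Qed.

Lemma measurable_seq d (T : measurableType d) (h : T -> E) :
  (forall i, measurable_fun setT (fun w => h w i)) -> measurable_fun setT h.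
Proof.
move=> mh; apply: (@measurability _ _ T E setT h (cylinders S)) => //.
move=> _ [_ [i _ [B mB <-]] <-]; rewrite !setTI.
by have := mh i measurableT B mB; rewrite setTI.
Qed.

Lemma measurable_rep I d (T : measurableType d) (h k : T -> E) :
  measurable_fun setT h -> measurable_fun setT k ->
  measurable_fun setT (fun w => rep I (h w) (k w)).
Proof.
move=> mh mk; apply: measurable_seq => i; rewrite /rep.
by case: (I i); apply: (measurableT_comp (measurable_coord i)).
Qed.

Definition rect (B : nat -> set S) N : set E := [set x | forall j, (j < N)%N -> B j (x j)].

Definition rects : set_system E :=
  [set A | exists B N, (forall j, measurable (B j)) /\ A = rect B N].

Lemma measurable_rect B N : (forall j, measurable (B j)) -> measurable (rect B N).
Proof.
move=> mB; rewrite (_ : rect B N =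
    \bigcap_(j in `I_N) ((fun x : E => x j) @^-1` B j)) //.
apply: fin_bigcap_measurable => // j _.
by rewrite -[X in measurable X]setTI; apply: measurable_coord.
Qed.

Lemma rect_pad B N M : (N <= M)%N ->
  rect B N = rect (fun j => if (j < N)%N then B j else setT) M.
Proof.
move=> NM; apply/seteqP; split=> x /= h j; first by case: ifPn => // jN _; exact: h.
by move=> jN; have := h j (leq_trans jN NM); rewrite jN.
Qed.

Lemma rectI B C N : rect B N `&` rect C N = rect (fun j => B j `&` C j) N.
Proof.
apply/seteqP; split=> x /=; first by move=> [h1 h2] j jN; split; [exact: h1|exact: h2].
by move=> h; split=> j jN; have [] := h j jN.
Qed.

Lemma rects_common A A' : rects A -> rects A' -> exists B C N,
  [/\ forall j, measurable (B j), forall j, measurable (C j), A = rect B N & A' = rect C N].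
Proof.
move=> [B [N [mB ->]]] [C [M [mC ->]]].
exists (fun j => if (j < N)%N then B j else setT),
       (fun j => if (j < M)%N then C j else setT), (maxn N M).
split; [by move=> j; case: ifP|by move=> j; case: ifP| |].
- by rewrite -rect_pad// leq_maxl.
- by rewrite -rect_pad// leq_maxr.
Qed.

Lemma setI_closed_rects : setI_closed rects.
Proof.
move=> A A' rA rA'; have [B [C [N [mB mC -> ->]]]] := rects_common rA rA'.
by exists (fun j => B j `&` C j), N; split=> [j|]; [exact: measurableI|rewrite rectI].
Qed.

Lemma rects_setT : rects setT.
Proof. by exists (fun=> setT), 0%N; split=> //; apply/seteqP; split. Qed.

Lemma cylinders_rects : cylinders S `<=` rects.
Proof.
move=> _ [i _ [B mB <-]]; rewrite setTI.
exists (fun j => if j == i then B else setT), i.+1; split=> [j|]; first by case: ifP.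
apply/seteqP; split=> x /= h; first by move=> j _; case: eqP => // ->.
by have := h i (ltnSn i); rewrite eqxx.
Qed.

Lemma measurable_rects A : rects A -> measurable A.
Proof. by move=> [B [N [mB ->]]]; exact: measurable_rect. Qed.

(** A pi-system generating the product sigma-algebra: finite measures that agree on it are equal,
    which reduces exchange invariance to finite products. *)
Definition rect_pairs : set_system (E * E) :=
  [set C | exists A B, [/\ rects A, rects B & C = A `*` B]].

Lemma measurable_rect_pairs : @measurable _ (E * E)%type = <<s rect_pairs >>.
Proof.
apply/seteqP; split.
  apply: smallest_sub; first exact: smallest_sigma_algebra.
  have fstM : measurable_fun (setT : set (g_sigma_algebraType rect_pairs)) (fst : _ -> E).
    apply: (@measurability _ _ (g_sigma_algebraType rect_pairs) E setT fst (cylinders S)) => // _ [A cA <-].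
    apply: sub_sigma_algebra; exists A, setT; split; [exact: cylinders_rects|exact: rects_setT|].
    by apply/seteqP; split=> z //= -[].
  have sndM : measurable_fun (setT : set (g_sigma_algebraType rect_pairs)) (snd : _ -> E).
    apply: (@measurability _ _ (g_sigma_algebraType rect_pairs) E setT snd (cylinders S)) => // _ [A cA <-].
    apply: sub_sigma_algebra; exists setT, A; split; [exact: rects_setT|exact: cylinders_rects|].
    by apply/seteqP; split=> z //= -[].
  by rewrite subUset; split => _ [A mA <-]; [exact: fstM|exact: sndM].
apply: smallest_sub; first exact: sigma_algebra_measurable.
move=> _ [A [B [rA rB ->]]].
by apply: measurableX; exact: measurable_rects.
Qed.

Lemma setI_closed_rect_pairs : setI_closed rect_pairs.
Proof.
move=> _ _ [A [B [rA rB ->]]] [A' [B' [rA' rB' ->]]].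
exists (A `&` A'), (B `&` B'); split; [exact: setI_closed_rects|exact: setI_closed_rects|].
by rewrite setXI.
Qed.

Definition exch I (z : E * E) : E * E := (rep I z.1 z.2, rep I z.2 z.1).

Lemma measurable_exch I : measurable_fun setT (exch I).
Proof. by apply: measurable_fun_pair; apply: measurable_rep. Qed.

End replacement.

(** * Invariance of two independent copies under exchange of coordinates *)

Section exchange.
Context d' (S : measurableType d') (R : realType).
Local Notation E := (seq_space S).
Variable Q : probability E R.
Hypothesis prodQ : forall B N, (forall j, measurable (B j)) ->
  Q (rect B N) = (\prod_(j < N) Q ((fun x : E => x j) @^-1` B j))%E.
Implicit Types (I J : pred nat) (x y z : E).

(** On a pair of rectangles the exchange swaps the sides indexed by I, and the probability is a
    product over coordinates whose factors commute. *)
Lemma exch_measure I (A : set (E * E)) : measurable A ->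
  (Q \x Q)%E (exch I @^-1` A) = (Q \x Q)%E A.
Proof.
move=> mA.
have [nu nuE] : exists nu : {measure set (E * E) -> \bar R},
    forall B, nu B = (Q \x Q)%E (exch I @^-1` B).
  unshelve eexists (pushforward (Q \x Q)%E (exch I)); last by [].
  exact: measurable_exch.
rewrite -nuE; apply: (@measure_unique _ R (E * E)%type (@rect_pairs _ S) (fun=> setT) (@measurable_rect_pairs _ S) (@setI_closed_rect_pairs _ S) _ _ nu (Q \x Q)%E) => //.
- by move=> _; exists setT, setT; split; [exact: rects_setT|exact: rects_setT|rewrite setXTT].
- by rewrite bigcup_const.
- move=> _ [A1 [A2 [rA1 rA2 ->]]].
  have [B [C [N [mB mC -> ->]]]] := rects_common rA1 rA2.
  rewrite nuE.
  pose B' j := if I j then C j else B j.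
  pose C' j := if I j then B j else C j.
  have mB' j : measurable (B' j) by rewrite /B'; case: ifP.
  have mC' j : measurable (C' j) by rewrite /C'; case: ifP.
  have -> : exch I @^-1` (rect B N `*` rect C N) = rect B' N `*` rect C' N.
    apply/seteqP; split=> -[x y] /= [h1 h2]; split=> j jN; have := h1 j jN;
      have := h2 j jN; rewrite /exch /rep /B' /C'/=; case: (I j) => //.
  have pQ U V : measurable U -> measurable V ->
      (Q \x Q)%E (U `*` V) = (Q U * Q V)%E by exact: product_measure1E.
  rewrite [RHS]pQ; try exact: measurable_rect.
  rewrite pQ; try exact: measurable_rect.
  rewrite !prodQ// -!big_split/=; apply: eq_bigr => j _.
  by rewrite /B' /C'; case: (I j) => //; rewrite muleC.
- move=> _; rewrite nuE preimage_setT.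
  by rewrite (le_lt_trans (probability_le1 _ measurableT)) ?ltry.
Qed.

Lemma exch_integral I (h : E * E -> \bar R) : measurable_fun setT h ->
  (forall w, (0 <= h w)%E) ->
  (\int[Q]_x \int[Q]_y h (x, y) = \int[Q]_x \int[Q]_y h (rep I x y, rep I y x))%E.
Proof.
move=> mh h0.
have e (k : E * E -> \bar R) : measurable_fun setT k -> (forall w, (0 <= k w)%E) ->
    (\int[Q]_x \int[Q]_y k (x, y) = \int[Q \x Q]_w k w)%E.
  by move=> mk k0; rewrite fubini_tonelli1.
rewrite e// (e (h \o exch I)); last 2 first.
- by apply: measurableT_comp => //; exact: measurable_exch.
- by move=> w; exact: h0.
transitivity (\int[pushforward (Q \x Q)%E (exch I)]_w h w)%E.
  apply: eq_measure_integral; first exact: measurable_exch.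
  by move=> mexch A mA _; apply/esym; exact: exch_measure.
by rewrite (ge0_integral_pushforward (@measurable_exch _ S I))// preimage_setT.
Qed.

End exchange.

(** * Averages over resampled coordinates of nonnegative functions *)

Section integrating_out.
Context d' (S : measurableType d') (R : realType).
Local Notation E := (seq_space S).
Variable Q : probability E R.
Hypothesis prodQ : forall B N, (forall j, measurable (B j)) ->
  Q (rect B N) = (\prod_(j < N) Q ((fun x : E => x j) @^-1` B j))%E.
Implicit Types (I J : pred nat) (x y z : E) (h k : E -> \bar R).
Local Open Scope ereal_scope.

Definition EI I h x : \bar R := \int[Q]_y h (rep I x y).

Definition nnegm h := measurable_fun setT h /\ forall x, 0 <= h x.

Lemma measurable_repx I x : measurable_fun setT (rep I x).
Proof. exact: (measurable_rep I (measurable_cst x) (@measurable_id _ _ _)). Qed.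

Lemma measurable_rep2 I : measurable_fun setT (fun w : E * E => rep I w.1 w.2).
Proof. exact: measurable_rep. Qed.

Lemma nnegm_EI I h : nnegm h -> nnegm (EI I h).
Proof.
move=> [mh h0]; split; last by move=> x; apply: integral_ge0 => y _; exact: h0.
apply: (@measurable_fun_fubini_tonelli_F _ _ E E R Q (fun w => h (rep I w.1 w.2))).
  by apply: measurableT_comp => //; exact: measurable_rep2.
by move=> w; exact: h0.
Qed.

(** Self-adjointness of the average: exchanging the coordinates in I between x and y turns
    [rep I x y] into x, and x into [rep I x y]. *)
Lemma int_EIM I h k : nnegm h -> nnegm k ->
  \int[Q]_x (k x * EI I h x) = \int[Q]_x (EI I k x * h x).
Proof.
move=> [mh h0] [mk k0].
have mhx x : measurable_fun setT (fun y => h (rep I x y)).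
  by apply: measurableT_comp => //; exact: measurable_repx.
have mkx x : measurable_fun setT (fun y => k (rep I x y)).
  by apply: measurableT_comp => //; exact: measurable_repx.
transitivity (\int[Q]_x \int[Q]_y (k x * h (rep I x y))).
  by apply: eq_integral => x _; rewrite ge0_integralZl.
transitivity (\int[Q]_x \int[Q]_y (k (rep I x y) * h x)).
  rewrite (@exch_integral _ S R Q prodQ I (fun w => k w.1 * h (rep I w.1 w.2))).
  - apply: eq_integral => x _; apply: eq_integral => y _ /=; congr (_ * h _).
    by apply/funext => j; rewrite /rep; case: (I j).
  - apply: emeasurable_funM; apply: measurableT_comp => //.
    exact: measurable_rep2.
  - by move=> w; exact: mule_ge0.
by apply: eq_integral => x _; rewrite ge0_integralZr.
Qed.

Lemma EI_inv I h x : (forall y, h (rep I x y) = h x) -> EI I h x = h x.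
Proof.
move=> e; rewrite /EI; under eq_integral do rewrite e.
by rewrite integral_cst// [X in _ * X]probability_setT mule1.
Qed.

Lemma int_EI I h : nnegm h -> \int[Q]_x EI I h x = \int[Q]_x h x.
Proof.
move=> [mh h0]; have := @int_EIM I h (cst 1) (conj mh h0).
have n1 : nnegm (cst 1) by split=> // x; exact: lee01.
move/(_ n1); under eq_integral do rewrite /= mul1e.
by move=> ->; apply: eq_integral => x _; rewrite EI_inv// mul1e.
Qed.

(** The averages draw from independent y and z, but the coordinates used are those of the single
    sequence [rep J y z], which has the law of y. With x frozen in k, this is [int_EI]; the identity
    thus holds at every x. *)
Lemma EI_EI I J h x : nnegm h ->
  EI I (EI J h) x = EI (fun j => I j || J j) h x.
Proof.
move=> [mh h0]; set IJ := fun j => _.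
pose k y := h (rep IJ x y).
have nk : nnegm k.
  by split=> [|y]; [apply: measurableT_comp => //; exact: measurable_repx|exact: h0].
rewrite -[RHS](int_EI J nk); apply: eq_integral => y _; apply: eq_integral => z _.
congr h; apply/funext => j; rewrite /rep /IJ.
by case: (I j); case: (J j).
Qed.

Lemma eq_EI I J h : I =1 J -> EI I h = EI J h.
Proof. by move=> /funext ->. Qed.

Lemma EI_rep I J h x y : (forall j, J j -> I j) -> EI I h (rep J x y) = EI I h x.
Proof.
move=> JI; apply: eq_integral => z _; congr h; apply/funext => j; rewrite /rep.
by case: ifPn => // nIj; case: ifPn => // /JI; rewrite (negbTE nIj).
Qed.

Lemma int_EI_EI I J h k : nnegm h -> nnegm k ->
  \int[Q]_x (EI I h x * EI J k x) = \int[Q]_x (h x * EI (fun j => I j || J j) k x).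
Proof.
move=> nh nk; have nJ := nnegm_EI J nk.
rewrite -(int_EIM I nJ nh); apply: eq_integral => x _.
by rewrite EI_EI.
Qed.

End integrating_out.

(** * Square-integrable functions and averages over coordinates *)

Section l1_l2.
Context d (T : measurableType d) (R : realType) (P : probability T R).
Implicit Types (u v : T -> R).

Definition L1 u := P.-integrable setT (EFin \o u).
Definition L2 u := measurable_fun setT u /\ L1 (fun x => u x ^+ 2).
Definition Ex u : R := \int[P]_x u x.

Lemma L1_meas u : L1 u -> measurable_fun setT u.
Proof. by move/measurable_int/measurable_EFinP. Qed.

Lemma L1_dom u v : measurable_fun setT u -> L1 v -> (forall x, `|u x| <= v x) -> L1 u.
Proof.
move=> mu lv uv; apply: le_integrable lv => //; first exact/measurable_EFinP.
by move=> x _ /=; rewrite lee_fin (le_trans (uv x))// ler_norm.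
Qed.

Lemma L1_ae u v : measurable_fun setT u -> L1 v -> {ae P, forall x, u x = v x} -> L1 u.
Proof.
move=> mu /integrableP[mv iv]; move=> uv; apply/integrableP; split; first exact/measurable_EFinP.
rewrite (le_lt_trans _ iv)//.
apply: ae_ge0_le_integral => //.
- by apply: measurableT_comp => //; exact/measurable_EFinP.
- exact: measurableT_comp.
- by apply: filterS uv => x /= -> _.
Qed.

Lemma L1_cst (c : R) : L1 (fun=> c).
Proof. exact: finite_measure_integrable_cst. Qed.

Lemma L1D u v : L1 u -> L1 v -> L1 (fun x => u x + v x).
Proof. by move=> lu lv; have := integrableD measurableT lu lv. Qed.

Lemma L1B u v : L1 u -> L1 v -> L1 (fun x => u x - v x).
Proof. by move=> lu lv; have := integrableB measurableT lu lv. Qed.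

Lemma L1Z (c : R) u : L1 u -> L1 (fun x => c * u x).
Proof. by move=> lu; have := integrableZl measurableT c lu. Qed.

Lemma L1_abs u : L1 u -> L1 (fun x => `|u x|).
Proof. by move=> lu; have := integrable_abse lu. Qed.

Lemma L1_bddM u v (c : R) : measurable_fun setT u -> (forall x, `|u x| <= c) -> L1 v ->
  L1 (fun x => u x * v x).
Proof.
move=> mu uc lv; apply: (L1_dom _ (L1Z c (L1_abs lv))).
  by apply: measurable_funM => //; exact: L1_meas.
by move=> x; rewrite normrM ler_wpM2r.
Qed.

Lemma L1_sum (I : Type) (s : seq I) (u : I -> T -> R) :
  (forall i, L1 (u i)) -> L1 (fun x => \sum_(i <- s) u i x).
Proof.
move=> lu; elim: s => [|i s IH].
  by under eq_fun do rewrite big_nil; exact: L1_cst.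
by under eq_fun do rewrite big_cons; exact: L1D.
Qed.

Lemma L2_L1 u : L2 u -> L1 u.
Proof.
move=> [mu lu]; apply: (L1_dom mu (L1D (L1_cst 1) lu)) => x.
rewrite -(real_normK (num_real (u x))).
by have := sqr_ge0 (`|u x| - 1); have := normr_ge0 (u x); nra.
Qed.

Lemma L2M u v : L2 u -> L2 v -> L1 (fun x => u x * v x).
Proof.
move=> [mu lu] [mv lv]; apply: (L1_dom _ (L1D lu lv)); first exact: measurable_funM.
move=> x; rewrite ler_norml; apply/andP.
have := sqr_ge0 (u x - v x); have := sqr_ge0 (u x + v x).
have := sqr_ge0 (u x); have := sqr_ge0 (v x); split; nra.
Qed.

Lemma L2D u v : L2 u -> L2 v -> L2 (fun x => u x + v x).
Proof.
move=> lu lv; have [mu su] := lu; have [mv sv] := lv.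
split; first exact: measurable_funD.
under eq_fun do rewrite sqrrD -mulr_natl.
by apply: L1D => //; apply: L1D => //; apply: L1Z; exact: L2M.
Qed.

Lemma L2N u : L2 u -> L2 (fun x => - u x).
Proof.
move=> [mu lu]; split; first exact: measurableT_comp.
by under eq_fun do rewrite sqrrN.
Qed.

Lemma L2B u v : L2 u -> L2 v -> L2 (fun x => u x - v x).
Proof. by move=> lu lv; apply: L2D => //; exact: L2N. Qed.

Lemma L2_abs u : L2 u -> L2 (fun x => `|u x|).
Proof.
move=> [mu lu]; split; first exact: measurableT_comp.
by under eq_fun do rewrite -normrX ger0_norm ?sqr_ge0//.
Qed.

Lemma L2_bdd u (c : R) : measurable_fun setT u -> (forall x, `|u x| <= c) -> L2 u.
Proof.
move=> mu uc; split=> //; apply: (L1_dom _ (L1_cst (c ^+ 2))).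
  exact: measurable_funX.
by move=> x; rewrite normrX lerXn2r ?nnegrE// (le_trans _ (uc x)).
Qed.

Lemma ExE u : L1 u -> (\int[P]_x (u x)%:E = (Ex u)%:E)%E.
Proof. by move=> lu; rewrite fineK//; apply: integrable_fin_num lu. Qed.

Lemma ExD u v : L1 u -> L1 v -> Ex (fun x => u x + v x) = Ex u + Ex v.
Proof. exact: RintegralD. Qed.

Lemma ExB u v : L1 u -> L1 v -> Ex (fun x => u x - v x) = Ex u - Ex v.
Proof. exact: RintegralB. Qed.

Lemma ExZ (c : R) u : L1 u -> Ex (fun x => c * u x) = c * Ex u.
Proof. exact: RintegralZl. Qed.

Lemma Ex_cst (c : R) : Ex (fun=> c) = c.
Proof. by rewrite /Ex /Rintegral integral_cst//= probability_setT mule1. Qed.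

Lemma Ex_le u v : L1 u -> L1 v -> (forall x, u x <= v x) -> Ex u <= Ex v.
Proof. by move=> lu lv uv; apply: le_Rintegral. Qed.

Lemma Ex_abs u : L1 u -> `|Ex u| <= Ex (fun x => `|u x|).
Proof. exact: le_normr_Rintegral. Qed.

Lemma Ex_ge0 u : (forall x, 0 <= u x) -> 0 <= Ex u.
Proof. by move=> u0; apply: Rintegral_ge0. Qed.

Lemma Ex_sum (I : Type) (s : seq I) (u : I -> T -> R) : (forall i, L1 (u i)) ->
  Ex (fun x => \sum_(i <- s) u i x) = \sum_(i <- s) Ex (u i).
Proof.
move=> lu; elim: s => [|i s IH].
  by under eq_fun do rewrite big_nil; rewrite Ex_cst big_nil.
under eq_fun do rewrite big_cons.
by rewrite ExD ?IH ?big_cons//; exact: L1_sum.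
Qed.

Lemma Ex_ae u v : measurable_fun setT u -> measurable_fun setT v ->
  {ae P, forall x, u x = v x} -> Ex u = Ex v.
Proof.
move=> mu mv uv; congr fine; apply: ae_eq_integral => //.
- exact/measurable_EFinP.
- exact/measurable_EFinP.
- by apply: filterS uv => x /= -> _.
Qed.

Lemma Ex_le_ae u v : L1 u -> L1 v -> {ae P, forall x, u x <= v x} -> Ex u <= Ex v.
Proof.
move=> lu lv uv; have [mu mv] := (L1_meas lu, L1_meas lv).
(* Replacing u by min(u, v) makes the inequality hold everywhere. *)
have mm : measurable_fun setT (fun x => Num.min (u x) (v x)) by exact: measurable_minr.
rewrite (@Ex_ae u (fun x => Num.min (u x) (v x)))//; last first.
  by apply: filterS uv => x /min_idPl ->.
apply: Ex_le => //; last by move=> x; rewrite ge_min lexx orbT.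
apply: (L1_ae mm lu).
by apply: filterS uv => x /min_idPl.
Qed.

Lemma L1_lty u : measurable_fun setT u -> (forall x, 0 <= u x) ->
  (\int[P]_x (u x)%:E < +oo)%E -> L1 u.
Proof.
move=> mu u0 uy; apply/integrableP; split; first exact/measurable_EFinP.
by under eq_integral do rewrite /= ger0_norm//.
Qed.

Lemma L1_lty_int u : L1 u -> (\int[P]_x (`|u x|)%:E < +oo)%E.
Proof. by move/integrableP => []. Qed.

End l1_l2.

Lemma vanishing_sets d (T : measurableType d) (R : realType) (P : probability T R)
    (H : (set T)^nat) (eps : R) : (forall n, measurable (H n)) ->
  (forall m n, (m <= n)%N -> H n `<=` H m) -> (forall x, exists n, ~ H n x) ->
  0 < eps -> exists K, (P (H K) <= eps%:E)%E.
Proof.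
move=> mH decH H0 e0.
have cH : P (H n) @[n --> \oo] --> P (\bigcap_n H n).
  apply: (@nonincreasing_cvg_mu _ _ _ P H) => //.
  - by rewrite (le_lt_trans (probability_le1 _ _)) ?ltry.
  - exact: bigcap_measurable.
  - by move=> m n mn; apply/subsetPset; exact: decH.
have H00 : \bigcap_n H n = set0.
  by apply/seteqP; split=> x // h; have [n] := H0 x; apply; exact: h.
rewrite H00 measure0 in cH.
have /fine_cvgP[_ /cvgr_lt] := cH.
move=> /(_ _ e0)[K _ /(_ K (leqnn K))]/= hK; exists K.
by rewrite -[P _]fineK ?fin_num_measure// lee_fin ltW.
Qed.

(** * Insensitivity of events to far coordinates *)

Section tail_resampling.
Context d' (S : measurableType d') (R : realType).
Local Notation E := (seq_space S).
Variable Q : probability E R.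
Hypothesis prodQ : forall B N, (forall j, measurable (B j)) ->
  Q (rect B N) = (\prod_(j < N) Q ((fun x : E => x j) @^-1` B j))%E.
Local Notation QQ := (Q \x Q)%E.

Definition tail n : pred nat := fun k => (n <= k)%N.

(** Membership in a set is passed as a function into [nat], so that one measurability proof serves
    both f and indicators. *)
Definition resampled (U : Type) (h : E -> U) n : set (E * E) :=
  [set w | h w.1 <> h (rep (tail n) w.1 w.2)].

Lemma QQ_fst A : measurable A -> QQ [set w : E * E | A w.1] = Q A.
Proof.
move=> mA; rewrite (_ : [set w | A w.1] = A `*` setT); last first.
  by apply/seteqP; split=> w //= -[].
have pQ U V : measurable U -> measurable V ->
  QQ (U `*` V) = (Q U * Q V)%E by exact: product_measure1E.
by rewrite pQ// [X in (_ * X)%E]probability_setT mule1.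
Qed.

Lemma QQ_rep I A : measurable A -> QQ [set w : E * E | A (rep I w.1 w.2)] = Q A.
Proof.
move=> mA; rewrite -(QQ_fst mA) -[RHS](exch_measure prodQ I)//.
by rewrite -[X in measurable X]setTI; apply: measurable_fst.
Qed.

Lemma QQ_setU A B : measurable A -> measurable B -> (QQ (A `|` B) <= QQ A + QQ B)%E.
Proof. by move=> mA mB; exact: measureU2. Qed.

Lemma QQ_le A B : measurable A -> measurable B -> A `<=` B -> (QQ A <= QQ B)%E.
Proof. by move=> mA mB AB; apply: le_measure; rewrite ?inE. Qed.

Lemma QQ_bigsetU (A : (set (E * E))^nat) n : (forall j, measurable (A j)) ->
  (QQ (\big[setU/set0]_(j < n) A j) <= \sum_(j < n) QQ (A j))%E.
Proof. by move=> mA; exact: Boole_inequality. Qed.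

Lemma measurable_resampled (h : E -> nat) n : measurable_fun setT h ->
  measurable (resampled h n).
Proof.
move=> mh.
have m1 : measurable_fun setT (fun w : E * E => h w.1).
  by apply: measurableT_comp => //; exact: measurable_fst.
have m2 : measurable_fun setT (fun w : E * E => h (rep (tail n) w.1 w.2)).
  by apply: measurableT_comp => //; exact: measurable_rep2.
rewrite (_ : resampled h n = ~` \bigcup_k
  (((fun w : E * E => h w.1) @^-1` [set k]) `&`
   ((fun w : E * E => h (rep (tail n) w.1 w.2)) @^-1` [set k]))).
  apply: measurableC; apply: bigcup_measurable => k _; apply: measurableI.
    by rewrite -[X in measurable X]setTI; exact: m1.
  by rewrite -[X in measurable X]setTI; exact: m2.
apply/seteqP; split=> w /=.
  by move=> hw [k _ [/= e1 e2]]; apply: hw; rewrite e1 e2.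
by move=> hw e; apply: hw; exists (h w.1) => //=; split.
Qed.

Lemma measurable_mem (A : set E) : measurable A -> measurable_fun setT (fun x => nat_of_bool (x \in A)).
Proof.
move=> mA; apply: (@measurableT_comp _ _ _ _ _ _ nat_of_bool) => //.
by apply: (measurable_fun_bool true); rewrite setTI (_ : _ @^-1` _ = A)//;
  apply/seteqP; split=> x /=; [move/set_mem|move/mem_set].
Qed.

Definition stable_tail (A : set E) := measurable A /\
  forall eps : R, 0 < eps -> exists N, forall n, (N <= n)%N ->
    (QQ (resampled (fun x => nat_of_bool (x \in A)) n) <= eps%:E)%E.

(** The finite union [G J] misses mass at most eps / 3. If membership in the whole union changes,
    then x or its resampling lies in the missing part, or membership in some [F j] with j < J
    changes. The resampled sequence also has law Q, so the three events cost eps / 3 each. *)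
Lemma stable_tail_bigcup (F : (set E)^nat) :
  (forall i, stable_tail (F i)) -> stable_tail (\bigcup_i F i).
Proof.
move=> sF; have mF i : measurable (F i) by have [] := sF i.
have mU : measurable (\bigcup_i F i) by exact: bigcup_measurable.
split=> // eps e0.
pose G n := \big[setU/set0]_(i < n) F i.
have mG n : measurable (G n) by exact: bigsetU_measurable.
have e3 : 0 < eps / 3 by rewrite divr_gt0.
have [J QJ] : exists J, (Q ((\bigcup_i F i) `\` G J) <= (eps / 3)%:E)%E.
  apply: (@vanishing_sets _ _ _ Q (fun n => (\bigcup_i F i) `\` G n)) => //.
  - by move=> n; exact: measurableD.
  - by move=> m n mn x [Fx Gx]; split=> // Gmx; apply: Gx; exact: (subset_bigsetU mn).
  - move=> x; have [[i _ Fix]|nF] := pselect ((\bigcup_i F i) x); last by exists 0%N => -[].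
    by exists i.+1 => -[_]; apply; rewrite /G big_ord_recr/=; right.
(* The bound is generalised for the induction on J; the divisor [J.+1] stays positive when J = 0. *)
have [N HN] : exists N, forall n, (N <= n)%N -> forall j, (j < J)%N ->
    (QQ (resampled (fun x => nat_of_bool (x \in F j)) n) <= (eps / 3 / J.+1%:R)%:E)%E.
  have p0 : 0 < eps / 3 / J.+1%:R by rewrite divr_gt0.
  elim: {QJ} J (eps / 3 / J.+1%:R) p0 => [|J IH] c c0; first by exists 0%N.
  have [N1 H1] := IH c c0; have [_ /(_ c c0)[N2 H2]] := sF J.
  exists (maxn N1 N2) => n; rewrite geq_max => /andP[n1 n2] j; rewrite ltnS leq_eqVlt.
  by move=> /orP[/eqP ->|jJ]; [exact: H2|exact: H1].
exists N => n Nn.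
pose W1 := \big[setU/set0]_(j < J) resampled (fun x => nat_of_bool (x \in F j)) n.
pose D := (\bigcup_i F i) `\` G J.
have mD : measurable D by exact: measurableD.
pose W2 := [set w : E * E | D w.1].
pose W3 := [set w : E * E | D (rep (tail n) w.1 w.2)].
have mW1 : measurable W1.
  by apply: bigsetU_measurable => j _; apply: measurable_resampled; exact: measurable_mem.
have mW2 : measurable W2.
  by rewrite -[X in measurable X]setTI; apply: measurable_fst.
have mW3 : measurable W3.
  by rewrite -[X in measurable X]setTI; apply: measurable_rep2.
have sub : resampled (fun x => nat_of_bool (x \in \bigcup_i F i)) n `<=` W1 `|` (W2 `|` W3).
  move=> w; rewrite /resampled/= => ne.
  have [h2|n2] := pselect (W2 w); first by right; left.
  have [h3|n3] := pselect (W3 w); first by right; right.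
  left; rewrite /W1 -(bigcup_mkord J (fun j => resampled (fun x => nat_of_bool (x \in F j)) n)); apply: contrapT => n1; apply: ne.
  have GE x : ~ D x -> (x \in \bigcup_i F i) = (x \in G J).
    move=> nDx; apply/idP/idP => /set_mem h; apply/mem_set.
      by apply: contrapT => h'; exact: nDx.
    exact: (@bigsetU_bigcup _ F J).
  rewrite (GE _ n2) (GE _ n3); congr nat_of_bool.
  have FE j : (j < J)%N -> (w.1 \in F j) = (rep (tail n) w.1 w.2 \in F j).
    move=> jJ; apply: contrapT => h; apply: n1; exists j => //=.
    by move=> e; apply: h; move: e; do 2 case: (_ \in _).
  have GJ x : G J x = exists2 j, (j < J)%N & F j x.
    by rewrite /G -(bigcup_mkord J F).
  apply/idP/idP => /set_mem; rewrite GJ => -[j jJ h]; apply/mem_set;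
    rewrite GJ; exists j => //; apply/set_mem; move/mem_set : h.
    by rewrite FE.
  by rewrite -FE.
apply: (@le_trans _ _ (QQ W1 + (QQ W2 + QQ W3))%E).
  apply: (le_trans (QQ_le _ _ sub)).
  - by apply: measurable_resampled; exact: measurable_mem.
  - by apply: measurableU => //; exact: measurableU.
  - apply: (le_trans (QQ_setU _ _)) => //; first exact: measurableU.
    by apply: leeD => //; exact: QQ_setU.
have -> : eps%:E = ((eps / 3)%:E + ((eps / 3)%:E + (eps / 3)%:E))%E.
  by rewrite -!EFinD; congr EFin; field.
apply: leeD; last first.
  by apply: leeD; [rewrite QQ_fst|rewrite QQ_rep].
apply: (@le_trans _ _ (\sum_(j < J) QQ (resampled (fun x => nat_of_bool (x \in F j)) n))%E).
  apply: (@QQ_bigsetU (fun j => resampled (fun x => nat_of_bool (x \in F j)) n)) => j; apply: measurable_resampled; exact: measurable_mem.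
apply: (@le_trans _ _ (\sum_(j < J) (eps / 3 / J.+1%:R)%:E)%E).
  by apply: lee_sum => j _; exact: HN.
rewrite sumEFin lee_fin sumr_const card_ord -[_ *+ J]mulr_natr.
by rewrite mulrAC ler_pdivrMr// ler_wpM2l ?(ltW e3)// ler_nat.
Qed.

(** Stable sets form a sigma-algebra, and a cylinder over coordinate i is unaffected by resampling
    from i + 1 on. *)
Lemma stable_tailP A : measurable A -> stable_tail A.
Proof.
move=> mA.
have : (<<s cylinders S >> : set (set E)) `<=` stable_tail.
  apply: smallest_sub.
    split.
    - split=> // eps e0; exists 0%N => n _.
      rewrite (_ : resampled _ _ = set0) ?measure0 ?lee_fin ?ltW//.
      by apply/seteqP; split=> w //=; rewrite /resampled/= !in_set0.
    - move=> B [mB hB]; rewrite setTD; split; first exact: measurableC.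
      move=> eps e0; have [N hN] := hB eps e0; exists N => n Nn.
      rewrite (_ : resampled _ _ = resampled (fun x => nat_of_bool (x \in B)) n).
        exact: hN.
      apply/seteqP; split=> w; rewrite /resampled/= !in_setC;
        by case: (_ \in _); case: (_ \in _).
    - exact: stable_tail_bigcup.
  move=> B cB; split; first exact: sub_sigma_algebra.
  move=> eps e0; case: cB => i _ [C mC <-]; exists i.+1 => n ni.
  rewrite (_ : resampled _ _ = set0) ?measure0 ?lee_fin ?ltW//.
  apply/seteqP; split=> w //=; apply; congr nat_of_bool.
  have e : rep (tail n) w.1 w.2 i = w.1 i by rewrite /rep /tail leqNgt ni.
  by apply/idP/idP => /set_mem[_ h]; apply/mem_set; split=> //=; move: h; rewrite /= e.
by apply.
Qed.

(* This replaces martingale convergence: [f] is almost a function of the first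
   [n] coordinates. *)
Lemma resampled_cvg0 (f : E -> nat) (eps : R) : measurable_fun setT f -> 0 < eps ->
  exists N, forall n, (N <= n)%N -> (QQ (resampled f n) <= eps%:E)%E.
Proof.
move=> mf e0.
have e2 : 0 < eps / 2 by rewrite divr_gt0.
pose F k := f @^-1` [set k].
have mF k : measurable (F k) by rewrite -[X in measurable X]setTI; exact: mf.
pose H n := [set x | (n <= f x)%N].
have mH n : measurable (H n).
  by rewrite -[X in measurable X]setTI (_ : H n = f @^-1` [set k | (n <= k)%N])//; exact: mf.
have [K QK] : exists K, (Q (H K) <= (eps / 2)%:E)%E.
  apply: vanishing_sets => //; first by move=> m n mn x; exact: leq_trans.
  by move=> x; exists (f x).+1; rewrite /H/= ltnn.
have [N HN] : exists N, forall n, (N <= n)%N -> forall k, (k < K)%N ->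
    (QQ (resampled (fun x => nat_of_bool (x \in F k)) n) <= (eps / 2 / K.+1%:R)%:E)%E.
  have p0 : 0 < eps / 2 / K.+1%:R by rewrite divr_gt0.
  elim: {QK} K (eps / 2 / K.+1%:R) p0 => [|K IH] c c0; first by exists 0%N.
  have [N1 H1] := IH c c0; have [_ /(_ c c0)[N2 H2]] := stable_tailP (mF K).
  exists (maxn N1 N2) => n; rewrite geq_max => /andP[n1 n2] j; rewrite ltnS leq_eqVlt.
  by move=> /orP[/eqP ->|jJ]; [exact: H2|exact: H1].
exists N => n Nn.
pose W1 := \big[setU/set0]_(k < K) resampled (fun x => nat_of_bool (x \in F k)) n.
pose W2 := [set w : E * E | H K w.1].
have mW1 : measurable W1.
  by apply: bigsetU_measurable => j _; apply: measurable_resampled; exact: measurable_mem.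
have mW2 : measurable W2.
  by rewrite -[X in measurable X]setTI; apply: measurable_fst.
(* A change of f is a change of membership in the level set of [f w.1], so only the first sequence
   has to avoid [H K]. *)
have sub : resampled f n `<=` W1 `|` W2.
  move=> w ne; have [h|h] := leqP K (f w.1); first by right.
  left; rewrite /W1 -(bigcup_mkord K (fun j => resampled (fun x => nat_of_bool (x \in F j)) n)); exists (f w.1) => //=.
  rewrite /resampled/= mem_set//; case: (boolP (_ \in _)) => // /set_mem h'.
  by exfalso; apply: ne; rewrite -h'.
apply: (@le_trans _ _ (QQ W1 + QQ W2)%E).
  apply: (le_trans (QQ_le _ _ sub)).
  - exact: measurable_resampled.
  - exact: measurableU.
  - exact: QQ_setU.
rewrite (splitr eps) EFinD; apply: leeD; last by rewrite QQ_fst.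
apply: (@le_trans _ _ (\sum_(j < K) QQ (resampled (fun x => nat_of_bool (x \in F j)) n))%E).
  apply: (@QQ_bigsetU (fun j => resampled (fun x => nat_of_bool (x \in F j)) n)) => j; apply: measurable_resampled; exact: measurable_mem.
apply: (@le_trans _ _ (\sum_(j < K) (eps / 2 / K.+1%:R)%:E)%E).
  by apply: lee_sum => j _; exact: HN.
rewrite sumEFin lee_fin sumr_const card_ord -[_ *+ K]mulr_natr.
by rewrite mulrAC ler_pdivrMr// ler_wpM2l ?(ltW e2)// ler_nat.
Qed.

End tail_resampling.

(** * Averages of nonnegative square-integrable functions *)

Section averaging.
Context d' (S : measurableType d') (R : realType).
Local Notation E := (seq_space S).
Variable Q : probability E R.
Hypothesis prodQ : forall B N, (forall j, measurable (B j)) ->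
  Q (rect B N) = (\prod_(j < N) Q ((fun x : E => x j) @^-1` B j))%E.
Implicit Types (I J : pred nat) (x y z : E) (u v : E -> R).

(* E[u(X) | X_k, k \notin I] *)
Definition ce u I x : R := fine (EI Q I (EFin \o u) x).

Lemma ceE u I x : ce u I x = Ex Q (fun y => u (rep I x y)).
Proof. by []. Qed.

(** Nonnegativity keeps the manipulation of averages within Tonelli. F, absolute values, indicators
    and suitably shifted test functions all qualify. *)
Definition nn2 u := (forall x, 0 <= u x) /\ L2 Q u.

Lemma nnegm_EFin u : measurable_fun setT u -> (forall x, 0 <= u x) -> nnegm (EFin \o u).
Proof.
by move=> mu u0; split=> [|x]; [exact/measurable_EFinP|rewrite /= lee_fin].
Qed.

Lemma nn2_nnegm u : nn2 u -> nnegm (EFin \o u).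
Proof. by move=> [u0 [mu _]]; exact: nnegm_EFin. Qed.

Lemma measurable_ce u I : measurable_fun setT u -> (forall x, 0 <= u x) ->
  measurable_fun setT (ce u I).
Proof.
move=> mu u0; apply: measurableT_comp => //.
by have [] := nnegm_EI Q I (nnegm_EFin mu u0).
Qed.

Lemma ce_ge0 u I x : (forall x, 0 <= u x) -> 0 <= ce u I x.
Proof. by move=> u0; apply: fine_ge0; apply: integral_ge0 => y _; rewrite lee_fin. Qed.

Lemma EI_ce u I : (forall x, 0 <= u x) -> L1 Q u ->
  {ae Q, forall x, EI Q I (EFin \o u) x = (ce u I x)%:E}.
Proof.
move=> u0 lu; have nu := nnegm_EFin (L1_meas lu) u0; have [mI I0] := nnegm_EI Q I nu.
have iI : Q.-integrable setT (EI Q I (EFin \o u)).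
  apply/integrableP; split=> //.
  under eq_integral do rewrite gee0_abs//.
  rewrite int_EI//; move/integrableP : lu => [_]; apply: le_lt_trans.
  have [mu' u0'] := nu.
  apply: ge0_le_integral => //; first exact: measurableT_comp.
  by move=> x _; exact: lee_abs.
apply: filterS (integrable_ae measurableT iI) => x /= h.
by rewrite /ce fineK//; exact: h.
Qed.

Lemma int_ceM u v I J : nn2 u -> nn2 v ->
  (\int[Q]_x (ce u I x * ce v J x)%:E =
   \int[Q]_x ((u x)%:E * EI Q (fun j => I j || J j) (EFin \o v) x))%E.
Proof.
move=> nu nv; rewrite -(int_EI_EI prodQ I J (nn2_nnegm nu) (nn2_nnegm nv)).
have [[mI I0] [mJ J0]] := (nnegm_EI Q I (nn2_nnegm nu), nnegm_EI Q J (nn2_nnegm nv)).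
have [u0 lu] := nu; have [v0 lv] := nv.
apply: ge0_ae_eq_integral => //.
- apply/measurable_EFinP; apply: measurable_funM; apply: measurable_ce => //.
    by case: lu.
  by case: lv.
- exact: emeasurable_funM.
- by move=> x _; rewrite lee_fin mulr_ge0 ?ce_ge0//.
- by move=> x _; rewrite mule_ge0.
- have := EI_ce J v0 (L2_L1 lv); have := EI_ce I u0 (L2_L1 lu).
  by apply: filterS2 => x -> -> _; rewrite EFinM.
Qed.

(** From u(x) u(x') <= u(x)^2 + u(x')^2, whose integral is twice the second moment of u. With
    [int_ceM] this makes averages square integrable in [nn2_ce]. *)
Lemma int_uEI_lty u I : nn2 u ->
  (\int[Q]_x ((u x)%:E * EI Q I (EFin \o u) x) < +oo)%E.
Proof.
move=> nu; have [u0 [mu su]] := nu; have nE := nn2_nnegm nu.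
have nE2 : nnegm (EFin \o (fun x => u x ^+ 2)).
  by apply: nnegm_EFin; [exact: measurable_funX|move=> x; exact: sqr_ge0].
have [m2 p2] := nE2; have [mI I0] := nnegm_EI Q I nE; have [mI2 I20] := nnegm_EI Q I nE2.
apply: (@le_lt_trans _ _ (\int[Q]_x ((u x ^+ 2)%:E + EI Q I (EFin \o (fun x => u x ^+ 2)%R) x)%E)%E).
  apply: ge0_le_integral => //.
  - by move=> x _; rewrite mule_ge0// lee_fin.
  - by apply: emeasurable_funM => //; exact/measurable_EFinP.
  - exact: emeasurable_funD.
  - move=> x _.
    have mx v : measurable_fun setT v -> measurable_fun setT (fun y => (v (rep I x y))%:E).
      move=> mv; apply/measurable_EFinP; apply: measurableT_comp => //.
      exact: measurable_repx.
    rewrite -ge0_integralZl//; last 3 first.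
    + exact: mx.
    + by move=> y _; rewrite lee_fin.
    + by rewrite lee_fin.
    apply: (@le_trans _ _ (\int[Q]_y ((u x ^+ 2)%:E + (u (rep I x y) ^+ 2)%:E))%E).
      apply: ge0_le_integral => //.
      * by move=> y _; rewrite mule_ge0// lee_fin.
      * by apply: emeasurable_funM => //; exact: mx.
      * apply: emeasurable_funD => //; apply: (mx (fun y => u y ^+ 2)).
        exact: measurable_funX.
      * move=> y _; rewrite -EFinM -EFinD lee_fin.
        by have := sqr_ge0 (u x - u (rep I x y)); have := u0 x; have := u0 (rep I x y); nra.
    rewrite ge0_integralD//; last 3 first.
    + by move=> y _; rewrite lee_fin sqr_ge0.
    + by move=> y _; rewrite lee_fin sqr_ge0.
    + by apply: (mx (fun y => u y ^+ 2)); exact: measurable_funX.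
    by rewrite integral_cst//= [X in (_ * X + _)%E]probability_setT mule1.
rewrite ge0_integralD//; last by move=> x _; rewrite lee_fin sqr_ge0.
rewrite int_EI// -ge0_fin_numE; last first.
  by apply: adde_ge0; apply: integral_ge0 => x _; rewrite lee_fin sqr_ge0.
by rewrite fin_numD !integrable_fin_num.
Qed.

Lemma nn2_ce u I : nn2 u -> nn2 (ce u I).
Proof.
move=> nu; have [u0 [mu su]] := nu.
have mc := measurable_ce I mu u0.
split; first by move=> x; exact: ce_ge0.
split=> //; apply: L1_lty; first exact: measurable_funX.
  by move=> x; exact: sqr_ge0.
under eq_integral do rewrite expr2.
rewrite int_ceM//; exact: int_uEI_lty.
Qed.

Lemma L2_ce u I : nn2 u -> L2 Q (ce u I).
Proof. by move=> /(nn2_ce I)[]. Qed.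

Lemma Ex_ceM u v I J : nn2 u -> nn2 v ->
  Ex Q (fun x => ce u I x * ce v J x) = Ex Q (fun x => u x * ce v (fun j => I j || J j) x).
Proof.
move=> nu nv; rewrite /Ex /Rintegral; congr fine.
rewrite (int_ceM I J nu nv).
have [u0 [mu _]] := nu; have [v0 lv] := nv; have [mv _] := lv.
have [mI I0] := nnegm_EI Q (fun j => I j || J j) (nn2_nnegm nv).
apply: ge0_ae_eq_integral => //.
- by apply: emeasurable_funM => //; exact/measurable_EFinP.
- by apply/measurable_EFinP; apply: measurable_funM => //; exact: measurable_ce.
- by move=> x _; rewrite mule_ge0// lee_fin.
- by move=> x _; rewrite lee_fin mulr_ge0 ?ce_ge0//.
- have := EI_ce (fun j => I j || J j) v0 (L2_L1 lv).
  by apply: filterS => x -> _; rewrite EFinM.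
Qed.

Lemma eq_ce u I J : I =1 J -> ce u I = ce u J.
Proof. by move=> /funext ->. Qed.

Lemma ce_inv u I x : (forall y, u (rep I x y) = u x) -> ce u I x = u x.
Proof. by move=> e; rewrite /ce EI_inv//= => y; rewrite e. Qed.

Lemma ce_rep u I J x y : (forall j, J j -> I j) -> ce u I (rep J x y) = ce u I x.
Proof. by move=> JI; rewrite /ce EI_rep. Qed.

Lemma Ex_adj u v I : nn2 u -> nn2 v ->
  Ex Q (fun x => ce u I x * v x) = Ex Q (fun x => u x * ce v I x).
Proof.
move=> nu nv.
rewrite (_ : (fun x => ce u I x * v x) = fun x => ce u I x * ce v (fun=> false) x).
  rewrite (Ex_ceM I (fun=> false) nu nv).
  by have -> : ce v (fun j => I j || false) = ce v I by apply: eq_ce => j; rewrite orbF.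
by apply/funext => x; rewrite [ce v _ x]ce_inv.
Qed.

End averaging.

(** * Martingale differences *)

Section martingale.
Local Opaque ce Ex.
Context d' (S : measurableType d') (R : realType).
Local Notation E := (seq_space S).
Variable Q : probability E R.
Hypothesis prodQ : forall B N, (forall j, measurable (B j)) ->
  Q (rect B N) = (\prod_(j < N) Q ((fun x : E => x j) @^-1` B j))%E.
Variable f : E -> nat.
Hypothesis mf : measurable_fun setT f.
Local Notation g := (fun x => (f x)%:R : R).
Hypothesis L2g : L2 Q g.
Implicit Types (I J : pred nat) (x y z : E) (u v : E -> R).

Let nn2g : nn2 Q g. Proof. by split=> // x; rewrite ler0n. Qed.

Definition single (i : nat) : pred nat := fun k => k == i.

(* E_i F, D_i F, E[F | X_k, k < n] and E[D_i F | X_k, k <= i] *)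
Definition ei i : E -> R := ce Q g (single i).
Definition dg i x : R := g x - ei i x.
Definition ma n : E -> R := ce Q g (tail n).
Definition ad i x : R := ma i.+1 x - ma i x.

Lemma L2_ei i : L2 Q (ei i). Proof. exact: L2_ce. Qed.
Lemma L2_ma n : L2 Q (ma n). Proof. exact: L2_ce. Qed.
Lemma L2_dg i : L2 Q (dg i). Proof. exact: L2B (L2_ei i). Qed.
Lemma L2_ad i : L2 Q (ad i). Proof. exact: L2B (L2_ma _) (L2_ma _). Qed.

(** This gives E[E_i F | F_i] = [ma i], and hence the form [ma i.+1 - ma i] of E[D_i F | F_i]. *)
Lemma single_tail i : (fun j => single i j || tail i.+1 j) =1 tail i.
Proof. by move=> j; rewrite /single /tail [RHS]leq_eqVlt eq_sym. Qed.

Lemma tail_single i : (fun j => tail i.+1 j || single i j) =1 tail i.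
Proof. by move=> j; rewrite orbC; exact: single_tail. Qed.

Lemma tail_single' i : (fun j => tail i j || single i j) =1 tail i.
Proof. by move=> j; rewrite /single /tail; case: eqP => [->|]; rewrite ?leqnn ?orbF. Qed.

Lemma tail_tail m n : (m <= n)%N -> (fun j => tail n j || tail m j) =1 tail m.
Proof.
by move=> mn j; rewrite /tail; case: leqP => //= nj; rewrite (leq_trans mn).
Qed.

Lemma tail_tail' m n : (m <= n)%N -> (fun j => tail m j || tail n j) =1 tail m.
Proof. by move=> mn j; rewrite orbC; exact: tail_tail. Qed.

Lemma Ex_adM i v : L2 Q v ->
  Ex Q (fun x => ad i x * v x) = Ex Q (fun x => ma i.+1 x * v x) - Ex Q (fun x => ma i x * v x).
Proof.
move=> lv; rewrite -ExB; [|exact: L2M (L2_ma _) lv|exact: L2M (L2_ma _) lv].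
by congr Ex; apply/funext => x; rewrite mulrBl.
Qed.

(** Moved onto v by adjointness, both terms of the increment become the average over the tail from
    i. *)
Lemma Ex_ad_ce i v : nn2 Q v -> Ex Q (fun x => ad i x * ce Q v (single i) x) = 0.
Proof.
move=> nv; rewrite Ex_adM; last exact: (L2_ce prodQ).
rewrite (Ex_ceM prodQ (tail i.+1) (single i) nn2g nv).
rewrite (Ex_ceM prodQ (tail i) (single i) nn2g nv).
by rewrite (eq_ce Q v (tail_single i)) (eq_ce Q v (tail_single' i)) subrr.
Qed.

Lemma Ex_ma_ma m n : (m <= n)%N -> Ex Q (fun x => ma n x * ma m x) = Ex Q (fun x => g x * ma m x).
Proof.
move=> mn; rewrite (Ex_ceM prodQ (tail n) (tail m) nn2g nn2g).
by rewrite (eq_ce Q _ (tail_tail mn)).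
Qed.

Lemma Ex_ma_ma' m n : (m <= n)%N -> Ex Q (fun x => ma m x * ma n x) = Ex Q (fun x => g x * ma m x).
Proof.
move=> mn; rewrite (Ex_ceM prodQ (tail m) (tail n) nn2g nn2g).
by rewrite (eq_ce Q _ (tail_tail' mn)).
Qed.

Lemma Ex_ad_sq i :
  Ex Q (fun x => ad i x ^+ 2) = Ex Q (fun x => g x * ma i.+1 x) - Ex Q (fun x => g x * ma i x).
Proof.
rewrite -[LHS]/(Ex Q (fun x => ad i x * ad i x)) Ex_adM; last exact: L2_ad.
have e n : Ex Q (fun x => ma n x * ad i x) =
    Ex Q (fun x => ma n x * ma i.+1 x) - Ex Q (fun x => ma n x * ma i x).
  rewrite -ExB; [|exact: L2M (L2_ma _) (L2_ma _)|exact: L2M (L2_ma _) (L2_ma _)].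
  by congr Ex; apply/funext => x; rewrite mulrBr.
rewrite !e (Ex_ma_ma (leqnn i.+1)) (Ex_ma_ma (leqnSn i)) (Ex_ma_ma' (leqnSn i)).
rewrite (Ex_ma_ma (leqnn i)).
move: (Ex Q (fun x => g x * ma i x)).
move: (Ex Q _) => A B.
by rewrite subrr subr0.
Qed.

Lemma Ex_ad_dg i : Ex Q (fun x => ad i x * dg i x) = Ex Q (fun x => ad i x ^+ 2).
Proof.
have -> : Ex Q (fun x => ad i x * dg i x) =
    Ex Q (fun x => ad i x * g x) - Ex Q (fun x => ad i x * ei i x).
  rewrite -ExB; [|exact: L2M (L2_ad _) L2g|exact: L2M (L2_ad _) (L2_ei _)].
  by congr Ex; apply/funext => x; rewrite mulrBr.
rewrite (Ex_ad_ce i nn2g) subr0 Ex_adM// Ex_ad_sq.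
by congr (_ - _); congr Ex; apply/funext => x; rewrite mulrC.
Qed.

Lemma ad_rep i x y : ad i (rep (tail i.+1) x y) = ad i x.
Proof.
rewrite /ad /ma ce_rep// ce_rep// => j; rewrite /tail; exact: ltnW.
Qed.

(** The defining property of E[D_i F | F_i], for test functions b of the coordinates up to i.
    Indicators identify [ad i] with [condD]; |a_i| gives [Ex_abs_ad_dg]. *)
Lemma Ex_inv_ad i b : nn2 Q b -> (forall x y, b (rep (tail i.+1) x y) = b x) ->
  Ex Q (fun x => b x * dg i x) = Ex Q (fun x => b x * ad i x).
Proof.
move=> nb bI; have [_ lb] := nb.
have cb : ce Q b (tail i.+1) = b.
  by apply/funext => x; rewrite ce_inv// => y; rewrite bI.
have e1 : Ex Q (fun x => b x * dg i x) = Ex Q (fun x => b x * g x) - Ex Q (fun x => b x * ei i x).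
  rewrite -ExB; [|exact: L2M lb L2g|exact: L2M lb (L2_ei _)].
  by congr Ex; apply/funext => x; rewrite mulrBr.
have e2 : Ex Q (fun x => b x * ad i x) =
    Ex Q (fun x => b x * ma i.+1 x) - Ex Q (fun x => b x * ma i x).
  rewrite -ExB; [|exact: L2M lb (L2_ma _)|exact: L2M lb (L2_ma _)].
  by congr Ex; apply/funext => x; rewrite mulrBr.
rewrite e1 e2; congr (_ - _).
  by rewrite -[in LHS]cb (Ex_adj prodQ (tail i.+1) nb nn2g).
rewrite -[in LHS]cb (Ex_ceM prodQ (tail i.+1) (single i) nb nn2g).
by rewrite (eq_ce Q _ (tail_single i)).
Qed.

Lemma Ex_abs_ad_dg i :
  Ex Q (fun x => `|ad i x| * dg i x) = Ex Q (fun x => `|ad i x| * ad i x).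
Proof.
apply: Ex_inv_ad => [|x y]; last by rewrite ad_rep.
by split=> [x|]; [exact: normr_ge0|exact: L2_abs (L2_ad i)].
Qed.

End martingale.

(** * Convergence of E[F | X_k, k < n] against bounded functions of F *)

Section convergence.
Context d' (S : measurableType d') (R : realType).
Local Notation E := (seq_space S).
Variable Q : probability E R.
Hypothesis prodQ : forall B N, (forall j, measurable (B j)) ->
  Q (rect B N) = (\prod_(j < N) Q ((fun x : E => x j) @^-1` B j))%E.
Variable f : E -> nat.
Hypothesis mf : measurable_fun setT f.
Local Notation g := (fun x => (f x)%:R : R).
Hypothesis L2g : L2 Q g.
Implicit Types (x y : E) (u v : E -> R).

Let nn2g : nn2 Q g. Proof. by split=> // x; rewrite ler0n. Qed.

(** The conditional probability, given x, that resampling the coordinates from n on changes f. *)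
Definition be n x : R := Ex Q (fun y => \1_(resampled f n) (x, y)).

Let mres n : measurable (resampled f n). Proof. exact: measurable_resampled. Qed.

Let m1 n : measurable_fun setT (fun w : E * E => (\1_(resampled f n) w : R)%:E).
Proof. by apply/measurable_EFinP; exact: measurable_indic. Qed.

Let m1x n x : measurable_fun setT (fun y : E => (\1_(resampled f n) (x, y) : R)).
Proof.
apply: measurableT_comp; first exact: measurable_indic.
by apply: measurable_fun_pair => //; exact: measurable_cst.
Qed.

Let L11 n x : L1 Q (fun y : E => (\1_(resampled f n) (x, y) : R)).
Proof.
apply: (L1_dom (m1x n x) (L1_cst Q 1)) => y.
by rewrite indicE; case: (_ \in _); rewrite /= ?normr1 ?normr0.
Qed.

Lemma be01 n x : 0 <= be n x <= 1.
Proof.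
rewrite /be Ex_ge0/=; last by move=> y; rewrite indicE.
rewrite -[leRHS](Ex_cst Q); apply: Ex_le; [exact: L11|exact: L1_cst|move=> y].
by rewrite indicE; case: (_ \in _).
Qed.

Let beE n : EFin \o be n = fun x => (\int[Q]_y (\1_(resampled f n) (x, y) : R)%:E)%E.
Proof. by apply/funext => x /=; rewrite ExE. Qed.

Lemma measurable_be n : measurable_fun setT (be n).
Proof.
apply/measurable_EFinP; rewrite beE.
apply: (@measurable_fun_fubini_tonelli_F _ _ E E R Q (fun w => (\1_(resampled f n) w : R)%:E)) => //.
Qed.

Lemma L1_be n : L1 Q (be n).
Proof.
apply: (L1_dom (measurable_be n) (L1_cst Q 1)) => x.
by have /andP[b0 b1] := be01 n x; rewrite ger0_norm.
Qed.

Lemma Ex_be n : ((Ex Q (be n))%:E = (Q \x Q) (resampled f n))%E.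
Proof.
rewrite -ExE; last exact: L1_be.
rewrite (_ : (\int[Q]_x (be n x)%:E)%E = (\int[Q]_x (EFin \o be n) x)%E)// beE.
rewrite -(fubini_tonelli1 (fun w => (\1_(resampled f n) w : R)%:E)) => [|//|w].
  by rewrite integral_indic// setIT.
by rewrite lee_fin indicE.
Qed.

(** As F is unbounded, F [be n] <= K [be n] + F^2 / K is used: K makes the last term small, then n
    the first. *)
Lemma Ex_g_be (eps : R) : 0 < eps ->
  exists N, forall n, (N <= n)%N -> Ex Q (fun x => g x * be n x) <= eps.
Proof.
move=> e0; have [mg sg] := L2g.
pose V := Ex Q (fun x => g x ^+ 2).
have V0 : 0 <= V by apply: Ex_ge0 => x; exact: sqr_ge0.
(* V + 1 rather than V keeps K positive when V = 0. *)
have [K K0 hV] : exists2 K, 0 < K & K^-1 * V <= eps / 2.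
  have V1 : 0 < V + 1 by rewrite ltr_wpDl.
  exists (2 * (V + 1) / eps); first by rewrite divr_gt0// mulr_gt0.
  have -> : (2 * (V + 1) / eps)^-1 * V = V / (V + 1) * (eps / 2).
    by field; rewrite !gt_eqF.
  by rewrite ler_piMl ?divr_ge0 ?(ltW e0)// ler_pdivrMr// mul1r lerDl.
have e2 : 0 < eps / 2 / K by apply: divr_gt0 => //; exact: divr_gt0.
have [N HN] := resampled_cvg0 prodQ mf e2; exists N => n Nn.
have LK : L1 Q (fun x => K * be n x) by apply: L1Z; exact: L1_be.
have Lg : L1 Q (fun x => K^-1 * g x ^+ 2) by exact: L1Z.
have Ll : L1 Q (fun x => g x * be n x).
  apply: (L1_dom _ (L2_L1 L2g)); first by apply: measurable_funM => //; exact: measurable_be.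
  move=> x; have /andP[b0 b1] := be01 n x.
  by rewrite normrM !ger0_norm// ler_piMr.
apply: (@le_trans _ _ (Ex Q (fun x => K * be n x + K^-1 * g x ^+ 2))).
  apply: Ex_le => //; first exact: L1D.
  move=> x; have /andP[b0 b1] := be01 n x.
  have g0 : 0 <= g x :> R by [].
  have [gK|Kg] := leP (g x) K.
    by rewrite ler_wpDr// ?mulr_ge0 ?invr_ge0 ?sqr_ge0 ?(ltW K0)// ler_wpM2r.
  rewrite ler_wpDl// ?mulr_ge0 ?(ltW K0)//.
  apply: (@le_trans _ _ (g x)); first exact: ler_piMr.
  by rewrite mulrC ler_pdivlMr// expr2 ler_wpM2l// ltW.
rewrite ExD// !ExZ//; last exact: L1_be.
rewrite -/V.
have hb : Ex Q (be n) <= eps / 2 / K by rewrite -lee_fin Ex_be; exact: HN.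
have : K * Ex Q (be n) <= eps / 2.
  by rewrite mulrC -ler_pdivlMr.
move: hV; move: (Ex Q (be n)) => A; lra.
Qed.

Section bounded_test.
Variables (phi : nat -> R) (C : R).
Hypothesis phi01 : forall k, 0 <= phi k <= C.
Let psi x := phi (f x).

Let C0 : 0 <= C. Proof. by have /andP[h1 h2] := phi01 0; exact: le_trans h2. Qed.

Lemma measurable_psi : measurable_fun setT psi.
Proof. exact: (@measurableT_comp _ _ _ _ _ _ phi). Qed.

Lemma nn2_psi : nn2 Q psi.
Proof.
split=> [x|]; first by have /andP[] := phi01 (f x).
apply: (@L2_bdd _ _ _ _ _ C); first exact: measurable_psi.
by move=> x; have /andP[h1 h2] := phi01 (f x); rewrite ger0_norm.
Qed.

Lemma ce_psi_close n x : `|ce Q psi (tail n) x - psi x| <= C * be n x.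
Proof.
have mr : measurable_fun setT (fun y => psi (rep (tail n) x y)).
  by apply: measurableT_comp; [exact: measurable_psi|exact: measurable_repx].
have Lr : L1 Q (fun y => psi (rep (tail n) x y)).
  apply: (L1_dom mr (L1_cst Q C)) => y.
  by have /andP[h1 h2] := phi01 (f (rep (tail n) x y)); rewrite ger0_norm.
have Lc : L1 Q (fun=> psi x) by exact: L1_cst.
rewrite ceE -[X in _ - X](Ex_cst Q) -ExB//.
apply: (le_trans (Ex_abs (L1B Lr Lc))).
rewrite -ExZ; last exact: L11.
apply: Ex_le; [exact: L1_abs (L1B Lr Lc)|exact: L1Z (L11 n x)|move=> y].
have /andP[h1 h2] := phi01 (f (rep (tail n) x y)).
have /andP[h3 h4] := phi01 (f x).
rewrite indicE; case: (boolP (_ \in _)) => /= [_|nr].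
  by rewrite mulr1 ler_norml; apply/andP; split; rewrite /psi; lra.
rewrite mulr0 (_ : psi (rep (tail n) x y) = psi x) ?subrr ?normr0//.
rewrite /psi; congr phi; apply: contrapT => ne.
by move/negP : nr; apply; apply/mem_set => /= e; apply: ne.
Qed.

(** Adjointness moves the average from the unbounded F to the bounded psi, which it changes by at
    most C [be n]. *)
Lemma Ex_ma_psi_cvg :
  Ex Q (fun x => ma Q f n x * psi x) @[n --> \oo] --> Ex Q (fun x => g x * psi x).
Proof.
apply/cvgrPdist_le => eps e0.
have C1 : 0 < C + 1 by rewrite ltr_wpDl.
have [N HN] := Ex_g_be (divr_gt0 e0 C1).
exists N => // n /= Nn.
have np := nn2_psi; have [_ lp] := np.
have nc := nn2_ce prodQ (tail n) np; have [_ lc] := nc.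
rewrite (Ex_adj prodQ (tail n) nn2g np).
rewrite -ExB; [|exact: L2M L2g lp|exact: L2M L2g lc].
have LB : L1 Q (fun x => g x * psi x - g x * ce Q psi (tail n) x).
  by apply: L1B; [exact: L2M L2g lp|exact: L2M L2g lc].
have Ll : L1 Q (fun x => g x * be n x).
  have [mg _] := L2g.
  apply: (L1_dom _ (L2_L1 L2g)); first by apply: measurable_funM => //; exact: measurable_be.
  move=> x; have /andP[b0 b1] := be01 n x.
  by rewrite normrM !ger0_norm// ler_piMr.
apply: (le_trans (Ex_abs LB)).
apply: (@le_trans _ _ (Ex Q (fun x => C * (g x * be n x)))).
  apply: Ex_le; [exact: L1_abs|exact: L1Z|move=> x].
  rewrite -mulrBr normrM ger0_norm// mulrCA ler_wpM2l//.
  by rewrite distrC; exact: ce_psi_close.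
rewrite ExZ//; have := HN n Nn; rewrite ler_pdivlMr//.
have : 0 <= Ex Q (fun x => g x * be n x).
  by apply: Ex_ge0 => x; have /andP[b0 _] := be01 n x; exact: mulr_ge0.
move: (Ex Q _) => A; nra.
Qed.

End bounded_test.

End convergence.

(** * Variance and covariances as sums over martingale differences *)

Section martingale_sums.
Context d' (S : measurableType d') (R : realType).
Local Notation E := (seq_space S).
Variable Q : probability E R.
Hypothesis prodQ : forall B N, (forall j, measurable (B j)) ->
  Q (rect B N) = (\prod_(j < N) Q ((fun x : E => x j) @^-1` B j))%E.
Variable f : E -> nat.
Hypothesis mf : measurable_fun setT f.
Local Notation g := (fun x => (f x)%:R : R).
Hypothesis L2g : L2 Q g.
Implicit Types (x y : E) (u v : E -> R).

Let nn2g : nn2 Q g. Proof. by split=> // x; rewrite ler0n. Qed.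
Let L2m n : L2 Q (ma Q f n). Proof. exact: L2_ma. Qed.
Let L2a i : L2 Q (ad Q f i). Proof. exact: L2_ad. Qed.

(** Expand E (F - [ma n])^2 >= 0, using E [ma n]^2 = E F [ma n]. *)
Lemma Ex_g_ma_le n : Ex Q (fun x => g x * ma Q f n x) <= Ex Q (fun x => g x ^+ 2).
Proof.
have h0 : 0 <= Ex Q (fun x => (g x - ma Q f n x) ^+ 2) by apply: Ex_ge0 => x; exact: sqr_ge0.
have e : Ex Q (fun x => (g x - ma Q f n x) ^+ 2) =
   Ex Q (fun x => g x ^+ 2) - 2 * Ex Q (fun x => g x * ma Q f n x) +
   Ex Q (fun x => ma Q f n x * ma Q f n x).
  have [_ sg] := L2g.
  rewrite -ExZ; last exact: L2M L2g (L2m n).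
  rewrite -ExB//; last by apply: L1Z; exact: L2M L2g (L2m n).
  rewrite -ExD; last 2 first.
  - by apply: L1B => //; apply: L1Z; exact: L2M L2g (L2m n).
  - exact: L2M (L2m n) (L2m n).
  by congr Ex; apply/funext => x; ring.
move: h0; rewrite e (Ex_ma_ma prodQ L2g (leqnn n)).
move: (Ex Q _) (Ex Q _) => A B; lra.
Qed.

Lemma Ex_g_min_cvg :
  Ex Q (fun x => g x * (minn (f x) K)%:R) @[K --> \oo] --> Ex Q (fun x => g x ^+ 2).
Proof.
have [mg sg] := L2g.
pose F K x := (g x * (minn (f x) K)%:R)%:E.
have mF K : measurable_fun setT (F K).
  apply/measurable_EFinP; apply: measurable_funM => //.
  exact: (@measurableT_comp _ _ _ _ _ _ (fun k => (minn k K)%:R : R)).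
have cF x : F K x @[K --> \oo] --> (g x ^+ 2)%:E.
  apply: cvg_near_cst; exists (f x) => // K /= fK.
  by rewrite /F (minn_idPl fK) expr2.
have dF K x : (`|F K x| <= (g x ^+ 2)%:E)%E.
  by rewrite /F lee_fin ger0_norm ?mulr_ge0// expr2 ler_wpM2l// ler_nat geq_minl.
have := @dominated_convergence _ E R Q setT measurableT F (EFin \o (fun x => g x ^+ 2))
  (EFin \o (fun x => g x ^+ 2)) mF _ _ sg _.
move=> H; have [|||_ _ h] := H.
- by apply/measurable_EFinP; exact: measurable_funX.
- by apply: aeW => x _; exact: cF.
- by apply: aeW => x K _; exact: dF.
have := fine_cvg (_ : _ --> (Ex Q (fun x => g x ^+ 2))%:E); apply.
by rewrite -ExE.
Qed.

(** A squeeze between E [ma n] min(F, K) and E F^2; the lower bound holds because [ma n] is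
    nonnegative. K is chosen first, then n by [Ex_ma_psi_cvg], as the truncation is a bounded test
    function. *)
Lemma Ex_g_ma_cvg :
  Ex Q (fun x => g x * ma Q f n x) @[n --> \oo] --> Ex Q (fun x => g x ^+ 2).
Proof.
apply/cvgrPdist_le => eps e0.
have e2 : 0 < eps / 2 by rewrite divr_gt0.
have /cvgrPdist_le/(_ _ e2)[K _ /(_ K (leqnn K)) hK] := Ex_g_min_cvg.
have p01 k : 0 <= ((minn k K)%:R : R) <= K%:R by rewrite ler0n ler_nat geq_minr.
have /cvgrPdist_le/(_ _ e2)[N _ hN] := Ex_ma_psi_cvg prodQ mf L2g p01.
exists N => // n Nn; have := hN n Nn; have := Ex_g_ma_le n; move: hK => /=.
have : Ex Q (fun x => ma Q f n x * (minn (f x) K)%:R) <= Ex Q (fun x => g x * ma Q f n x).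
  have lp : L2 Q (fun x => (minn (f x) K)%:R).
    by have [] := nn2_psi Q mf p01.
  apply: Ex_le; [exact: L2M (L2m n) lp|exact: L2M L2g (L2m n)|move=> x].
  rewrite mulrC ler_wpM2r ?ler_nat ?geq_minl//.
  by have [h _] := nn2_ce prodQ (tail n) nn2g; exact: h.
rewrite !ler_norml => h1 /andP[h2 h3] h4 /andP[h5 h6].
apply/andP; move: h1 h2 h3 h4 h5 h6.
move: (Ex Q _) (Ex Q _) (Ex Q _) (Ex Q _) => A B C D; split; lra.
Qed.

Lemma ma0 x : ma Q f 0 x = Ex Q g.
Proof. by []. Qed.

Lemma sum_ad_sq n : \sum_(i < n) Ex Q (fun x => ad Q f i x ^+ 2) =
  Ex Q (fun x => g x * ma Q f n x) - Ex Q g ^+ 2.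
Proof.
elim: n => [|n IH].
  rewrite big_ord0 (_ : (fun x => g x * ma Q f 0 x) = fun x => Ex Q g * g x).
    by rewrite ExZ ?subrr//; exact: L2_L1.
  by apply/funext => x; rewrite ma0 mulrC.
rewrite big_ord_recr/= IH (Ex_ad_sq prodQ L2g).
by move: (Ex Q _) (Ex Q _) => A B; ring.
Qed.

Lemma sum_ad_sq_cvg : \sum_(i < n) Ex Q (fun x => ad Q f i x ^+ 2) @[n --> \oo] -->
  Ex Q (fun x => g x ^+ 2) - Ex Q g ^+ 2.
Proof.
under eq_fun do rewrite sum_ad_sq.
by apply: cvgB; [exact: Ex_g_ma_cvg|exact: cvg_cst].
Qed.

Lemma sum_ad_psi_cvg (phi : nat -> R) (C : R) : (forall k, 0 <= phi k <= C) ->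
  \sum_(i < n) Ex Q (fun x => ad Q f i x * phi (f x)) @[n --> \oo] -->
  Ex Q (fun x => (g x - Ex Q g) * phi (f x)).
Proof.
move=> p01.
have [_ lp] := nn2_psi Q mf p01.
have e n : \sum_(i < n) Ex Q (fun x => ad Q f i x * phi (f x)) =
    Ex Q (fun x => ma Q f n x * phi (f x)) - Ex Q g * Ex Q (fun x => phi (f x)).
  elim: n => [|n IH].
    rewrite big_ord0 (_ : (fun x => ma Q f 0 x * phi (f x)) = fun x => Ex Q g * phi (f x))//.
    by rewrite ExZ ?subrr//; exact: L2_L1.
  rewrite big_ord_recr/= IH (Ex_adM prodQ L2g n lp).
  by move: (Ex Q _) (Ex Q _) (Ex Q _) (Ex Q _) => A B C' D; ring.
under eq_fun do rewrite e.
have -> : Ex Q (fun x => (g x - Ex Q g) * phi (f x)) =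
    Ex Q (fun x => g x * phi (f x)) - Ex Q g * Ex Q (fun x => phi (f x)).
  rewrite -ExZ; last exact: L2_L1.
  rewrite -ExB; [|exact: L2M L2g lp|by apply: L1Z; exact: L2_L1].
  by congr Ex; apply/funext => x; rewrite mulrBl.
by apply: cvgB; [exact: Ex_ma_psi_cvg p01|exact: cvg_cst].
Qed.

End martingale_sums.

(** Integrate 3 u^2 v <= 2 u^3 + v^3, that is (u - v)^2 (2 u + v) >= 0, over two independent
    points. *)
Lemma int_young d (T : measurableType d) (R : realType) (P : probability T R) (u v : T -> R) :
  measurable_fun setT u -> measurable_fun setT v ->
  (forall x, 0 <= u x) -> (forall x, 0 <= v x) ->
  ((\int[P]_x (u x ^+ 2)%:E) * (\int[P]_x (v x)%:E) <=
   (2 / 3)%:E * (\int[P]_x (u x ^+ 3)%:E) + (1 / 3)%:E * (\int[P]_x (v x ^+ 3)%:E))%E.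
Proof.
move=> mu mv u0 v0.
have mX (w : T -> R) n : measurable_fun setT w -> measurable_fun setT (fun x : T => (w x ^+ n)%:E).
  by move=> mw; apply/measurable_EFinP; exact: measurable_funX.
have young x y : u x ^+ 2 * v y <= 2 / 3 * u x ^+ 3 + 1 / 3 * v y ^+ 3.
  suff : 0 <= (u x - v y) ^+ 2 * (2 * u x + v y) by lra.
  by rewrite mulr_ge0 ?sqr_ge0// addr_ge0// mulr_ge0.
have p3 (w : T -> R) x : 0 <= w x -> (0 <= (w x ^+ 3)%:E)%E by move=> ?; rewrite lee_fin exprn_ge0.
set B := (\int[P]_x (v x ^+ 3)%:E)%E.
have B0 : (0 <= B)%E by apply: integral_ge0 => x _; rewrite lee_fin exprn_ge0.
have I0 : (0 <= \int[P]_x (v x)%:E)%E by apply: integral_ge0 => x _; rewrite lee_fin.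
rewrite -ge0_integralZr//; [|exact: mX|by move=> x _; rewrite lee_fin sqr_ge0].
apply: (@le_trans _ _ (\int[P]_x ((2 / 3)%:E * (u x ^+ 3)%:E + (1 / 3)%:E * B))%E).
  apply: ge0_le_integral => //.
  - by move=> x _; rewrite mule_ge0// lee_fin sqr_ge0.
  - by apply: emeasurable_funM => //; exact: mX.
  - apply: emeasurable_funD => //.
    by apply: emeasurable_funM => //; exact: mX.
  move=> x _; rewrite -ge0_integralZl//; last 3 first.
  - exact/measurable_EFinP.
  - by move=> y _; rewrite lee_fin.
  - by rewrite lee_fin sqr_ge0.
  apply: (@le_trans _ _ (\int[P]_y ((2 / 3)%:E * (u x ^+ 3)%:E + (1 / 3)%:E * (v y ^+ 3)%:E))%E).
    apply: ge0_le_integral => //.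
    - by move=> y _; rewrite -EFinM lee_fin mulr_ge0// sqr_ge0.
    - by apply: emeasurable_funM => //; exact/measurable_EFinP.
    - by apply: emeasurable_funD => //; apply: emeasurable_funM => //; exact: mX.
    - by move=> y _; rewrite -!EFinM -EFinD lee_fin.
  rewrite ge0_integralD//; last 3 first.
  - by move=> y _; rewrite mule_ge0 ?p3// lee_fin divr_ge0.
  - by move=> y _; rewrite mule_ge0 ?p3// lee_fin divr_ge0.
  - by apply: emeasurable_funM => //; exact: mX.
  rewrite integral_cst//= [X in (_ * X + _)%E]probability_setT mule1.
  by rewrite ge0_integralZl// ?lee_fin ?divr_ge0//; [exact: mX|move=> y _; exact: p3].
rewrite ge0_integralD//; last 3 first.
- by move=> y _; rewrite mule_ge0 ?p3// lee_fin divr_ge0.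
- by apply: emeasurable_funM => //; exact: mX.
- by move=> y _; rewrite mule_ge0// lee_fin divr_ge0.
rewrite integral_cst//= [X in (_ + _ * X)%E]probability_setT mule1.
by rewrite ge0_integralZl// ?lee_fin ?divr_ge0//; [exact: mX|move=> y _; exact: p3].
Qed.

Lemma natr_dist_le_sqr (R : realType) (m n : nat) :
  `|m%:R - n%:R| <= (m%:R - n%:R) ^+ 2 :> R.
Proof.
wlog mn : m n / (n <= m)%N.
  move=> H; have [/H//|/ltnW/H] := leqP n m.
  by rewrite distrC -[X in _ <= X]sqrrN opprB.
by rewrite -natrB// ger0_norm// -natrX ler_nat; case: (m - n)%N => // k; rewrite leq_pmull.
Qed.

(** * Comparison of D_i F and d_i F *)

Section pointwise.
Context d' (S : measurableType d') (R : realType).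
Local Notation E := (seq_space S).
Variable Q : probability E R.
Hypothesis prodQ : forall B N, (forall j, measurable (B j)) ->
  Q (rect B N) = (\prod_(j < N) Q ((fun x : E => x j) @^-1` B j))%E.
Variable f : E -> nat.
Hypothesis mf : measurable_fun setT f.
Local Notation g := (fun x => (f x)%:R : R).
Hypothesis L2g : L2 Q g.
Implicit Types (I J : pred nat) (x y : E) (u v : E -> R).

Let nn2g : nn2 Q g. Proof. by split=> // x; rewrite ler0n. Qed.

(** Averages preserve integrals, so the average of the indicator of a null set vanishes almost
    everywhere. *)
Lemma ae_rep I (A : E -> Prop) : {ae Q, forall x, A x} ->
  {ae Q, forall x, {ae Q, forall y, A (rep I x y)}}.
Proof.
move=> [N [mN N0 sN]].
have n1 : nnegm (EFin \o (\1_N : E -> R)).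
  by apply: nnegm_EFin => [|x]; [exact: measurable_indic|rewrite indicE].
have [m1 p1] := nnegm_EI Q I n1.
have : (\int[Q]_x EI Q I (EFin \o (\1_N : E -> R)) x = 0)%E.
  by rewrite int_EI// integral_indic// setIT.
have mR x : measurable_fun setT (rep I x) by exact: measurable_repx.
move=> i0; have : ae_eq Q setT (EI Q I (EFin \o (\1_N : E -> R))) (cst 0%E).
  apply/ae_eq_integral_abs => //.
  by under eq_integral do rewrite gee0_abs//.
apply: filterS => x /= /(_ Logic.I) h.
exists (rep I x @^-1` N); split.
- by rewrite -[X in measurable X]setTI; exact: mR.
- have : (\int[Q]_y (\1_(rep I x @^-1` N) y : R)%:E = 0)%E by [].
  rewrite integral_indic// ?setIT//.
  by rewrite -[X in measurable X]setTI; exact: mR.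
- by move=> y /= nA; apply: sN.
Qed.

(* 2 (d_i F)^2 *)
Definition vv i x : R := Ex Q (fun y => (g x - g (rep (single i) x y)) ^+ 2).

Lemma vv_ge0 i x : 0 <= vv i x.
Proof. by apply: Ex_ge0 => y; exact: sqr_ge0. Qed.

Lemma measurable_vv i : measurable_fun setT (vv i).
Proof.
apply: measurableT_comp => //.
apply: (@measurable_fun_fubini_tonelli_F _ _ E E R Q
  (fun w => ((g w.1 - g (rep (single i) w.1 w.2)) ^+ 2)%:E)).
  have [mg _] := L2g.
  apply/measurable_EFinP; apply: measurable_funX; apply: measurable_funB.
    by apply: (@measurableT_comp _ _ _ _ _ _ (fun x : E => (f x)%:R : R)).
  apply: (@measurableT_comp _ _ _ _ _ _ (fun x : E => (f x)%:R : R)) => //.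
  exact: measurable_rep2.
by move=> w; rewrite lee_fin sqr_ge0.
Qed.

(** Integrals over resampled coordinates are split only where the section is integrable; the null
    set left out here is why the following identities hold almost everywhere. *)
Lemma ae_L2_rep I : {ae Q, forall x, L2 Q (fun y => g (rep I x y))}.
Proof.
have [mg sg] := L2g.
have := EI_ce prodQ I (fun x => sqr_ge0 (g x)) sg.
apply: filterS => x h.
have mgx : measurable_fun setT (fun y => g (rep I x y)).
  apply: (@measurableT_comp _ _ _ _ _ _ (fun x : E => (f x)%:R : R)) => //.
  exact: measurable_repx.
split=> //; apply: L1_lty; [exact: measurable_funX|by move=> y; exact: sqr_ge0|].
by move: h; rewrite /EI/= => ->; rewrite ltry.
Qed.

Let ei_rep i x y : ei Q f i (rep (single i) x y) = ei Q f i x.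
Proof. by rewrite /ei ce_rep. Qed.

Lemma ae_dg_vv i : {ae Q, forall x, vv i x + dg Q f i x =
  Ex Q (fun y => (g x - g (rep (single i) x y)) ^+ 2 + (g x - g (rep (single i) x y)))}.
Proof.
apply: filterS (ae_L2_rep (single i)) => x l2.
have lB : L2 Q (fun y => g x - g (rep (single i) x y)).
  by apply: L2B => //; apply: (@L2_bdd _ _ _ Q _ (g x)) => // y; rewrite ger0_norm.
have [_ sB] := lB.
rewrite [RHS]ExD//; last exact: L2_L1.
rewrite [X in _ = _ + X]ExB ?Ex_cst//; [exact: L1_cst|exact: L2_L1].
Qed.

(** Average |m - n| <= (m - n)^2, valid for integers, over the resampled coordinate. This makes the
    correction terms nonnegative almost everywhere. *)
Lemma ae_abs_dg_le i : {ae Q, forall x, `|dg Q f i x| <= vv i x}.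
Proof.
apply: filterS (ae_L2_rep (single i)) => x l2.
have lB : L2 Q (fun y => g x - g (rep (single i) x y)).
  by apply: L2B => //; apply: (@L2_bdd _ _ _ Q _ (g x)) => // y; rewrite ger0_norm.
have [_ sB] := lB; have l1 := L2_L1 lB.
have -> : dg Q f i x = Ex Q (fun y => g x - g (rep (single i) x y)).
  by rewrite ExB ?Ex_cst//; [exact: L1_cst|exact: L2_L1].
apply: (le_trans (Ex_abs l1)).
apply: Ex_le => //; first exact: L1_abs.
by move=> y; exact: natr_dist_le_sqr.
Qed.

End pointwise.

(** * The averaged Taylor expansion and third moments *)

Section taylor_expansion.
Context d' (S : measurableType d') (R : realType).
Local Notation E := (seq_space S).
Variable Q : probability E R.
Hypothesis prodQ : forall B N, (forall j, measurable (B j)) ->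
  Q (rect B N) = (\prod_(j < N) Q ((fun x : E => x j) @^-1` B j))%E.
Variable f : E -> nat.
Hypothesis mf : measurable_fun setT f.
Local Notation g := (fun x => (f x)%:R : R).
Hypothesis L2g : L2 Q g.
Implicit Types (I J : pred nat) (x y : E) (u v : E -> R).

Let nn2g : nn2 Q g. Proof. by split=> // x; rewrite ler0n. Qed.

Lemma ae_taylor (phi : nat -> R) (c C : R) i : 0 <= c ->
  (forall k, 0 <= phi k <= C) -> (forall k, `|phi k.+1 - phi k| <= c) ->
  {ae Q, forall x,
   `|phi (f x) - ce Q (fun x => phi (f x)) (single i) x -
     (phi (f x).+1 - phi (f x)) * dg Q f i x| <= c * (vv Q f i x + dg Q f i x)}.
Proof.
move=> c0 p01 dphi.
apply: filterS2 (ae_L2_rep prodQ L2g (single i)) (ae_dg_vv prodQ L2g i) => x l2 ->.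
set D := phi (f x).+1 - phi (f x).
pose gy y : R := (f (rep (single i) x y))%:R.
pose py y := phi (f (rep (single i) x y)).
have lB : L2 Q (fun y => g x - gy y).
  by apply: L2B => //; apply: (@L2_bdd _ _ _ Q _ (g x)) => // y; rewrite ger0_norm.
have [_ sB] := lB; have l1 := L2_L1 lB.
have lp : L1 Q py.
  apply: (L1_dom _ (L1_cst Q C)).
    apply: (@measurableT_comp _ _ _ _ _ _ phi) => //.
    by apply: (measurableT_comp mf); exact: measurable_repx.
  by move=> y; have /andP[h1 h2] := p01 (f (rep (single i) x y)); rewrite ger0_norm.
have lpB : L1 Q (fun y => phi (f x) - py y) by apply: L1B => //; exact: L1_cst.
have -> : phi (f x) - ce Q (fun x => phi (f x)) (single i) x - D * dg Q f i x =
    Ex Q (fun y => phi (f x) - py y - D * (g x - gy y)).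
  rewrite ExB//; last exact: L1Z.
  rewrite ExZ// ExB//; last exact: L1_cst.
  rewrite Ex_cst; congr (_ - _ * _).
  by rewrite ExB ?Ex_cst//; [exact: L1_cst|exact: L2_L1].
have lD : L1 Q (fun y => phi (f x) - py y - D * (g x - gy y)) by apply: L1B => //; exact: L1Z.
apply: (le_trans (Ex_abs lD)).
rewrite -ExZ; last exact: L1D.
apply: Ex_le; [exact: L1_abs|by apply: L1Z; exact: L1D|move=> y].
exact: nat_taylor.
Qed.

Let L2d i : L2 Q (dg Q f i). Proof. exact: L2_dg. Qed.

Lemma ei_rep i x y : ei Q f i (rep (single i) x y) = ei Q f i x.
Proof. by rewrite /ei ce_rep. Qed.

(** F - T_i F is D_i F minus its resampled copy, which has mean zero over coordinate i, so the cross
    term vanishes. *)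
Lemma ae_vvE i : {ae Q, forall x,
  vv Q f i x = dg Q f i x ^+ 2 + Ex Q (fun y => dg Q f i (rep (single i) x y) ^+ 2)}.
Proof.
apply: filterS (ae_L2_rep prodQ L2g (single i)) => x l2.
pose gy y : R := (f (rep (single i) x y))%:R.
pose dy y := gy y - ei Q f i x.
have ld : L2 Q dy.
  by apply: L2B => //; apply: (@L2_bdd _ _ _ Q _ `|ei Q f i x|).
have [_ sd] := ld.
have -> : (fun y => dg Q f i (rep (single i) x y) ^+ 2) = fun y => dy y ^+ 2.
  by apply/funext => y; rewrite /dg ei_rep.
have d0 : Ex Q dy = 0.
  by rewrite ExB ?Ex_cst; [rewrite /ei ceE subrr|exact: L2_L1|exact: L1_cst].
rewrite /vv.
have -> : (fun y => (g x - g (rep (single i) x y)) ^+ 2) =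
    fun y => dg Q f i x ^+ 2 - 2 * dg Q f i x * dy y + dy y ^+ 2.
  by apply/funext => y; rewrite /dg /dy /gy; ring.
have lZ : L1 Q (fun y => 2 * dg Q f i x * dy y) by apply: L1Z; exact: L2_L1.
rewrite ExD//; last by apply: L1B => //; exact: L1_cst.
rewrite ExB//; last exact: L1_cst.
by rewrite Ex_cst ExZ ?d0 ?mulr0 ?subr0//; exact: L2_L1.
Qed.

(** The triangle inequality for integrals: [ad i] is the average of D_i F over the tail from i +
    1. *)
Lemma ae_ad_le i : {ae Q, forall x, `|ad Q f i x| <= ce Q (fun x => `|dg Q f i x|) (tail i.+1) x}.
Proof.
have nabs : nn2 Q (fun x => `|dg Q f i x|) by split=> [x|]; [exact: normr_ge0|exact: L2_abs].
have [e0 le] := nn2_ce prodQ (single i) nn2g; have [me _] := le.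
have [a0 la] := nabs; have [mabs _] := la.
(* [EI_EI] relates extended averages; this lets the inner one be read as the real number [ei i] at
   almost every resampled point. *)
have aeE := ae_rep prodQ (tail i.+1) (EI_ce prodQ (single i) (fun x => ler0n R (f x)) (L2_L1 L2g)).
have aei := EI_ce prodQ (tail i.+1) e0 (L2_L1 le).
have aea := EI_ce prodQ (tail i.+1) a0 (L2_L1 la).
have aeg := EI_ce prodQ (tail i.+1) (fun x => ler0n R (f x)) (L2_L1 L2g).
apply: filterS2 (filterI aeE aei) (filterI aea aeg) => x [h1 h2] [h3 h4].
pose r y := rep (tail i.+1) x y.
have mr u : measurable_fun setT u -> measurable_fun setT (fun y => u (r y)).
  by move=> mu; apply: measurableT_comp => //; exact: measurable_repx.
have fin u v : (forall x, 0 <= u x) -> measurable_fun setT u ->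
    EI Q (tail i.+1) (EFin \o u) x = (v x)%:E -> L1 Q (fun y => u (r y)).
  move=> u0 mu h; apply: L1_lty => //; first exact: mr.
  by move: h; rewrite /EI/= -/r => ->; rewrite ltry.
have l1 : L1 Q (fun y => ei Q f i (r y)) by apply: fin h2 => //.
have l2 : L1 Q (fun y => `|dg Q f i (r y)|) by apply: (fin _ _ _ _ h3) => //.
have [mg _] := L2g.
have l3 : L1 Q (fun y => g (r y)) by apply: (fin _ _ _ _ h4) => //.
have -> : ad Q f i x = Ex Q (fun y => dg Q f i (r y)).
  rewrite ExB//; congr (_ - _).
  have [mE E0] := nnegm_EI Q (single i) (nn2_nnegm nn2g).
  rewrite /ma /ce; have <- : EI Q (fun j => tail i.+1 j || single i j) (EFin \o g) =
      EI Q (tail i) (EFin \o g) by apply: eq_EI => j; rewrite tail_single.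
  rewrite -(EI_EI prodQ (tail i.+1) (single i) x (nn2_nnegm nn2g)).
  rewrite /Ex /Rintegral; congr fine; apply: ae_eq_integral => //.
  - by apply: measurableT_comp => //; exact: measurable_repx.
  - by apply/measurable_EFinP; exact: mr.
  - by apply: filterS h1 => y /= -> _.
apply: (le_trans (Ex_abs _)) => //.
by apply: L1B.
Qed.

(** With u = |D_i F|, 2 (d_i F)^2 = u^2 + E_i u^2 and |a_i| <= E[u | F_i]. The product splits into
    terms E_J[u^2] E[u | F_i] with J empty or {i}, E_J being the average over J. By [int_young] each
    is at most 2/3 E_J[u^3] + 1/3 E[u^3 | F_i], whose integral is E u^3. *)
Lemma int_vv_ad_le i :
  (\int[Q]_x (vv Q f i x * `|ad Q f i x|)%:E <= 2%:E * \int[Q]_x (`|dg Q f i x| ^+ 3)%:E)%E.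
Proof.
pose u x : R := `|dg Q f i x|.
have [md _] := L2d i.
have mu : measurable_fun setT u by exact: measurableT_comp.
have u0 x : 0 <= u x by exact: normr_ge0.
have lu : L1 Q u by exact: L1_abs (L2_L1 (L2d i)).
have lu2 : L1 Q (fun x => u x ^+ 2) by have [] := L2_abs (L2d i).
have nu n : nnegm (EFin \o (fun x => u x ^+ n)).
  by apply: nnegm_EFin => [|x]; [exact: measurable_funX|exact: exprn_ge0].
have nu1 : nnegm (EFin \o u) by exact: nnegm_EFin.
have young I x : (EI Q I (EFin \o (fun x => u x ^+ 2)%R) x * EI Q (tail i.+1) (EFin \o u) x <=
   (2 / 3)%:E * EI Q I (EFin \o (fun x => u x ^+ 3)%R) x +
   (1 / 3)%:E * EI Q (tail i.+1) (EFin \o (fun x => u x ^+ 3)%R) x)%E.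
  have mr J : measurable_fun setT (fun y => u (rep J x y)).
    by apply: measurableT_comp => //; exact: measurable_repx.
  exact: (int_young Q (mr I) (mr (tail i.+1)) (fun y => u0 _) (fun y => u0 _)).
pose A n J := EI Q J (EFin \o (fun x => u x ^+ n)).
have {}young J x : (EI Q J (EFin \o (fun x => u x ^+ 2)%R) x * EI Q (tail i.+1) (EFin \o u) x <=
   (2 / 3)%:E * A 3%N J x + (1 / 3)%:E * A 3%N (tail i.+1) x)%E by exact: young.
have nA n J : nnegm (A n J) by exact: nnegm_EI.
have iA n J : (\int[Q]_x A n J x = \int[Q]_x (u x ^+ n)%:E)%E by exact: int_EI.
set T3 := (\int[Q]_x (u x ^+ 3)%:E)%E in iA *.
clearbody A.
pose B J x := ((2 / 3)%:E * A 3%N J x + (1 / 3)%:E * A 3%N (tail i.+1) x)%E.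
have mB J : measurable_fun setT (B J).
  have [m1 _] := nA 3%N J; have [m2 _] := nA 3%N (tail i.+1).
  by apply: emeasurable_funD; [exact: (measurable_funeM _ m1)|exact: (measurable_funeM _ m2)].
have B0 J x : (0 <= B J x)%E.
  have [_ h1] := nA 3%N J; have [_ h2] := nA 3%N (tail i.+1).
  by rewrite adde_ge0// mule_ge0// lee_fin divr_ge0.
have iB J : (\int[Q]_x B J x = T3)%E.
  have [m1 h1] := nA 3%N J; have [m2 h2] := nA 3%N (tail i.+1).
  rewrite ge0_integralD//; last 4 first.
  - by move=> x _; rewrite mule_ge0// lee_fin divr_ge0.
  - exact: (measurable_funeM _ m1).
  - by move=> x _; rewrite mule_ge0// lee_fin divr_ge0.
  - exact: (measurable_funeM _ m2).
  rewrite !ge0_integralZl// ?lee_fin ?divr_ge0// !iA -ge0_muleDl ?lee_fin ?divr_ge0//.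
  by rewrite -EFinD (_ : 2 / 3 + 1 / 3 = 1 :> R) ?mul1e//; field.
rewrite -[X in (_ <= X)%E]/(2%:E * T3)%E.
have {}young J x : (EI Q J (EFin \o (fun x => u x ^+ 2)%R) x * EI Q (tail i.+1) (EFin \o u) x <=
   B J x)%E by exact: young.
clearbody B T3.
apply: (@le_trans _ _ (\int[Q]_x (B (fun=> false) x + B (single i) x))%E); last first.
  rewrite ge0_integralD// !iB.
  by rewrite -[X in (X + X <= _)%E]mul1e -ge0_muleDl// -EFinD.
apply: ae_ge0_le_integral => //.
- by move=> x _; rewrite lee_fin mulr_ge0// vv_ge0.
- apply/measurable_EFinP; apply: measurable_funM; first exact: measurable_vv.
  by apply: measurableT_comp => //; have [] := L2_ad prodQ L2g i.
- by move=> x _; exact: adde_ge0.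
- exact: emeasurable_funD.
apply: filterS2 (filterI (ae_vvE i) (ae_ad_le i))
  (filterI (EI_ce prodQ (tail i.+1) u0 lu) (EI_ce prodQ (single i) (fun x => sqr_ge0 (u x)) lu2)).
move=> x [hv ha] [h1 h2] _.
have e2 : vv Q f i x = u x ^+ 2 + ce Q (fun x => u x ^+ 2) (single i) x.
  rewrite hv /u real_normK ?num_real//; congr (_ + _); rewrite ceE; congr Ex.
  by apply/funext => y; rewrite real_normK ?num_real.
apply: (@le_trans _ _ ((u x ^+ 2 + ce Q (fun x => u x ^+ 2) (single i) x) *
    ce Q u (tail i.+1) x)%:E).
  by rewrite lee_fin e2 ler_wpM2l// -e2 vv_ge0.
rewrite mulrDl EFinD; apply: leeD.
  apply: (le_trans _ (young (fun=> false) x)).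
  by rewrite EI_inv// h1.
apply: (le_trans _ (young (single i) x)).
by rewrite h1 h2.
Qed.

End taylor_expansion.

(** * The approximation bound on the sequence space *)

Section measurable_limits.
Context d (T : measurableType d) (R : realType).
Local Open Scope ereal_scope.

Lemma cvgn_limn_einf_esup (u : (\bar R)^nat) : limn_einf u = limn_esup u ->
  u @ \oo --> limn_esup u.
Proof.
move=> e; apply: (@squeeze_cvge _ _ _ _ (einfs u) u (esups u)).
- apply: nearW => n; apply/andP; split.
    by apply: ereal_inf_lbound; exists n => /=.
  by apply: ereal_sup_ubound; exists n => /=.
- by rewrite -e limn_einf_lim; exact: is_cvg_einfs.
- by rewrite limn_esup_lim; exact: is_cvg_esups.
Qed.

(* Where the sequence diverges, [limn] is the constant [point]. *)
Lemma emeasurable_fun_limn (h : (T -> \bar R)^nat) :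
  (forall n, measurable_fun setT (h n)) ->
  measurable_fun setT (fun x => limn (h ^~ x)).
Proof.
move=> mh.
have ms := measurable_fun_limn_esup mh.
have mi : measurable_fun setT (fun x => limn_einf (h ^~ x)).
  apply: measurableT_comp => //.
  by apply: measurable_fun_limn_esup => n; exact: measurableT_comp.
rewrite (_ : (fun x => _) = fun x =>
    if limn_einf (h ^~ x) == limn_esup (h ^~ x) then limn_esup (h ^~ x) else point).
  by apply: measurable_fun_ifT => //; exact: measurable_fun_eqe.
apply/funext => x; case: eqP => [e|ne]; first by apply/cvg_lim => //; exact: cvgn_limn_einf_esup.
apply: dvgP => cu; apply: ne.
by rewrite (is_cvg_limn_einfE cu) (is_cvg_limn_esupE cu).
Qed.

(** Convergence to a real number means that the lower and upper limits in the extended reals agree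
    and are finite, a measurable condition; elsewhere the limit is a constant default. *)
Lemma measurable_fun_limn (u : (T -> R)^nat) :
  (forall n, measurable_fun setT (u n)) ->
  measurable_fun setT (fun x => limn (u ^~ x)).
Proof.
move=> mu; pose h n x := (u n x)%:E.
have mh n : measurable_fun setT (h n) by exact/measurable_EFinP.
have ms := measurable_fun_limn_esup mh.
have mi : measurable_fun setT (fun x => limn_einf (h ^~ x)).
  apply: measurableT_comp => //.
  by apply: measurable_fun_limn_esup => n; exact: measurableT_comp.
rewrite (_ : (fun x => _) = fun x =>
    if (limn_einf (h ^~ x) == limn_esup (h ^~ x)) && (`|limn_esup (h ^~ x)| < +oo)
    then fine (limn_esup (h ^~ x)) else point).
  apply: measurable_fun_ifT => //; last exact: measurableT_comp.
  apply: measurable_and; first exact: measurable_fun_eqe.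
  by apply: measurable_fun_lte => //; exact: measurableT_comp.
apply/funext => x; case: ifP => [/andP[/eqP e fe]|ne].
  apply/cvg_lim => //; have := cvgn_limn_einf_esup e.
  rewrite -fin_num_abs in fe; rewrite -[in X in X -> _](fineK fe).
  by move/fine_cvgP => [].
apply: dvgP => cu; move/negP : ne; apply.
have ch : h ^~ x @ \oo --> (limn (u ^~ x))%:E.
  by apply/fine_cvgP; split; [exact: nearW|exact: cu].
have [-> ->] := cvg_limn_einf_sup ch.
by rewrite eqxx/= ltry.
Qed.

End measurable_limits.

(** * Series with summable L^1 norms *)

Section l1_series.
Context d (T : measurableType d) (R : realType) (P : probability T R).
Variable u : nat -> T -> R.
Hypothesis L1u : forall i, L1 P (u i).
Hypothesis sum_lty : (\sum_(0 <= i <oo) \int[P]_x (`|u i x|)%:E < +oo)%E.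

Let Zp n x := \sum_(0 <= i < n) u i x.
Let Z x := limn (Zp ^~ x).

Let mu i : measurable_fun setT (u i). Proof. exact: L1_meas. Qed.

Let G x := (\sum_(0 <= i <oo) (`|u i x|)%:E)%E.

Let mG : measurable_fun setT G.
Proof.
apply: ge0_emeasurable_sum => [k x _ _|k _]; first by rewrite lee_fin.
by apply/measurable_EFinP; exact: measurableT_comp.
Qed.

Let G0 x : (0 <= G x)%E.
Proof. by apply: nneseries_ge0 => n _ _; rewrite lee_fin. Qed.

Let iG : P.-integrable setT G.
Proof.
apply/integrableP; split=> //; under eq_integral do rewrite gee0_abs//.
rewrite integral_nneseries// => n.
by apply/measurable_EFinP; exact: measurableT_comp.
Qed.

(** The sum G of the absolute values is integrable. Its almost sure finiteness gives pointwise
    convergence, and it dominates the partial sums. *)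
Lemma series_L1_cvg : [/\ {ae P, forall x, Zp n x @[n --> \oo] --> Z x}, L1 P Z &
  Ex P (fun x => `|Zp n x - Z x|) @[n --> \oo] --> (0 : R)].
Proof.
have mZp n : measurable_fun setT (Zp n) by exact: measurable_sum.
have mZ : measurable_fun setT Z by exact: measurable_fun_limn.
have aefin : {ae P, forall x, G x \is a fin_num}.
  by have := integrable_ae measurableT iG; apply: filterS => x /(_ Logic.I).
have aecvg : {ae P, forall x, Zp n x @[n --> \oo] --> Z x}.
  apply: filterS aefin => x fG.
  suff : cvgn (Zp ^~ x) by [].
  apply: (@normed_cvg _ _ (fun i => u i x)).
  have cG : (\sum_(0 <= i < n) `|u i x|)%:E @[n --> \oo] --> (fine (G x))%:E.
    rewrite (fineK fG); under eq_fun do rewrite -sumEFin.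
    by apply: is_cvg_nneseries => n _ _; rewrite lee_fin.
  move/fine_cvgP : cG => [_ cG].
  by apply/cvg_ex; exists (fine (G x)).
have dom n x : (`|(Zp n x)%:E| <= G x)%E.
  rewrite /= -[leLHS]/((`|Zp n x|)%:E).
  apply: (@le_trans _ _ (\sum_(0 <= i < n) (`|u i x|)%:E)%E).
    by rewrite sumEFin lee_fin; exact: ler_norm_sum.
  by apply: nneseries_lim_ge => k _ _; rewrite lee_fin.
have [||||iZ c0 _] := @dominated_convergence _ T R P setT measurableT
   (fun n x => (Zp n x)%:E) (EFin \o Z) G _ _ _ iG _.
- by move=> n; exact/measurable_EFinP.
- exact/measurable_EFinP.
- apply: filterS aecvg => x h _; apply/fine_cvgP; split=> //; exact: nearW.
- by apply: aeW => x n _; exact: dom.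
split=> //.
have -> : (fun n => Ex P (fun x => `|Zp n x - Z x|)) =
    fine \o (fun n => \int[P]_x `|(Zp n x)%:E - (EFin \o Z) x|)%E.
  by apply/funext => n; rewrite /Ex /Rintegral.
exact: (fine_cvg c0).
Qed.

Lemma Ex_series_cvg : \sum_(i < n) Ex P (u i) @[n --> \oo] --> Ex P Z.
Proof.
have [_ LZ c0] := series_L1_cvg.
apply/cvgrPdist_le => eps e0.
have /cvgrPdist_le/(_ _ e0)[N _ hN] := c0.
exists N => // n Nn; have := hN n Nn; rewrite sub0r normrN /= => h.
have e : \sum_(i < n) Ex P (u i) = Ex P (Zp n).
  by rewrite /Zp Ex_sum// big_mkord.
have LZp : L1 P (Zp n) by exact: L1_sum.
rewrite e -ExB//; apply: (le_trans (Ex_abs (L1B LZ LZp))).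
apply: le_trans h; rewrite ger0_norm; last by apply: Ex_ge0 => x.
apply: Ex_le => [||x]; [exact: L1_abs (L1B LZ LZp)|exact: L1_abs (L1B LZp LZ)|].
by rewrite distrC.
Qed.

End l1_series.

(** * The correction terms of the first bound *)

Section correction_terms.
Context d' (S : measurableType d') (R : realType).
Local Notation E := (seq_space S).
Variable Q : probability E R.
Hypothesis prodQ : forall B N, (forall j, measurable (B j)) ->
  Q (rect B N) = (\prod_(j < N) Q ((fun x : E => x j) @^-1` B j))%E.
Variable f : E -> nat.
Hypothesis mf : measurable_fun setT f.
Local Notation g := (fun x => (f x)%:R : R).
Hypothesis L2g : L2 Q g.
Implicit Types (x y : E) (i n : nat).

Let nn2g : nn2 Q g. Proof. by split=> // x; rewrite ler0n. Qed.
Let L2d i : L2 Q (dg Q f i). Proof. exact: L2_dg. Qed.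
Let L2a i : L2 Q (ad Q f i). Proof. exact: L2_ad. Qed.

Definition hh i x : R := (vv Q f i x + dg Q f i x) * `|ad Q f i x|.
(* The variable Z of the theorem, on the sequence space *)
Definition ZE x : R := limn (fun n => \sum_(0 <= i < n) dg Q f i x * ad Q f i x).

Let L1da i : L1 Q (fun x => dg Q f i x * ad Q f i x). Proof. exact: L2M. Qed.

Lemma measurable_hh i : measurable_fun setT (hh i).
Proof.
have [md _] := L2d i; have [ma' _] := L2a i.
apply: measurable_funM; last exact: measurableT_comp.
by apply: measurable_funD => //; exact: measurable_vv.
Qed.

Lemma measurable_ZE : measurable_fun setT ZE.
Proof.
apply: measurable_fun_limn => n; apply: measurable_sum => i.
by have := L1_meas (L1da i).
Qed.

Lemma ae_hh_ge0 i : {ae Q, forall x, 0 <= hh i x}.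
Proof.
apply: filterS (ae_abs_dg_le prodQ L2g i) => x.
by rewrite ler_norml => /andP[h _]; rewrite mulr_ge0//; lra.
Qed.

(** The terms are nonnegative only almost everywhere, so the series and the integral are exchanged
    through absolute values. *)
Lemma int_sum_hh : (\int[Q]_x \sum_(0 <= i <oo) (hh i x)%:E =
  \sum_(0 <= i <oo) \int[Q]_x (`|hh i x|)%:E)%E.
Proof.
have mE i : measurable_fun setT (EFin \o hh i).
  by apply/measurable_EFinP; exact: measurable_hh.
rewrite -integral_nneseries//; last first.
  by move=> i; apply/measurable_EFinP; apply: measurableT_comp => //; exact: measurable_hh.
apply: ae_eq_integral => //.
- apply: emeasurable_fun_limn => n; exact: emeasurable_sum.
- apply: ge0_emeasurable_sum => [k x _ _|k _]; first by rewrite lee_fin.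
  by apply/measurable_EFinP; apply: measurableT_comp => //; exact: measurable_hh.
have /ae_foralln : forall i, {ae Q, forall x, 0 <= hh i x} by exact: ae_hh_ge0.
apply: filterS => x h _; apply: eq_eseriesr => i _.
by rewrite ger0_norm.
Qed.

(** Subtracting E a_i E_i phi(F) = 0 leaves a_i times the Taylor remainder of [ae_taylor]. *)
Lemma Ex_ad_phi (phi : nat -> R) (c C : R) i : 0 <= c ->
  (forall k, 0 <= phi k <= C) -> (forall k, `|phi k.+1 - phi k| <= c) ->
  L1 Q (hh i) ->
  `|Ex Q (fun x => ad Q f i x * phi (f x)) -
    Ex Q (fun x => (phi (f x).+1 - phi (f x)) * (dg Q f i x * ad Q f i x))| <=
  c * Ex Q (fun x => `|hh i x|).
Proof.
move=> c0 p01 dphi Lh.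
have np := nn2_psi Q mf p01; have [_ lp] := np.
have lc := L2_ce prodQ (single i) np.
pose D x := phi (f x).+1 - phi (f x).
have mD : measurable_fun setT D.
  by apply: (@measurableT_comp _ _ _ _ _ _ (fun k => phi k.+1 - phi k) _ f).
have lD : L1 Q (fun x => D x * (dg Q f i x * ad Q f i x)).
  by apply: (L1_bddM mD _ (L1da i)) => x; exact: dphi.
have l1 : L1 Q (fun x => ad Q f i x * phi (f x)) by exact: L2M.
have l2 : L1 Q (fun x => ad Q f i x * ce Q (fun x => phi (f x)) (single i) x).
  exact: L2M.
rewrite -[X in `|X - _|]subr0 -(Ex_ad_ce prodQ L2g i np).
rewrite -ExB// -ExB//; last exact: L1B.
apply: (le_trans (Ex_abs _)); first by apply: L1B => //; exact: L1B.
rewrite -ExZ; last exact: L1_abs.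
apply: Ex_le_ae.
- by apply: L1_abs; apply: L1B => //; exact: L1B.
- by apply: L1Z; exact: L1_abs.
apply: filterS2 (ae_taylor prodQ mf L2g i c0 p01 dphi) (ae_hh_ge0 i) => x ht h0.
rewrite (ger0_norm h0) /hh [leRHS]mulrA.
rewrite (_ : _ - _ - _ = (phi (f x) - ce Q (fun x => phi (f x)) (single i) x -
     (phi (f x).+1 - phi (f x)) * dg Q f i x) * ad Q f i x); last by rewrite /D; ring.
by rewrite normrM ler_wpM2r.
Qed.

(** Since |D_i F| <= 2 (d_i F)^2, |D_i F a_i| <= [hh i] - |a_i| D_i F almost everywhere, and E |a_i|
    D_i F = E |a_i| a_i >= - E a_i^2. *)
Lemma Ex_abs_da i : L1 Q (hh i) ->
  Ex Q (fun x => `|dg Q f i x * ad Q f i x|) <=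
  Ex Q (fun x => `|hh i x|) + Ex Q (fun x => ad Q f i x ^+ 2).
Proof.
move=> Lh; have [_ sa] := L2a i.
have laa : L1 Q (fun x => `|ad Q f i x| * ad Q f i x) by exact: L2M (L2_abs (L2a i)) (L2a i).
have lad : L1 Q (fun x => `|ad Q f i x| * dg Q f i x) by exact: L2M (L2_abs (L2a i)) (L2d i).
have h1 : - Ex Q (fun x => `|ad Q f i x| * dg Q f i x) <= Ex Q (fun x => ad Q f i x ^+ 2).
  rewrite (Ex_abs_ad_dg prodQ L2g).
  apply: (@le_trans _ _ `|Ex Q (fun x => `|ad Q f i x| * ad Q f i x)|).
    by rewrite -normrN ler_norm.
  apply: (le_trans (Ex_abs laa)); apply: Ex_le => //; first exact: L1_abs.
  by move=> x; rewrite normrM normr_id -expr2 real_normK ?num_real.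
apply: (@le_trans _ _ (Ex Q (fun x => `|hh i x|) - Ex Q (fun x => `|ad Q f i x| * dg Q f i x))).
  rewrite -ExB//; last exact: L1_abs.
  apply: Ex_le_ae; [exact: L1_abs|by apply: L1B => //; exact: L1_abs|].
  apply: filterS2 (ae_abs_dg_le prodQ L2g i) (ae_hh_ge0 i) => x h h0.
  rewrite (ger0_norm h0) /hh normrM mulrDl [X in _ + X - _]mulrC addrK.
  by rewrite ler_wpM2r.
by rewrite lerD2l.
Qed.

End correction_terms.

(** * The Stein discrepancy of F *)

Section stein_bound.
Context d' (S : measurableType d') (R : realType).
Local Notation E := (seq_space S).
Variable Q : probability E R.
Hypothesis prodQ : forall B N, (forall j, measurable (B j)) ->
  Q (rect B N) = (\prod_(j < N) Q ((fun x : E => x j) @^-1` B j))%E.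
Variable f : E -> nat.
Hypothesis mf : measurable_fun setT f.
Local Notation g := (fun x => (f x)%:R : R).
Hypothesis L2g : L2 Q g.
Implicit Types (x y : E) (i n : nat).

Let nn2g : nn2 Q g. Proof. by split=> // x; rewrite ler0n. Qed.
Let L2d i : L2 Q (dg Q f i). Proof. exact: L2_dg. Qed.
Let L2a i : L2 Q (ad Q f i). Proof. exact: L2_ad. Qed.
Let L1da i : L1 Q (fun x => dg Q f i x * ad Q f i x). Proof. exact: L2M. Qed.
Let mh i : measurable_fun setT (hh Q f i). Proof. exact: measurable_hh. Qed.
Let Bh := (\sum_(0 <= i <oo) \int[Q]_x (`|hh Q f i x|)%:E)%E.
Let mu := Ex Q g.
Let sg2 := Ex Q (fun x => g x ^+ 2) - mu ^+ 2.

Lemma sum_ad_sq_E : (\sum_(0 <= i <oo) (Ex Q (fun x => ad Q f i x ^+ 2))%:E = sg2%:E)%E.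
Proof.
apply/cvg_lim => //; under eq_fun do rewrite sumEFin big_mkord.
by apply/fine_cvgP; split; [exact: nearW|exact: (sum_ad_sq_cvg prodQ mf L2g)].
Qed.

Let ihh_ge0 i : (0 <= \int[Q]_x (`|hh Q f i x|)%:E)%E.
Proof. by apply: integral_ge0 => x _; rewrite lee_fin. Qed.

Lemma L1_hh i : (Bh < +oo)%E -> L1 Q (hh Q f i).
Proof.
move=> By; apply/integrableP; split; first exact/measurable_EFinP.
apply: le_lt_trans By.
apply: le_trans (nneseries_lim_ge i.+1 (fun k _ _ => ihh_ge0 k)).
by rewrite big_nat_recr//= leeDr// sume_ge0.
Qed.

Lemma summable_da : (Bh < +oo)%E ->
  (\sum_(0 <= i <oo) \int[Q]_x (`|dg Q f i x * ad Q f i x|)%:E < +oo)%E.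
Proof.
move=> By; apply: (@le_lt_trans _ _ (Bh + sg2%:E)%E); last by rewrite lte_add_pinfty// ltry.
rewrite -sum_ad_sq_E -nneseriesD//; last first.
  by move=> i _ _; rewrite lee_fin; apply: Ex_ge0 => x; exact: sqr_ge0.
apply: lee_nneseries => i _; first by move=> _; apply: integral_ge0 => x _; rewrite lee_fin.
have Lh := L1_hh i By.
rewrite !ExE; [|exact: L1_abs|exact: L1_abs].
by rewrite -EFinD lee_fin; exact: Ex_abs_da.
Qed.

(** E (F - mu) phi(F) is the limit of the partial sums of E a_i phi(F). These stay within c times
    the correction sum of E Delta phi(F) Z_n, and the partial sums Z_n tend to Z in L^1. *)
Lemma stein_discrepancy (phi : nat -> R) (c C t : R) : (Bh < +oo)%E -> 0 <= c ->
  (forall k, 0 <= phi k <= C) -> (forall k, `|phi k.+1 - phi k| <= c) ->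
  `|t * Ex Q (fun x => phi (f x).+1 - phi (f x)) - Ex Q (fun x => (g x - mu) * phi (f x))| <=
  c * (Ex Q (fun x => `|t - ZE Q f x|) + fine Bh).
Proof.
move=> By c0 p01 dphi.
have [_ LZ cZ] := series_L1_cvg L1da (summable_da By).
rewrite -/(ZE Q f) in LZ cZ.
have B0 : (0 <= Bh)%E by exact: nneseries_ge0.
pose D x := phi (f x).+1 - phi (f x).
have mD : measurable_fun setT D.
  by apply: (@measurableT_comp _ _ _ _ _ _ (fun k => phi k.+1 - phi k) _ f).
have Db x : `|D x| <= c by exact: dphi.
pose Zp n x := \sum_(0 <= i < n) dg Q f i x * ad Q f i x.
have LZp n : L1 Q (Zp n) by exact: L1_sum.
have LDp n : L1 Q (fun x => D x * Zp n x) by exact: L1_bddM Db (LZp n).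
have LD : L1 Q D by apply: (L1_dom mD (L1_cst Q c)).
pose s n := \sum_(i < n) Ex Q (fun x => ad Q f i x * phi (f x)).
have cs := sum_ad_psi_cvg prodQ mf L2g p01; rewrite -/s -/mu in cs.
have step1 n : `|s n - Ex Q (fun x => D x * Zp n x)| <= c * fine Bh.
  have -> : Ex Q (fun x => D x * Zp n x) =
      \sum_(i < n) Ex Q (fun x => D x * (dg Q f i x * ad Q f i x)).
    rewrite -(big_mkord xpredT (fun i => Ex Q (fun x => D x * (dg Q f i x * ad Q f i x)))).
    rewrite -Ex_sum => [|i]; last exact: L1_bddM Db (L1da i).
    by congr Ex; apply/funext => x; rewrite /Zp mulr_sumr.
  rewrite /s -sumrB; apply: (le_trans (ler_norm_sum _ _ _)).
  apply: (@le_trans _ _ (\sum_(i < n) c * Ex Q (fun x => `|hh Q f i x|))).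
    apply: ler_sum => i _; apply: (Ex_ad_phi prodQ mf L2g c0 p01 dphi).
    exact: L1_hh.
  rewrite -mulr_sumr ler_wpM2l// -lee_fin fineK; last by rewrite ge0_fin_numE.
  rewrite -sumEFin -(big_mkord xpredT (fun i => (Ex Q (fun x => `|hh Q f i x|))%:E)).
  under eq_bigr => i _ do rewrite -(ExE (L1_abs (L1_hh i By))).
  by apply: nneseries_lim_ge => k _ _; exact: ihh_ge0.
have Lt : L1 Q (fun x => t - ZE Q f x) by apply: L1B => //; exact: L1_cst.
have step2 n : `|t * Ex Q D - Ex Q (fun x => D x * Zp n x)| <=
    c * (Ex Q (fun x => `|t - ZE Q f x|) + Ex Q (fun x => `|Zp n x - ZE Q f x|)).
  have LtD : L1 Q (fun x => t * D x) by exact: L1Z.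
  have LB := L1B LtD (LDp n).
  rewrite -ExZ// -ExB//; apply: (le_trans (Ex_abs LB)).
  have LB2 : L1 Q (fun x => Zp n x - ZE Q f x) by exact: L1B.
  have LS : L1 Q (fun x => `|t - ZE Q f x| + `|Zp n x - ZE Q f x|).
    by apply: L1D; exact: L1_abs.
  rewrite -ExD; [|exact: L1_abs|exact: L1_abs].
  rewrite -ExZ//; apply: Ex_le; [exact: L1_abs|exact: L1Z|move=> x].
  rewrite (_ : t * D x - D x * Zp n x = D x * ((t - ZE Q f x) - (Zp n x - ZE Q f x))); last by ring.
  by rewrite normrM ler_pM// ler_normB.
apply: (@ler_cvg_to nat \oo _ R
   (fun n => `|t * Ex Q D - s n|)
   (fun n => c * (Ex Q (fun x => `|t - ZE Q f x|) + Ex Q (fun x => `|Zp n x - ZE Q f x|) + fine Bh))).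
- by apply: cvg_norm; apply: cvgB; [exact: cvg_cst|exact: cs].
- rewrite -[X in _ --> c * (X + _)]addr0.
  apply: cvgM; first exact: cvg_cst.
  apply: cvgD; last exact: cvg_cst.
  by apply: cvgD; [exact: cvg_cst|exact: cZ].
- apply: nearW => n; have := step1 n; have := step2 n.
  move: (t * Ex Q D) (s n) (Ex Q (fun x => D x * Zp n x)) (Ex Q (fun x => `|t - ZE Q f x|)) (Ex Q (fun x => `|Zp n x - ZE Q f x|)) (fine Bh) => a1 a2 a3 a4 a5 a6.
  move=> h1 h2; rewrite (_ : a1 - a2 = (a1 - a3) - (a2 - a3)); last by ring.
  by apply: (le_trans (ler_normB _ _)); lra.
Qed.

Lemma L1_bdd_nat (phi : nat -> R) (C : R) : (forall k, `|phi k| <= C) ->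
  L1 Q (fun x => phi (f x)).
Proof.
move=> pC; apply: (L1_dom _ (L1_cst Q C)) => //.
exact: (@measurableT_comp _ _ _ _ _ _ phi).
Qed.

Lemma poisson_discrepancy (t : R) (A : set nat) : 0 < t -> (Bh < +oo)%E ->
  `|fine (Q (f @^-1` A)) - pmass t A| <=
  Num.min 1 (Num.sqrt (2 / (expR 1 * t))) * `|t - mu| +
  (1 - expR (- t)) / t * (Ex Q (fun x => `|t - ZE Q f x|) + fine Bh).
Proof.
move=> t0 By.
set c1 := Num.min _ _; set c2 := (1 - _) / t.
pose phi := stein_sol t A.
have hphi k : `|phi k| <= c1 by exact: stein_sol_le.
have dphi k : `|phi k.+1 - phi k| <= c2 by exact: stein_sol_diff_le.
have c20 : 0 <= c2 by exact: le_trans (dphi 0%N).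
(* The averaging calculus asks for nonnegative test functions. The shift changes neither the
   increments nor E (F - mu) phi(F). *)
pose psi k := phi k + c1.
have p01 k : 0 <= psi k <= 2 * c1.
  by have := hphi k; rewrite ler_norml /psi => /andP[h1 h2]; apply/andP; split; lra.
have dpsi k : `|psi k.+1 - psi k| <= c2.
  by rewrite /psi (_ : _ - _ = phi k.+1 - phi k) ?dphi//; ring.
have main := stein_discrepancy t By c20 p01 dpsi.
have mfA : measurable (f @^-1` A) by rewrite -[X in measurable X]setTI; exact: mf.
have Lp : L1 Q (fun x => phi (f x)) by exact: L1_bdd_nat hphi.
have Lp1 : L1 Q (fun x => phi (f x).+1) by apply: (@L1_bdd_nat (fun k => phi k.+1) c1).
have L1g : L1 Q g by exact: L2_L1.
have Lgp : L1 Q (fun x => g x * phi (f x)).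
  apply: L2M => //; apply: (@L2_bdd _ _ _ Q _ c1) => //.
  exact: (@measurableT_comp _ _ _ _ _ _ phi).
have eA : fine (Q (f @^-1` A)) = Ex Q (fun x => \1_A (f x)).
  rewrite /Ex /Rintegral -(setIT (f @^-1` A)) -integral_indic//.
have LA : L1 Q (fun x => \1_A (f x)).
  apply: (@L1_bdd_nat (fun k => \1_A k) 1) => k.
  by rewrite indicE ger0_norm//; case: (_ \in _).
have e1 : fine (Q (f @^-1` A)) - pmass t A =
    t * Ex Q (fun x => phi (f x).+1) - Ex Q (fun x => g x * phi (f x)).
  rewrite eA -[X in _ - X](Ex_cst Q) -ExB//; last exact: L1_cst.
  rewrite -ExZ// -ExB//; last exact: L1Z.
  by congr Ex; apply/funext => x; rewrite indicE (stein_equation t0).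
have e2 : Ex Q (fun x => psi (f x).+1 - psi (f x)) =
    Ex Q (fun x => phi (f x).+1) - Ex Q (fun x => phi (f x)).
  by rewrite -ExB//; congr Ex; apply/funext => x; rewrite /psi; ring.
have e3 : Ex Q (fun x => (g x - mu) * psi (f x)) =
    Ex Q (fun x => g x * phi (f x)) - mu * Ex Q (fun x => phi (f x)).
  have -> : (fun x => (g x - mu) * psi (f x)) =
     fun x => g x * phi (f x) - mu * phi (f x) + c1 * (g x - mu).
    by apply/funext => x; rewrite /psi; ring.
  have Lc : L1 Q (fun=> mu) by exact: L1_cst.
  rewrite ExD//; [|by apply: L1B => //; exact: L1Z|by apply: L1Z; exact: L1B].
  rewrite ExB//; last exact: L1Z.
  by rewrite [X in _ + X]ExZ ?ExB ?Ex_cst ?subrr ?mulr0 ?addr0 ?ExZ//; exact: L1B.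
have e4 : `|Ex Q (fun x => phi (f x))| <= c1.
  rewrite -[leRHS](Ex_cst Q); apply: (le_trans (Ex_abs Lp)).
  by apply: Ex_le => //; [exact: L1_abs|exact: L1_cst].
rewrite e2 e3 in main; rewrite e1.
have tm : `|(t - mu) * Ex Q (fun x => phi (f x))| <= c1 * `|t - mu|.
  by rewrite normrM mulrC ler_wpM2r.
move: main tm; move: (c2 * _) (Ex Q (fun x => phi (f x).+1)) (Ex Q (fun x => g x * phi (f x)))
  (Ex Q (fun x => phi (f x))) => a1 a2 a3 a4 h1 h2.
(* The mismatch between t and the mean is split off and costs the sup norm of phi. *)
rewrite (_ : t * a2 - a3 = (t - mu) * a4 + (t * (a2 - a4) - (a3 - mu * a4))); last by ring.
by apply: (le_trans (ler_normD _ _)); exact: lerD.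
Qed.

End stein_bound.

(** Expand E (|u| - m)^2 >= 0 with m = E |u|; an infinite second moment makes the right side
    infinite. *)
Lemma Ex_abs_le_sqrte d (T : measurableType d) (R : realType) (P : probability T R) (u : T -> R) :
  measurable_fun setT u ->
  (\int[P]_x (`|u x|)%:E <= sqrte (\int[P]_x (u x ^+ 2)%:E))%E.
Proof.
move=> mu; have [lt|] := ltP (\int[P]_x (u x ^+ 2)%:E)%E +oo%E; last first.
  by rewrite leye_eq => /eqP ->; rewrite leey.
have l2 : L2 P u.
  split=> //; apply: L1_lty => //; first exact: measurable_funX.
  by move=> x; exact: sqr_ge0.
have la := L2_abs l2; have l1 := L2_L1 la; have [_ s2] := l2.
rewrite !ExE//= lee_fin.
set m := Ex P (fun x => `|u x|).
have m0 : 0 <= m by apply: Ex_ge0 => x.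
have : 0 <= Ex P (fun x => (`|u x| - m) ^+ 2) by apply: Ex_ge0 => x; exact: sqr_ge0.
have -> : (fun x => (`|u x| - m) ^+ 2) = fun x => u x ^+ 2 - 2 * m * `|u x| + m ^+ 2.
  by apply/funext => x; rewrite -[in RHS](real_normK (num_real (u x))); ring.
have lZ : L1 P (fun x => 2 * m * `|u x|) by exact: L1Z.
rewrite ExD; [|exact: L1B|exact: L1_cst].
rewrite ExB// ExZ// Ex_cst.
rewrite -/m => h.
have : m ^+ 2 <= Ex P (fun x => u x ^+ 2) by lra.
by move/ler_wsqrtr; rewrite sqrtr_sqr ger0_norm.
Qed.

(** * The two bounds on the sequence space *)

Section total_variation_bound.
Context d' (S : measurableType d') (R : realType).
Local Notation E := (seq_space S).
Variable Q : probability E R.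
Hypothesis prodQ : forall B N, (forall j, measurable (B j)) ->
  Q (rect B N) = (\prod_(j < N) Q ((fun x : E => x j) @^-1` B j))%E.
Variable f : E -> nat.
Hypothesis mf : measurable_fun setT f.
Local Notation g := (fun x => (f x)%:R : R).
Hypothesis L2g : L2 Q g.
Implicit Types (x y : E) (i n : nat).

Let nn2g : nn2 Q g. Proof. by split=> // x; rewrite ler0n. Qed.
Let L2d i : L2 Q (dg Q f i). Proof. exact: L2_dg. Qed.
Let L2a i : L2 Q (ad Q f i). Proof. exact: L2_ad. Qed.
Let L1da i : L1 Q (fun x => dg Q f i x * ad Q f i x). Proof. exact: L2M. Qed.
Let mu := Ex Q g.
Let sg2 := Ex Q (fun x => g x ^+ 2) - mu ^+ 2.

Lemma dTV_le (t : R) : 0 < t ->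
  (dTV (pushforward Q f) (Pn t) <=
   (Num.min 1 (Num.sqrt (2 / (expR 1 * t))) * `|t - mu|)%:E +
   ((1 - expR (- t)) / t)%:E *
   (\int[Q]_x (`|t - ZE Q f x|)%:E + \int[Q]_x \sum_(0 <= i <oo) (hh Q f i x)%:E))%E.
Proof.
move=> t0; rewrite (int_sum_hh prodQ L2g).
set c2 := (1 - _) / t.
(* Strictness matters: for an infinite correction sum, [c2] times +oo must be +oo. *)
have c2p : 0 < c2 by rewrite divr_gt0// subr_gt0 -expR0 ltr_expR oppr_lt0.
set Bh := (\sum_(0 <= i <oo) _)%E.
have B0 : (0 <= Bh)%E.
  by apply: nneseries_ge0 => n _ _; apply: integral_ge0 => x _; rewrite lee_fin.
have I0 : (0 <= \int[Q]_x (`|t - ZE Q f x|)%:E)%E.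
  by apply: integral_ge0 => x _; rewrite lee_fin.
have [By|] := ltP Bh +oo%E; last first.
  rewrite leye_eq => /eqP ->; rewrite addey; last first.
    by rewrite gt_eqF// (lt_le_trans _ I0).
  by rewrite gt0_muley ?lte_fin// addey// leey.
have [_ LZ _] := series_L1_cvg L1da (summable_da prodQ mf L2g By).
have Lt : L1 Q (fun x => t - ZE Q f x) by apply: L1B => //; exact: L1_cst.
rewrite (ExE (L1_abs Lt)) -[Bh]fineK ?ge0_fin_numE//.
apply: ub_ereal_sup => _ [A _ <-].
have mfA : measurable (f @^-1` A) by rewrite -[X in measurable X]setTI; exact: mf.
rewrite PnE /pushforward -[Q _]fineK ?fin_num_measure// -EFinB/= lee_fin.
exact: (poisson_discrepancy prodQ mf L2g).
Qed.

(** E a_i^2 = E a_i D_i F is at most the mean of E a_i^2 and E (D_i F)^2. *)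
Lemma Ex_ad_sq_le i : Ex Q (fun x => ad Q f i x ^+ 2) <= Ex Q (fun x => dg Q f i x ^+ 2).
Proof.
have [_ sa] := L2a i; have [_ sd] := L2d i.
have h : Ex Q (fun x => ad Q f i x ^+ 2) <=
    Ex Q (fun x => 2^-1 * (ad Q f i x ^+ 2 + dg Q f i x ^+ 2)).
  rewrite -(Ex_ad_dg prodQ L2g); apply: Ex_le => //; first exact: L2M.
    by apply: L1Z; exact: L1D.
  by move=> x; have := sqr_ge0 (ad Q f i x - dg Q f i x); lra.
move: h; rewrite (ExZ _ (L1D sa sd)) (ExD sa sd).
by move: (Ex Q _) (Ex Q _) => a b; lra.
Qed.

Lemma int_abs_da_le i :
  (\int[Q]_x (`|dg Q f i x * ad Q f i x|)%:E <= \int[Q]_x (dg Q f i x ^+ 2)%:E)%E.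
Proof.
have [_ sa] := L2a i; have [_ sd] := L2d i.
rewrite !ExE//; last exact: L1_abs.
rewrite lee_fin; apply: (@le_trans _ _
    (Ex Q (fun x => 2^-1 * (ad Q f i x ^+ 2 + dg Q f i x ^+ 2)))).
  apply: Ex_le; [exact: L1_abs|by apply: L1Z; exact: L1D|move=> x].
  rewrite ler_norml; apply/andP; have := sqr_ge0 (ad Q f i x - dg Q f i x).
  by have := sqr_ge0 (ad Q f i x + dg Q f i x); split; lra.
rewrite (ExZ _ (L1D sa sd)) (ExD sa sd).
by have := Ex_ad_sq_le i; move: (Ex Q _) (Ex Q _) => a b; lra.
Qed.

Let lyap k := (\sum_(0 <= i <oo) \int[Q]_x (`|dg Q f i x| ^+ k)%:E)%E.

Let lyap_ge0 k : (0 <= lyap k)%E.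
Proof.
apply: nneseries_ge0 => n _ _; apply: integral_ge0 => x _.
by rewrite lee_fin exprn_ge0.
Qed.

Lemma int_sum_hh_le :
  (\int[Q]_x \sum_(0 <= i <oo) (hh Q f i x)%:E <= 2%:E * lyap 3 + lyap 2)%E.
Proof.
rewrite (int_sum_hh prodQ L2g) -nneseriesZl; last first.
  by move=> i _; apply: integral_ge0 => x _; rewrite lee_fin exprn_ge0.
rewrite -nneseriesD; last 2 first.
- by move=> i _ _; rewrite mule_ge0//; apply: integral_ge0 => x _; rewrite lee_fin exprn_ge0.
- by move=> i _ _; apply: integral_ge0 => x _; rewrite lee_fin exprn_ge0.
apply: lee_nneseries => i _; first by move=> _; apply: integral_ge0 => x _; rewrite lee_fin.
apply: (@le_trans _ _ (\int[Q]_x ((vv Q f i x * `|ad Q f i x|)%:E +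
    (`|dg Q f i x * ad Q f i x|)%:E))%E).
  have mvv := measurable_vv L2g i.
  have [ma' _] := L2a i; have [md _] := L2d i.
  have m1 : measurable_fun setT (fun x => vv Q f i x * `|ad Q f i x|).
    by apply: measurable_funM => //; exact: measurableT_comp.
  have m2 : measurable_fun setT (fun x => `|dg Q f i x * ad Q f i x|).
    by apply: measurableT_comp => //; exact: measurable_funM.
  apply: ge0_le_integral => //.
  - apply/measurable_EFinP; apply: measurableT_comp => //.
    exact: measurable_hh.
  - by apply/measurable_EFinP; exact: measurable_funD.
  - move=> x _; rewrite -EFinD lee_fin /hh mulrDl.
    apply: (le_trans (ler_normD _ _)).
    by rewrite !normrM normr_id lerD// ger0_norm// vv_ge0.
rewrite ge0_integralD//; last 3 first.
- by move=> x _; rewrite lee_fin mulr_ge0// vv_ge0.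
- apply/measurable_EFinP; apply: measurable_funM; first exact: measurable_vv.
  by apply: measurableT_comp => //; have [] := L2a i.
- by apply/measurable_EFinP; apply: measurableT_comp => //; exact: L1_meas (L1da i).
apply: leeD; first exact: (int_vv_ad_le prodQ L2g).
under [leRHS]eq_integral do rewrite real_normK ?num_real//.
exact: int_abs_da_le.
Qed.

(** A finite L_2 makes Z integrable, with mean the sum of the E a_i D_i F = E a_i^2, which is the
    variance. Then Cauchy-Schwarz applies to Z minus its mean. *)
Lemma int_abs_ZE_le (t : R) : (lyap 2 < +oo)%E ->
  (\int[Q]_x (`|t - ZE Q f x|)%:E <= (`|t - sg2|)%:E + sqrte 'V_Q[ZE Q f])%E.
Proof.
move=> Ly.
have sda : (\sum_(0 <= i <oo) \int[Q]_x (`|dg Q f i x * ad Q f i x|)%:E < +oo)%E.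
  apply: le_lt_trans Ly; apply: lee_nneseries => i _.
    by move=> _; apply: integral_ge0 => x _; rewrite lee_fin.
  under [leRHS]eq_integral do rewrite real_normK ?num_real//.
  exact: int_abs_da_le.
have [_ LZ _] := series_L1_cvg L1da sda; rewrite -/(ZE Q f) in LZ.
have eZ : Ex Q (ZE Q f) = sg2.
  have c1 := Ex_series_cvg L1da sda; rewrite -/(ZE Q f) in c1.
  have c2 := sum_ad_sq_cvg prodQ mf L2g.
  have e : (fun n => \sum_(i < n) Ex Q (fun x => dg Q f i x * ad Q f i x)) =
      fun n => \sum_(i < n) Ex Q (fun x => ad Q f i x ^+ 2).
    apply/funext => n; apply: eq_bigr => i _.
    rewrite -(Ex_ad_dg prodQ L2g i).
    by congr Ex; apply/funext => x; rewrite mulrC.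
  rewrite e in c1.
  by rewrite -(cvg_lim (@Rhausdorff R) c1) (cvg_lim (@Rhausdorff R) c2).
have -> : ('V_Q[ZE Q f] = \int[Q]_x ((ZE Q f x - sg2) ^+ 2)%:E)%E.
  rewrite /variance unlock unlock.
  by rewrite -[fine (\int[Q]_x _)%E]/(Ex Q (ZE Q f)) eZ.
have mZ := measurable_ZE prodQ L2g.
have mZs : measurable_fun setT (fun x => ZE Q f x - sg2) by exact: measurable_funB.
apply: le_trans (leeD (lexx _) (Ex_abs_le_sqrte Q mZs)).
have Lt : L1 Q (fun x => t - ZE Q f x) by apply: L1B => //; exact: L1_cst.
have Ls : L1 Q (fun x => ZE Q f x - sg2) by apply: L1B => //; exact: L1_cst.
rewrite (ExE (L1_abs Lt)) (ExE (L1_abs Ls)) -EFinD lee_fin -[X in X + _](Ex_cst Q) -ExD.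
- apply: Ex_le; [exact: L1_abs|by apply: L1D; [exact: L1_cst|exact: L1_abs]|move=> x].
  by rewrite (_ : t - ZE Q f x = (t - sg2) - (ZE Q f x - sg2)) ?ler_normB//; ring.
- exact: L1_cst.
- exact: L1_abs.
Qed.

Lemma int_ZE_hh_le (t : R) :
  (\int[Q]_x (`|t - ZE Q f x|)%:E + \int[Q]_x \sum_(0 <= i <oo) (hh Q f i x)%:E <=
   (`|t - sg2|)%:E + sqrte 'V_Q[ZE Q f] + 2%:E * lyap 3 + lyap 2)%E.
Proof.
have V0 : (0 <= sqrte 'V_Q[ZE Q f])%E by exact: sqrte_ge0.
(* If L_2 is infinite, so is the right side, its other terms being nonnegative. *)
have [Ly|] := ltP (lyap 2) +oo%E; last first.
  rewrite leye_eq => /eqP ->; rewrite addey ?leey//.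
  rewrite gt_eqF// (@lt_le_trans _ _ 0%E)//.
  by rewrite adde_ge0 ?mule_ge0 ?adde_ge0 ?lee_fin.
by rewrite -[leRHS]addeA; apply: leeD; [exact: int_abs_ZE_le|exact: int_sum_hh_le].
Qed.

End total_variation_bound.

(** * Transfer to the underlying probability space *)

Section cond_exp_uniqueness.
Context d (T : measurableType d) (R : realType) (P : probability T R).

(** Integrals over sets of G determine a function almost everywhere on a space whose measurable sets
    are those of G. The versions are compared there, under the image of P by the identity, and the
    null set is brought back. *)
Lemma is_cond_exp_ae_eq (G : set_system T) (Y V W : T -> R) :
  sigma_algebra setT G -> G `<=` measurable ->
  is_cond_exp P G Y V -> is_cond_exp P G Y W -> {ae P, forall w, V w = W w}.
Proof.
move=> sG Gm [gV iV eV] [gW iW eW].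
have GE : <<s G >> = G by exact: sigma_algebra_id.
pose i : T -> g_sigma_algebraType G := idfun.
have mi : measurable_fun setT i.
  by move=> _ B; rewrite setTI /measurable/= GE; exact: Gm.
pose I : {mfun T >-> g_sigma_algebraType G} :=
  HB.pack i (isMeasurableFun.Build _ _ _ _ i mi).
pose Q : probability _ R := distribution P I.
have mG (U : T -> R) : (forall B : set R, measurable B -> G (U @^-1` B)) ->
    measurable_fun setT (EFin \o U : g_sigma_algebraType G -> \bar R).
  move=> gU; apply/measurable_EFinP => _ B mB.
  by rewrite setTI /measurable/= GE; exact: gU.
have iQ (U : T -> R) : (forall B : set R, measurable B -> G (U @^-1` B)) ->
    P.-integrable setT (EFin \o U) -> Q.-integrable setT (EFin \o U).
  by move=> gU iU; apply: integrable_pushforward => //; exact: mG.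
have iE (U : T -> R) A : (forall B : set R, measurable B -> G (U @^-1` B)) ->
    P.-integrable setT (EFin \o U) -> G A ->
    (\int[Q]_(w in A) (U w)%:E = \int[P]_(w in A) (U w)%:E)%E.
  move=> gU iU GA; rewrite integral_pushforward//.
  - exact: mG.
  - by apply: integrableS iU => //; exact: Gm.
  - by rewrite /measurable/= GE.
have [N [mN QN VN]] : ae_eq Q setT (EFin \o V) (EFin \o W).
  apply: integral_ae_eq => //; [exact: iQ|exact: mG|move=> A _].
  rewrite /measurable/= GE => GA.
  by rewrite !iE// eV// eW.
exists N; split => //; first by move: mN; rewrite /measurable/= GE; exact: Gm.
move=> w /= h; apply: VN => /= e; apply: h; apply: EFin_inj; exact: e.
Qed.

End cond_exp_uniqueness.

(** * The filtration seen from the sequence space *)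

Section filtration.
Context d d' (T : measurableType d) (S : measurableType d') (R : realType).
Variable P : probability T R.
Variable X : nat -> {RV P >-> S}.
Local Notation E := (seq_space S).
Implicit Types (i : nat) (x y : E).

Lemma measurable_seq_of : measurable_fun setT (seq_of X).
Proof. by apply: measurable_seq => i; exact: measurable_funPT. Qed.

Lemma filtration_sub i : filtration X i `<=` measurable.
Proof.
apply: smallest_sub; first exact: sigma_algebra_measurable.
by move=> _ [k _ [B mB <-]]; rewrite setTI -[X in measurable X]setTI; exact: measurable_funPT.
Qed.

(** Sets of this form are a sigma-algebra containing the generators. The invariance is what
    [Ex_inv_ad] asks of an indicator. *)
Lemma filtration_invariant i A : filtration X i A -> exists B : set E,
  [/\ measurable B, A = seq_of X @^-1` B & forall x y, B (rep (tail i.+1) x y) <-> B x].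
Proof.
move: A; apply: smallest_sub.
- split.
  + by exists set0; split.
  + move=> A [B [mB -> iB]]; exists (~` B); split.
    * exact: measurableC.
    * by rewrite setTD.
    * by move=> x y; split=> h /(iB x y).
  + move=> F hF; have /choice[G hG] := hF.
    exists (\bigcup_k G k); split.
    * by apply: bigcup_measurable => k _; have [] := hG k.
    * by rewrite preimage_bigcup; apply: eq_bigcupr => k _; have [] := hG k.
    * move=> x y; split=> -[k _ h]; exists k => //; have [_ _ iG] := hG k.
        by apply/(iG x y).
      by apply/(iG x y).
- move=> _ [k /= ki [B mB <-]]; exists ((fun x : E => x k) @^-1` B); split.
  + by rewrite -[X in measurable X]setTI; exact: measurable_coord.
  + by rewrite setTI.
  + by move=> x y; rewrite /= /rep /tail ltnNge ki.
Qed.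

Lemma invariant_filtration i (u : E -> R) (B : set R) : measurable_fun setT u ->
  (forall x y, u (rep (tail i.+1) x y) = u x) -> measurable B ->
  filtration X i ((u \o seq_of X) @^-1` B).
Proof.
move=> mu iu mB.
have [->|/set0P[w0 _]] := eqVneq ((u \o seq_of X) @^-1` B) set0.
  by have [] : sigma_algebra setT (filtration X i) := smallest_sigma_algebra _ _.
pose G := \bigcup_(k in [set k | (k <= i)%N])
  preimage_set_system setT (X k : T -> S) measurable.
pose h : g_sigma_algebraType G -> E := fun w => rep (tail i.+1) (seq_of X w) (seq_of X w0).
have mh : measurable_fun setT h.
  apply: measurable_seq => k; rewrite /h /rep /tail.
  case: ltnP => ik; first exact: measurable_cst.
  move=> _ C mC; rewrite setTI; apply: sub_sigma_algebra.
  by exists k => //; exists C => //; rewrite setTI.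
have muh : measurable_fun setT (u \o h) by exact: measurableT_comp.
have -> : (u \o seq_of X) @^-1` B = (u \o h) @^-1` B.
  by apply/funext => w; rewrite /= /h iu.
by have := muh measurableT _ mB; rewrite setTI.
Qed.

End filtration.

(** * The law of X *)

Section law.
Context d d' (T : measurableType d) (S : measurableType d') (R : realType).
Variable P : probability T R.
Variable X : nat -> {RV P >-> S}.
Local Notation E := (seq_space S).
Implicit Types (i : nat) (x y : E).

HB.instance Definition _ := isMeasurableFun.Build _ _ _ _ (seq_of X) (measurable_seq_of X).

Definition law : probability E R := distribution P (seq_of X).

Lemma lawE A : law A = P (seq_of X @^-1` A). Proof. by []. Qed.

Lemma law_rect : independent_seq X -> forall B N, (forall j, measurable (B j)) ->
  law (rect B N) = (\prod_(j < N) law ((fun x : E => x j) @^-1` B j))%E.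
Proof.
move=> indX B N mB; rewrite lawE.
rewrite -(big_mkord xpredT (fun j => P (seq_of X @^-1` ((fun x : E => x j) @^-1` B j)))).
rewrite /index_iota subn0 -(indX _ B (iota_uniq 0 N) mB); congr (P _).
apply/seteqP; split=> w h j /=; last by move=> jN; apply: h; rewrite /= mem_iota.
by rewrite mem_iota => /andP[_]; exact: h.
Qed.

Lemma integral_law (h : E -> \bar R) : measurable_fun setT h ->
  (\int[law]_x h x = \int[P]_w h (seq_of X w))%E.
Proof.
move=> mh; rewrite integralE [RHS]integralE.
rewrite !ge0_integral_pushforward//.
- by rewrite preimage_setT -funepos_comp -funeneg_comp.
- exact: measurable_funeneg.
- exact: measurable_funepos.
Qed.

Lemma Ex_law (u : E -> R) : measurable_fun setT u -> Ex law u = Ex P (u \o seq_of X).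
Proof. by move=> mu; rewrite /Ex /Rintegral integral_law//; exact/measurable_EFinP. Qed.

Lemma L1_law (u : E -> R) : L1 law u -> L1 P (u \o seq_of X).
Proof.
move=> /integrableP[mu iu]; apply/integrableP; split.
  by apply: (measurableT_comp mu); exact: measurable_seq_of.
by move: iu; rewrite integral_law//; exact: measurableT_comp.
Qed.

Lemma L2_law (u : E -> R) : measurable_fun setT u -> L2 P (u \o seq_of X) -> L2 law u.
Proof.
move=> mu [_ iu]; split=> //; apply: L1_lty; first exact: measurable_funX.
  by move=> x; exact: sqr_ge0.
rewrite integral_law; last by apply/measurable_EFinP; exact: measurable_funX.
have := L1_lty_int iu; congr (_ < _)%E.
by apply: eq_integral => w _; rewrite ger0_norm ?sqr_ge0.
Qed.

End law.

(** * Identification of the quantities of the theorem under the law of X *)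

Section functional.
Context d d' (T : measurableType d) (S : measurableType d') (R : realType).
Variable P : probability T R.
Variables X X' : nat -> {RV P >-> S}.
Local Notation E := (seq_space S).
Hypothesis indX : independent_seq X.
Hypothesis copyX : independent_copy X X'.
Variable f : E -> nat.
Hypothesis mf : measurable_fun setT f.
Local Notation g := (fun x => (f x)%:R : R).
Local Notation Q := (law X).
Hypothesis L2g : L2 Q g.
Implicit Types (i : nat) (x y : E).

Let prodQ := law_rect indX.
Let mg : measurable_fun setT g. Proof. by have [] := L2g. Qed.

Lemma DopE i w : Dop X g i w = dg Q f i (seq_of X w).
Proof.
rewrite /Dop /dg /Ei unlock; congr (_ - fine _).
rewrite -(@integral_law _ _ _ _ _ _ X (fun y => (g (rep (single i) (seq_of X w) y))%:E)) //.
by apply/measurable_EFinP; apply: (measurableT_comp mg); exact: measurable_repx.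
Qed.

Lemma law_copy A : measurable A -> law X' A = law X A.
Proof. by move=> mA; have [+ _] := copyX; exact. Qed.

Lemma dopE i w : 2 * dop X X' g i w ^+ 2 = vv Q f i (seq_of X w).
Proof.
have -> : vv Q f i (seq_of X w) = fine 'E_P[fun w' =>
    `|g (seq_of X w) - Tshift g i (seq_of X w) (seq_of X' w')| ^+ 2]; last first.
  rewrite /dop sqr_sqrtr; first by rewrite mulrA divff ?mul1r.
  rewrite mulr_ge0// fine_ge0// unlock; apply: integral_ge0 => w' _.
  by rewrite lee_fin exprn_ge0.
rewrite unlock.
pose h y := ((g (seq_of X w) - g (rep (single i) (seq_of X w) y)) ^+ 2)%:E : \bar R.
have mh : measurable_fun setT h.
  apply/measurable_EFinP; apply: measurable_funX; apply: measurable_funB => //.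
  by apply: (measurableT_comp mg); exact: measurable_repx.
transitivity (fine (\int[law X']_y h y)).
  congr fine; apply: eq_measure_integral => A mA _; exact/esym/law_copy.
rewrite (integral_law X' mh); congr fine; apply: eq_integral => w' _.
by rewrite /h real_normK ?num_real.
Qed.

Let iD i : P.-integrable setT (EFin \o Dop X g i).
Proof.
have -> : Dop X g i = dg Q f i \o seq_of X by apply/funext => w; exact: DopE.
exact: L1_law (L2_L1 (L2_dg prodQ L2g i)).
Qed.

Let sF i : sigma_algebra setT (filtration X i).
Proof. exact: smallest_sigma_algebra. Qed.

Let condDP i : is_cond_exp P (filtration X i) (Dop X g i) (condD X g i).
Proof. by apply: cond_expP => //; exact: filtration_sub. Qed.

Lemma measurable_condD i : measurable_fun setT (condD X g i).
Proof. by have [_ /L1_meas] := condDP i. Qed.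

(** By uniqueness of versions: [ad i] ignores later coordinates, and over a set of F_i, the preimage
    of an invariant B, it integrates like D_i F by [Ex_inv_ad]. *)
Lemma condDE i : {ae P, forall w, condD X g i w = ad Q f i (seq_of X w)}.
Proof.
have L2a := L2_ad prodQ L2g i; have L2d := L2_dg prodQ L2g i.
have eD : Dop X g i = dg Q f i \o seq_of X by apply/funext => w; exact: DopE.
apply: (is_cond_exp_ae_eq (sF i) _ (condDP i)); first exact: filtration_sub.
split.
- move=> B mB; apply: invariant_filtration => //; first by case: L2a.
  by move=> x y; exact: ad_rep.
- exact: L1_law (L2_L1 L2a).
move=> A /filtration_invariant[B [mB -> iB]].
have nb : nn2 Q (\1_B : E -> R).
  split; first by move=> x; rewrite indicE.
  apply: (@L2_bdd _ _ _ Q _ 1) => [|x]; first exact: measurable_indic.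
  by rewrite indicE; case: (_ \in _); rewrite ?normr1 ?normr0.
have e (u : E -> R) : L2 Q u ->
    (\int[P]_(w in seq_of X @^-1` B) (u (seq_of X w))%:E =
     (Ex Q (fun x => \1_B x * u x))%:E)%E.
  move=> Lu; have [_ Lb] := nb.
  rewrite -(ExE (L2M Lb Lu)) integral_law; last first.
    by apply/measurable_EFinP; exact: L1_meas (L2M Lb Lu).
  rewrite integral_mkcond; apply: eq_integral => w _.
  rewrite patchE indicE [w \in _](_ : _ = (seq_of X w \in B))//.
  by case: (_ \in B); rewrite ?mul1r ?mul0r.
have ib x y : \1_B (rep (tail i.+1) x y) = \1_B x :> R.
  by rewrite !indicE; congr (_%:R); congr nat_of_bool; apply/idP/idP => /set_mem/iB/mem_set.
rewrite eD; apply: (eq_trans (e _ L2a)); apply: (eq_trans _ (esym (e _ L2d))).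
exact: (congr1 EFin (esym (Ex_inv_ad prodQ L2g nb ib))).
Qed.

Lemma integral_ae_law (h : E -> \bar R) (k : T -> \bar R) :
  measurable_fun setT h -> measurable_fun setT k ->
  {ae P, forall w, k w = h (seq_of X w)} -> (\int[P]_w k w = \int[Q]_x h x)%E.
Proof.
move=> mh mk kh; rewrite integral_law//; apply: ae_eq_integral => //.
  by apply: (measurableT_comp mh); exact: measurable_seq_of.
by apply: filterS kh.
Qed.

Lemma lyapunovE n :
  (lyapunov X g n.+1%:R = \sum_(0 <= i <oo) \int[Q]_x (`|dg Q f i x| ^+ n.+1)%:E)%E.
Proof.
apply: eq_eseriesr => i _; rewrite unlock integral_law.
  by apply: eq_integral => w _; rewrite powR_mulrn// DopE.
apply/measurable_EFinP; apply: measurable_funX; apply: measurableT_comp => //.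
exact: L1_meas (L2_L1 (L2_dg prodQ L2g i)).
Qed.

(** The series over i call for one null set common to all indices. *)
Let condDE_all : {ae P, forall w, forall i, condD X g i w = ad Q f i (seq_of X w)}.
Proof. by apply/ae_foralln; exact: condDE. Qed.

Let mDop i : measurable_fun setT (Dop X g i).
Proof. exact: L1_meas (iD i). Qed.

Lemma measurable_Zvar : measurable_fun setT (Zvar X g).
Proof.
apply: measurable_fun_limn => n; apply: measurable_sum => i.
by apply: measurable_funM => //; exact: measurable_condD.
Qed.

Lemma ZvarE : {ae P, forall w, Zvar X g w = ZE Q f (seq_of X w)}.
Proof.
apply: filterS condDE_all => w h; rewrite /Zvar /ZE.
do 2 f_equal; apply/funext => n; apply: eq_bigr => i _.
by rewrite DopE h.
Qed.

Lemma E_dist_Zvar (t : R) :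
  ('E_P[fun w => `|t - Zvar X g w|%R] = \int[Q]_x (`|t - ZE Q f x|)%:E)%E.
Proof.
rewrite unlock; apply: integral_ae_law.
- apply/measurable_EFinP; apply: measurableT_comp => //; apply: measurable_funB => //.
  exact: (measurable_ZE prodQ L2g).
- apply/measurable_EFinP; apply: measurableT_comp => //; apply: measurable_funB => //.
  exact: measurable_Zvar.
- by apply: filterS ZvarE => w ->.
Qed.

Lemma V_Zvar : ('V_P[Zvar X g] = 'V_Q[ZE Q f])%E.
Proof.
have mZ := measurable_Zvar; have mZE := measurable_ZE prodQ L2g.
have eE : ('E_P[Zvar X g] = 'E_Q[ZE Q f])%E.
  rewrite unlock; apply: integral_ae_law; [exact/measurable_EFinP|exact/measurable_EFinP|].
  by apply: filterS ZvarE => w h; congr EFin.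
rewrite /variance !(covariance.unlock) eE unlock; apply: integral_ae_law.
- by apply/measurable_EFinP; apply: measurable_funM; exact: measurable_funB.
- by apply/measurable_EFinP; apply: measurable_funM; exact: measurable_funB.
- by apply: filterS ZvarE => w h; rewrite !mulrfctE/= h.
Qed.

Lemma integral_sum_hh :
  (\int[P]_w \sum_(0 <= i <oo)
     ((2 * dop X X' g i w ^+ 2 + Dop X g i w) * `|condD X g i w|)%:E =
   \int[Q]_x \sum_(0 <= i <oo) (hh Q f i x)%:E)%E.
Proof.
apply: integral_ae_law.
- apply: emeasurable_fun_limn => n; apply: emeasurable_sum => i.
  by apply/measurable_EFinP; exact: measurable_hh.
- apply: emeasurable_fun_limn => n; apply: emeasurable_sum => i.
  apply/measurable_EFinP; under eq_fun do rewrite dopE.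
  apply: measurable_funM; last by apply: measurableT_comp => //; exact: measurable_condD.
  apply: measurable_funD => //.
  by apply: (measurableT_comp (measurable_vv L2g i)); exact: measurable_seq_of.
- apply: filterS condDE_all => w h; apply: eq_eseriesr => i _.
  by rewrite dopE DopE h.
Qed.

End functional.

Theorem theorem4p1 (d d' : measure_display) (T : measurableType d)
  (S : measurableType d') (R : realType) (P : probability T R)
  (X X' : nat -> {RV P >-> S})
  (indX : independent_seq X)
  (copyX : independent_copy X X')
  (f : seq_space S -> nat)
  (mf : measurable_fun [set: seq_space S] f)
  (g := (fun x => (f x)%:R) : seq_space S -> R)
  (F := f \o seq_of X)
  (L2F : (fun w => (F w)%:R) \in Lfun P 2%:E)
  (mu sigma : R)
  (meanF : ('E_P[fun w => ((F w)%:R)%R] = mu%:E)%E)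
  (varF : ('V_P[fun w => ((F w)%:R)%R] = (sigma ^+ 2)%:E)%E)
  (theta : R)
  (theta_gt0 : 0 < theta) :
  let c1 := Num.min 1 (Num.sqrt (2 / (expR 1 * theta))) in
  let c2 := (1 - expR (- theta)) / theta in
  let Z := Zvar X g in
  let bound1 :=
    ((c1 * `|theta - mu|)%:E + c2%:E *
      ('E_P[fun w => `|theta - Z w|%R] +
       \int[P]_w \sum_(0 <= i <oo)
         ((2 * dop X X' g i w ^+ 2 + Dop X g i w) * `|condD X g i w|)%:E))%E in
  let bound2 :=
    ((c1 * `|theta - mu|)%:E + c2%:E *
      (`|theta - sigma ^+ 2|%:E + sqrte 'V_P[Z] +
       2%:E * lyapunov X g 3 + lyapunov X g 2))%E in
  (dTV (pushforward P F) (Pn theta) <= bound1)%E /\ (bound1 <= bound2)%E.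
Proof.
move=> c1 c2 Z bound1 bound2.
have mg : measurable_fun setT g.
  by apply: (@measurableT_comp _ _ _ _ _ _ (fun n : nat => n%:R : R) _ f).
have c2_ge0 : 0 <= c2.
  by rewrite divr_ge0 ?(ltW theta_gt0)// subr_ge0 -expR0 ler_expR oppr_le0 ltW.
have L2gX : L2 P (g \o seq_of X).
  split; last exact: (Lfun2_integrable_sqr L2F).
  by apply: (measurableT_comp mg); exact: measurable_seq_of.
have L2g : L2 (law X) g by exact: L2_law.
have muE : mu = Ex (law X) g.
  by rewrite Ex_law//; apply: EFin_inj; rewrite -meanF unlock -ExE//; exact: L2_L1.
have sigmaE : sigma ^+ 2 = Ex (law X) (fun x => g x ^+ 2) - Ex (law X) g ^+ 2.
  have [_ sq] := L2gX.
  apply: EFin_inj; rewrite -varF varianceE// meanF EFinB -muE EFin_expe.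
  congr (_ - _)%E; rewrite unlock Ex_law; last exact: measurable_funX.
  by rewrite -ExE.
have prodQ := law_rect indX.
have eZ : ('E_P[fun w => `|theta - Z w|%R] = \int[law X]_x (`|theta - ZE (law X) f x|)%:E)%E.
  exact: (E_dist_Zvar indX L2g).
have eS := integral_sum_hh indX copyX L2g.
rewrite /bound1 /bound2 eZ eS; split.
  rewrite muE; exact: (dTV_le prodQ mf L2g theta_gt0).
apply: leeD => //; apply: lee_wpmul2l; first by rewrite lee_fin.
rewrite sigmaE (V_Zvar indX L2g) (lyapunovE indX L2g 2) (lyapunovE indX L2g 1).
exact: (int_ZE_hh_le prodQ mf L2g).
Qed.
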